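(* Let $d,q$ be positive integers and set $n=(q+1)d$. There exists an explicit real constant $C_d$ such that for every real $\alpha\ge C_d$ there exists a linear subspace $A$ of $\mathbb{R}^n$ of dimension $d$ such that $A\in\bigcap_{e=1}^{n-d}\mathcal{I}_n(d,e)_{\min(d,e)}$ and \[ \forall e\in\{d,\dots,n-d\},\quad \mu_n(A\mid e)_d=\frac{\alpha^{q_e+1}}{r_e+(d-r_e)\alpha},\qquad \forall e\in\{1,\dots,d-1\},\quad \mu_n(A\mid e)_e=\frac{\alpha}{r_e}=\frac{\alpha}{e}, \] where $q_e$ and $r_e$ are the quotient and remainder of the Euclidean division of $e$ by $d$.
   Context: A subspace of $\mathbb{R}^n$ is rational if it has a basis of vectors in $\mathbb{Q}^n$; $\mathcal{R}_n(e)$ is the set of rational subspaces of dimension $e$. The height of a rational subspace $B$ is $H(B)=\|X_1\wedge\cdots\wedge X_e\|$ where $X_1,\dots,X_e$ is a $\mathbb{Z}$-basis of $B\cap\mathbb{Z}^n$ (equivalently the Euclidean norm of its primitive integer Plücker coordinate vector). For nonzero $X,Y\in\mathbb{R}^n$, $\omega(X,Y)=\frac{\|X\wedge Y\|}{\|X\|\|Y\|}$. For subspaces $A,B$ of dimensions $d,e$ and $t=\min(d,e)$, the angles $\psi_1(A,B)\le\dots\le\psi_t(A,B)$ are defined inductively: $\psi_1(A,B)=\min\{\omega(X,Y):X\in A\setminus\{0\},Y\in B\setminus\{0\}\}$ attained at $(X_1,Y_1)$; given $(X_1,Y_1),\dots,(X_j,Y_j)$, let $A_j$ (resp. $B_j$)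 be the orthogonal complement of $\mathrm{Span}(X_1,\dots,X_j)$ in $A$ (resp. of $\mathrm{Span}(Y_1,\dots,Y_j)$ in $B$), and $\psi_{j+1}(A,B)=\min\{\omega(X,Y):X\in A_j\setminus\{0\},Y\in B_j\setminus\{0\}\}$ attained at $(X_{j+1},Y_{j+1})$. For $d+e\le n$ and $j\le\min(d,e)$, a $d$-dimensional subspace $A$ is $(e,j)$-irrational if $\dim(A\cap B)<j$ for every $B\in\mathcal{R}_n(e)$; the set of these is $\mathcal{I}_n(d,e)_j$. For $A\in\mathcal{I}_n(d,e)_j$, $\mu_n(A\mid e)_j$ is the supremum of all $\mu>0$ such that there are infinitely many $B\in\mathcal{R}_n(e)$ with $\psi_j(A,B)\le H(B)^{-\mu}$. *)

(* Defs.v *)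
From HB Require Import structures.
From mathcomp Require Import all_boot all_order all_algebra.
From mathcomp Require Import all_classical all_reals all_analysis.

Set Implicit Arguments.
Unset Strict Implicit.
Unset Printing Implicit Defensive.

Import Order.TTheory GRing.Theory Num.Theory.

Local Open Scope classical_set_scope.
Local Open Scope ring_scope.

Section RationalApproximation.
Context {R : realType} {n : nat}.
Implicit Types (A B : {vspace 'rV[R]_n}) (v w : 'rV[R]_n).

Definition dotr v w : R := \sum_(i < n) v 0 i * w 0 i.

(* Not `|v|, which on matrices is the sup norm. *)
Definition enorm v : R := Num.sqrt (dotr v v).

(* Norm of the wedge product of the rows of M: its coordinates in the
   orthonormal basis e_(f 0) /\ ... /\ e_(f (e-1)), f strictly increasing, of
   the e-th exterior power of R^n are the maximal minors of M. *)
Definition wedge_norm {e : nat} (M : 'M[R]_(e, n)) : R :=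
  Num.sqrt (\sum_(f : {ffun 'I_e -> 'I_n} |
                   [forall i : 'I_e, forall j : 'I_e, (i < j)%N ==> (f i < f j)%N])
              \det (colsub f M) ^+ 2).

Definition omega v w : R := wedge_norm (col_mx v w) / (enorm v * enorm w).

Definition rational_subspace B : Prop :=
  exists s : seq 'rV[rat]_n, basis_of B (map (map_mx ratr) s).

Definition rational_subspaces (e : nat) : set {vspace 'rV[R]_n} :=
  [set B | rational_subspace B /\ \dim B = e].

(* The rows of M form a Z-basis of the intersection of B with Z^n. *)
Definition Zbasis B {e : nat} (M : 'M[int]_(e, n)) : Prop :=
  (forall c : 'rV[int]_e, map_mx intr (c *m M) \in B) /\
  (forall x : 'rV[int]_n, map_mx intr x \in B ->
     exists! c : 'rV[int]_e, x = c *m M).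

(* The set is a singleton when B is rational; otherwise the value may be the
   default one. *)
Definition height B : R :=
  xget 1 [set h | exists2 M : 'M[int]_(\dim B, n),
                    Zbasis B M & h = wedge_norm (map_mx intr M)].

(* The orthogonal complement of Span(X 1, ..., X k) in A, minus 0. *)
Definition orth_nonzero A (X : nat -> 'rV[R]_n) (k : nat) : set 'rV[R]_n :=
  [set v | [/\ v \in A, v != 0 &
     forall w, w \in <<[seq X i | i <- iota 1 k]>>%VS -> dotr v w = 0]].

(* (X 1, Y 1), ..., (X j, Y j) are successive choices of minimizing pairs. *)
Definition minimizing_pairs A B (j : nat) (X Y : nat -> 'rV[R]_n) : Prop :=
  forall k, (k < j)%N ->
    [/\ orth_nonzero A X k (X k.+1), orth_nonzero B Y k (Y k.+1) &
        forall v w, orth_nonzero A X k v -> orth_nonzero B Y k w ->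
          omega (X k.+1) (Y k.+1) <= omega v w].

(* For 1 <= j <= min (\dim A) (\dim B) the minima are attained and the value
   does not depend on the minimizing pairs; other values of j are irrelevant. *)
Definition psi A B (j : nat) : R :=
  xget 0 [set r | exists X Y, minimizing_pairs A B j X Y /\
                              r = omega (X j) (Y j)].

Definition irrational_subspaces (d e j : nat) : set {vspace 'rV[R]_n} :=
  [set A | \dim A = d /\
           forall B, rational_subspaces e B -> (\dim (A :&: B) < j)%N].

Definition mu_exponent A (e j : nat) : \bar R :=
  ereal_sup [set mu%:E | mu in
    [set mu : R | 0 < mu /\
       infinite_set [set B | rational_subspaces e B /\
                             psi A B j <= height B `^ (- mu)]]].

End RationalApproximation.

(* Main.v *)
Require Import Defs.
From HB Require Import structures.
From mathcomp Require Import all_boot all_order all_algebra all_fingroup.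
From mathcomp Require Import all_classical all_reals all_analysis.
From mathcomp Require Import ring lra zify.

(** Identify R^n with R^(q+1) (x) R^d. Let t_0 = 1 and t_(N+1) = g_N t_N, where
    t_N divides g_N and t_(N+1) / t_N ^ alpha stays between 2 and 4 ([den],
    [ratio]); let X_0 = e_0 and X_(N+1) = g_N X_N + e_(1 + N mod q) ([numer]).
    Then x_N = X_N / t_N ([xi]) converges to a vector Y ([limxi]) at distance
    about 1 / t_(N+1), and A = Y (x) R^d ([limsp]).

    The good approximations of dimension Q d + r are spanned by
    X_N, ..., X_(N+Q-1), tensored with R^d, and by r vectors X_(N-1) (x) e_j.
    As X_(M+1) - g_M X_M is a basis vector, their height is about
    t_N ^ (d-r) t_(N-1) ^ r, and their distance to A is about 1 / t_(N+Q).

    Conversely let B be rational of dimension Q d + r >= d and close to A. An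
    integer vector outside B is at distance at least 1 / H(B) from B, so B
    contains X_M (x) R^d for Q consecutive values N, ..., N+Q-1 of M, where N
    depends on H(B), unless B is too far from A. Once it does, B having
    dimension less than (Q+1) d, its distance to A is at least c / t_(N+Q).
    Adjoining X_(N-1) (x) e_j to B multiplies the height by at most
    t_(N-1) / t_N each time the dimension increases; the final space contains
    X_M (x) R^d for N-1 <= M < N+Q, which gives the lower bound for H(B). When
    dim B < d the same window argument is run on the minors of an integer basis
    of B, and shows that B lies in X_N (x) R^d.

    Up to a factor at most the smaller dimension, the last angle between two
    subspaces is the largest distance from a unit vector of the smaller one to the
    larger. *)

Set Implicit Arguments.
Unset Strict Implicit.
Unset Printing Implicit Defensive.

Import Order.TTheory GRing.Theory Num.Theory.

Local Open Scope ring_scope.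

(** * Gram determinants *)

(** On logarithmic scale a good space of dimension Q d + r has height (d - r + r / alpha) ln t_N and
    distance - alpha ^ Q ln t_N, up to constants; the ratio is the required exponent. Only constants
    independent of B matter, so crude ones (factorials in place of Hadamard, q + 1 for norms) are
    used throughout.

    The obstacle is a rational B unrelated to the sequence. When B misses a vector of the window,
    the argument only bounds its exponent by 1 + alpha ^ (Q-1) alpha / (alpha - 1); this must stay
    below the target, which is at least alpha ^ Q / d. Hence the constant 4 d.

    Since t_N divides g_N, t_(N+1) is coprime to one coordinate of X_(N+1). It follows that t_N
    divides the coordinates along e_0 of all integer points in the span of at most q consecutive
    lines, which bounds heights from below by about t_N ^ d. The cyclic choice of e_(1 + N mod q)
    freezes one coordinate of x_N, ..., x_(N+k) for k < q: a bounded linear form kills these vectors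
    but neither x_(N+k+1) nor Y, which gives dimensions and lower bounds for distances.
    Irrationality costs nothing more: the same bounds exclude distance 0. *)

Section CauchyBinet.
Context {K : comNzRingType} {e n : nat}.
Implicit Types M N : 'M[K]_(e, n).

Definition increasing (f : {ffun 'I_e -> 'I_n}) : bool :=
  [forall i : 'I_e, forall j : 'I_e, (i < j)%N ==> (f i < f j)%N].

Lemma increasingP (f : {ffun 'I_e -> 'I_n}) :
  reflect (forall i j : 'I_e, (i < j)%N -> (f i < f j)%N) (increasing f).
Proof.
apply: (iffP idP) => [/forallP h i j ij|h].
  by move/forallP: (h i) => /(_ j) /implyP; apply.
by apply/forallP => i; apply/forallP => j; apply/implyP; apply: h.
Qed.

Lemma increasing_inj (f : {ffun 'I_e -> 'I_n}) : increasing f -> injective f.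
Proof.
move=> /increasingP h i j fij; apply: val_inj.
by case: (ltngtP i j) => // /h; rewrite fij ltnn.
Qed.

(** Distributivity over the rows of [M] produces all maps [f]; the non-injective ones disappear
    later through [det_colsub_noninj]. *)
Lemma det_mulmx_tr_ffun M N :
  \det (M *m N^T) = \sum_(f : {ffun 'I_e -> 'I_n})
     (\prod_i M i (f i)) * \det (colsub f N).
Proof.
rewrite [LHS]/determinant.
under eq_bigr => s _.
  under eq_bigr => i _ do (rewrite mxE; under eq_bigr => k _ do rewrite mxE).
  rewrite bigA_distr_bigA /=.
  over.
under eq_bigr => s _ do rewrite mulr_sumr.
rewrite exchange_big /=; apply: eq_bigr => f _.
rewrite -[in RHS]det_tr /determinant mulr_sumr; apply: eq_bigr => s _.
rewrite big_split /= mulrCA; congr (_ * (_ * _)).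
by apply: eq_bigr => i _; rewrite !mxE.
Qed.

Lemma det_colsub_noninj N (f : {ffun 'I_e -> 'I_n}) :
  ~~ injectiveb f -> \det (colsub f N) = 0.
Proof.
move=> /injectivePn[i [j ij fij]].
rewrite -det_tr; apply: (determinant_alternate ij) => k.
by rewrite !mxE fij.
Qed.

(** An injective map factors uniquely as a permutation followed by an increasing map, which turns a
    sum over injective maps into a double sum. *)
Definition reordering (p : {ffun 'I_e -> 'I_n} * {perm 'I_e}) :
  {ffun 'I_e -> 'I_n} := [ffun i => p.1 (p.2 i)].

Lemma det_colsub_reordering N g (s : {perm 'I_e}) :
  \det (colsub (reordering (g, s)) N) = (-1) ^+ s * \det (colsub g N).
Proof.
rewrite (_ : colsub _ N = col_perm s (colsub g N)); last first.
  by apply/matrixP => i j; rewrite !mxE ffunE.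
by rewrite col_permE det_mulmx det_perm mulrC odd_permV.
Qed.

Lemma sorted_codom_increasing (f : {ffun 'I_e -> 'I_n}) :
  increasing f -> sorted ltn [seq val (f i) | i <- enum 'I_e].
Proof.
move=> /increasingP h.
have : sorted ltn [seq val i | i <- enum 'I_e] by rewrite val_enum_ord iota_ltn_sorted.
rewrite !sorted_map; apply: sub_sorted => i j /=; exact: h.
Qed.

Lemma reordering_inj :
  {in [pred p | increasing p.1] &, injective reordering}.
Proof.
move=> [g s] [g' s'] /= ig ig' /ffunP eqgs.
have gs i : g (s i) = g' (s' i) by move: (eqgs i); rewrite !ffunE.
have g'inj := increasing_inj ig'.
have eg : g = g'.
  (* Both increasing maps list the same set of values, and a strictly sorted list is determined by
     its elements. *)
  have : [seq val (g i) | i <- enum 'I_e] = [seq val (g' i) | i <- enum 'I_e].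
    apply: (irr_sorted_eq ltn_trans ltnn);
      [exact: sorted_codom_increasing ig|exact: sorted_codom_increasing ig'|].
    move=> x; apply/mapP/mapP => -[i _ ->].
      exists (s' ((s^-1)%g i)); rewrite ?mem_enum//.
      by rewrite -gs permKV.
    exists (s ((s'^-1)%g i)); rewrite ?mem_enum//.
    by rewrite gs permKV.
  move=> /eq_in_map h; apply/ffunP => i; apply: val_inj.
  by apply: h; rewrite mem_enum.
congr (_, _) => //; apply/permP => i; apply: g'inj.
by rewrite -gs eg.
Qed.

Lemma reordering_surj (f : {ffun 'I_e -> 'I_n}) : injectiveb f ->
  exists2 p, increasing p.1 & f = reordering p.
Proof.
move=> /injectiveP finj.
pose r := (fun a b : 'I_n => (a <= b)%N).
pose t := [tuple f i | i < e].
pose l := sort_tuple r t.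
have /tuple_permP[p tp] : perm_eq t l by rewrite perm_sym perm_sort.
have lE i : f i = tnth l (p i).
  have := congr1 (fun u => nth (f i) u i) tp.
  rewrite -[nth _ t i]tnth_nth tnth_mktuple => ->.
  by rewrite (nth_map i) ?size_enum_ord// nth_ord_enum.
exists ([ffun i => tnth l i], p); last first.
  by apply/ffunP => i; rewrite !ffunE.
apply/increasingP => i j ij; rewrite !ffunE.
have srt : sorted ltn [seq val x | x <- l].
  rewrite ltn_sorted_uniq_leq map_inj_uniq; last exact: val_inj.
  rewrite sort_uniq /= map_inj_uniq ?enum_uniq//=.
  rewrite sorted_map; apply: sort_sorted => a b; exact: leq_total.
have := sorted_ltn_nth ltn_trans (val (tnth l i)) srt.
move=> /(_ i j); rewrite !inE size_map size_tuple !ltn_ord => /(_ isT isT ij).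
rewrite !(nth_map (tnth l i)) ?size_tuple//.
by rewrite -!tnth_nth.
Qed.

(** Injective maps are grouped by their increasing rearrangement [g]; inside a group the signed sum
    over permutations is the Leibniz expansion of [\det (colsub g M)]. *)
Lemma Cauchy_Binet M N :
  \det (M *m N^T) =
  \sum_(f | increasing f) \det (colsub f M) * \det (colsub f N).
Proof.
rewrite det_mulmx_tr_ffun (bigID (fun f : {ffun 'I_e -> 'I_n} => injectiveb f)) /=.
rewrite [X in _ + X]big1 ?addr0; last first.
  by move=> f nf; rewrite det_colsub_noninj// mulr0.
transitivity (\sum_(f in reordering @: [set p | increasing p.1])
    (\prod_i M i (f i)) * \det (colsub f N)).
  apply: eq_bigl => f; apply/idP/imsetP.
    by move=> /reordering_surj[p ip ->]; exists p; rewrite ?inE.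
  move=> [[g s]]; rewrite inE /= => ig ->; apply/injectiveP => i j.
  by rewrite !ffunE /= => /(increasing_inj ig) /perm_inj.
rewrite big_imset /=; last first.
  by move=> p p'; rewrite !inE => ip ip'; exact: reordering_inj.
transitivity (\sum_(p : {ffun 'I_e -> 'I_n} * {perm 'I_e} | increasing p.1 && true)
   (\prod_i M i (reordering p i)) * \det (colsub (reordering p) N)).
  by apply: eq_bigl => p; rewrite inE andbT.
rewrite -(pair_big_dep increasing (fun _ _ => true)
  (fun g s => (\prod_i M i (reordering (g, s) i)) *
              \det (colsub (reordering (g, s)) N))) /=.
apply: eq_bigr => g ig.
under eq_bigr => s _ do rewrite det_colsub_reordering mulrA.
rewrite -mulr_suml; congr (_ * _).
apply: eq_bigr => s _; rewrite mulrC; congr (_ * _).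
by apply: eq_bigr => i _; rewrite !mxE ffunE.
Qed.

End CauchyBinet.

Section Euclidean.
Context {R : realType} {n : nat}.
Implicit Types (u v w : 'rV[R]_n) (B : {vspace 'rV[R]_n}).

Lemma dotrE v w : dotr v w = (v *m w^T) 0 0.
Proof. by rewrite mxE; apply: eq_bigr => i _; rewrite mxE. Qed.

Lemma mulmx_tr_dotr v w : v *m w^T = (dotr v w)%:M.
Proof. by rewrite [LHS]mx11_scalar -dotrE. Qed.

Lemma dotrC v w : dotr v w = dotr w v.
Proof. by apply: eq_bigr => i _; rewrite mulrC. Qed.

Lemma dotrDl u v w : dotr (u + v) w = dotr u w + dotr v w.
Proof. by rewrite !dotrE mulmxDl mxE. Qed.

Lemma dotrZl a v w : dotr (a *: v) w = a * dotr v w.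
Proof. by rewrite !dotrE -scalemxAl mxE. Qed.

Lemma dotrNl v w : dotr (- v) w = - dotr v w.
Proof. by rewrite -scaleN1r dotrZl mulN1r. Qed.

Lemma dotrBl u v w : dotr (u - v) w = dotr u w - dotr v w.
Proof. by rewrite dotrDl dotrNl. Qed.

Lemma dotr0l w : dotr 0 w = 0.
Proof. by rewrite -(scale0r 0) dotrZl mul0r. Qed.

Lemma dotrDr u v w : dotr u (v + w) = dotr u v + dotr u w.
Proof. by rewrite dotrC dotrDl !(dotrC _ u). Qed.

Lemma dotrZr a v w : dotr v (a *: w) = a * dotr v w.
Proof. by rewrite dotrC dotrZl dotrC. Qed.

Lemma dotrBr u v w : dotr u (v - w) = dotr u v - dotr u w.
Proof. by rewrite dotrC dotrBl !(dotrC _ u). Qed.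

Lemma dotr0r w : dotr w 0 = 0.
Proof. by rewrite dotrC dotr0l. Qed.

Lemma dotr_suml I (r : seq I) (P : pred I) (F : I -> 'rV[R]_n) w :
  dotr (\sum_(i <- r | P i) F i) w = \sum_(i <- r | P i) dotr (F i) w.
Proof.
by elim/big_ind2: _ => [|x1 x2 y1 y2 <- <-|//]; rewrite ?dotr0l ?dotrDl.
Qed.

Lemma dotr_ge0 v : 0 <= dotr v v.
Proof. by apply: sumr_ge0 => i _; rewrite -expr2 sqr_ge0. Qed.

Lemma dotr_eq0 v : (dotr v v == 0) = (v == 0).
Proof.
apply/idP/eqP => [|->]; last by rewrite dotr0l.
rewrite psumr_eq0 => [/allP h|i _]; last by rewrite -expr2 sqr_ge0.
apply/rowP => i; rewrite mxE; apply/eqP.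
by have := h i (mem_index_enum i); rewrite -expr2 sqrf_eq0.
Qed.

Lemma enorm_ge0 v : 0 <= enorm v.
Proof. exact: sqrtr_ge0. Qed.

Lemma sqr_enorm v : enorm v ^+ 2 = dotr v v.
Proof. by rewrite sqr_sqrtr// dotr_ge0. Qed.

Lemma enorm_eq0 v : (enorm v == 0) = (v == 0).
Proof. by rewrite -sqrf_eq0 sqr_enorm dotr_eq0. Qed.

Lemma enorm_gt0 v : (0 < enorm v) = (v != 0).
Proof. by rewrite lt_def enorm_ge0 andbT enorm_eq0. Qed.

Lemma enorm0 : enorm (0 : 'rV[R]_n) = 0.
Proof. by apply/eqP; rewrite enorm_eq0. Qed.

Lemma enormZ a v : enorm (a *: v) = `|a| * enorm v.
Proof.
by rewrite /enorm dotrZl dotrZr mulrA -expr2 sqrtrM ?sqr_ge0// sqrtr_sqr.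
Qed.

Lemma enormN v : enorm (- v) = enorm v.
Proof. by rewrite -scaleN1r enormZ normrN1 mul1r. Qed.

Lemma enormBC v w : enorm (v - w) = enorm (w - v).
Proof. by rewrite -enormN opprB. Qed.

(** Cauchy-Schwarz: the squared norm of [dotr w w *: v - dotr v w *: w] is [dotr w w] times the
    difference of the two sides. *)
Lemma sqr_dotr_le v w : dotr v w ^+ 2 <= dotr v v * dotr w w.
Proof.
have [->|w0] := eqVneq w 0; first by rewrite !dotr0r mulr0 expr0n.
have p : 0 < dotr w w by rewrite lt_def dotr_ge0 dotr_eq0 w0.
have := dotr_ge0 (dotr w w *: v - dotr v w *: w).
rewrite !dotrBl !dotrBr !dotrZl !dotrZr (dotrC w v).
have -> : forall a b c : R, a * (a * b) - a * (c * c) - (c * (a * c) - c * (c * a))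
  = a * (b * a - c ^+ 2) by move=> *; ring.
by rewrite pmulr_rge0// subr_ge0.
Qed.

Lemma dotr_le v w : `|dotr v w| <= enorm v * enorm w.
Proof.
rewrite -(@ler_pXn2r _ 2)// ?nnegrE ?mulr_ge0 ?enorm_ge0//.
by rewrite exprMn !sqr_enorm real_normK ?num_real// sqr_dotr_le.
Qed.

Lemma enormD v w : enorm (v + w) <= enorm v + enorm w.
Proof.
rewrite -(@ler_pXn2r _ 2)// ?nnegrE ?addr_ge0 ?enorm_ge0//.
rewrite sqrrD !sqr_enorm !dotrDl !dotrDr (dotrC w v).
have := le_trans (ler_norm _) (dotr_le v w); lra.
Qed.

Lemma enormB v w : enorm (v - w) <= enorm v + enorm w.
Proof. by rewrite -(enormN w) enormD. Qed.

Lemma enorm_sum I (r : seq I) (P : pred I) (F : I -> 'rV[R]_n) :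
  enorm (\sum_(i <- r | P i) F i) <= \sum_(i <- r | P i) enorm (F i).
Proof.
elim/big_ind2: _ => [|x1 x2 y1 y2 h1 h2|//]; first by rewrite enorm0.
exact: le_trans (enormD _ _) (lerD h1 h2).
Qed.

Lemma coord_le_enorm v i : `|v 0 i| <= enorm v.
Proof.
rewrite -(@ler_pXn2r _ 2)// ?nnegrE ?enorm_ge0// sqr_enorm real_normK ?num_real//.
rewrite /dotr (bigD1 i)//= -expr2 lerDl.
by apply: sumr_ge0 => j _; rewrite -expr2 sqr_ge0.
Qed.

Lemma enorm_delta (j : 'I_n) : enorm (delta_mx 0 j : 'rV[R]_n) = 1.
Proof.
rewrite /enorm /dotr (bigD1 j)//= big1 ?addr0; first by rewrite !mxE !eqxx mulr1 sqrtr1.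
by move=> l lj; rewrite !mxE eqxx (negPf lj) mul0r.
Qed.

Lemma enorm_le_coord v c : 0 <= c -> (forall i, `|v 0 i| <= c) ->
  enorm v <= n%:R * c.
Proof.
move=> c0 h.
apply: (@le_trans _ _ (\sum_(i < n) `|v 0 i|)); last first.
  rewrite mulr_natl -[X in _ *+ X]card_ord -sumr_const.
  by apply: ler_sum => i _; exact: h.
rewrite [v in enorm v]row_sum_delta; apply: le_trans (enorm_sum _ _ _) _.
by apply: ler_sum => i _; rewrite enormZ enorm_delta mulr1.
Qed.

Lemma sqr_enorm_orth v w : dotr v w = 0 ->
  enorm (v + w) ^+ 2 = enorm v ^+ 2 + enorm w ^+ 2.
Proof.
move=> vw; rewrite !sqr_enorm !dotrDl !dotrDr (dotrC w v) vw; ring.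
Qed.

Lemma enorm_le_orth v w : dotr v w = 0 -> enorm v <= enorm (v + w).
Proof.
move=> vw; rewrite -(@ler_pXn2r _ 2)// ?nnegrE ?enorm_ge0//.
by rewrite sqr_enorm_orth// lerDl sqr_ge0.
Qed.

End Euclidean.

Section Gram.
Context {R : realType} {n : nat}.

Definition gram {e} (M : 'M[R]_(e, n)) : R := \det (M *m M^T).

Lemma gram_ge0 e (M : 'M[R]_(e, n)) : 0 <= gram M.
Proof.
rewrite /gram Cauchy_Binet; apply: sumr_ge0 => f _.
by rewrite -expr2 sqr_ge0.
Qed.

Lemma wedge_normE e (M : 'M[R]_(e, n)) : wedge_norm M = Num.sqrt (gram M).
Proof. by rewrite /gram Cauchy_Binet. Qed.

Lemma gram_mulmx e (C : 'M[R]_e) (M : 'M[R]_(e, n)) :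
  gram (C *m M) = \det C ^+ 2 * gram M.
Proof.
by rewrite /gram trmx_mul !mulmxA -(mulmxA C) !det_mulmx det_tr mulrAC expr2.
Qed.

Lemma dotr_row e f (M : 'M[R]_(e, n)) (N : 'M[R]_(f, n)) i j :
  (M *m N^T) i j = dotr (row i M) (row j N).
Proof. by rewrite dotrE mxE [RHS]mxE; apply: eq_bigr => k _; rewrite !mxE. Qed.

Lemma row_free_gram e (M : 'M[R]_(e, n)) : row_free M = (gram M != 0).
Proof.
rewrite /gram -unitfE -unitmxE -row_free_unit.
apply/idP/idP => [fM|]; last first.
  move=> /row_freeP[N MN]; apply/row_freeP; exists (M^T *m N).
  by rewrite mulmxA.
apply/inj_row_free => v; rewrite mulmxA => /(congr1 (mulmx^~ v^T)).
rewrite mul0mx -mulmxA -trmx_mul mulmx_tr_dotr => /matrixP/(_ 0 0).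
rewrite !mxE eqxx mulr1n => /eqP; rewrite dotr_eq0 => /eqP vM0.
by apply: (row_free_inj fM); rewrite vM0 mul0mx.
Qed.

Lemma row_free_gram_gt0 e (M : 'M[R]_(e, n)) : row_free M = (0 < gram M).
Proof. by rewrite lt_def gram_ge0 andbT row_free_gram. Qed.

Lemma orthoproj e (M : 'M[R]_(e, n)) (x : 'rV[R]_n) : row_free M ->
  exists c, (x - c *m M) *m M^T = 0.
Proof.
rewrite row_free_gram -unitfE -unitmxE => uG.
exists (x *m M^T *m invmx (M *m M^T)).
by rewrite mulmxBl -!mulmxA mulVmx// mulmx1 subrr.
Qed.

Lemma gram_col_orth e (M : 'M[R]_(e, n)) (z : 'rV[R]_n) : z *m M^T = 0 ->
  gram (col_mx z M) = dotr z z * gram M.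
Proof.
move=> zM; have Mz : M *m z^T = 0 by rewrite -[LHS]trmxK trmx_mul trmxK zM trmx0.
rewrite /gram tr_col_mx mul_col_row zM Mz det_ublock.
by rewrite mulmx_tr_dotr det_scalar expr1.
Qed.

Lemma gram_col_add e (M : 'M[R]_(e, n)) (z : 'rV[R]_n) c :
  gram (col_mx (z + c *m M) M) = gram (col_mx z M).
Proof.
have -> : col_mx (z + c *m M) M = block_mx 1 c 0 1 *m col_mx z M.
  by rewrite mul_block_col !mul1mx mul0mx add0r.
by rewrite gram_mulmx det_ublock !det1 mulr1 expr1n mul1r.
Qed.

(** Stacking [x] on [M] multiplies the Gram determinant by the squared distance from [x] to the row
    space, which any point [c *m M] bounds. This controls heights when a vector is adjoined. *)
Lemma gram_col_le e (M : 'M[R]_(e, n)) (x : 'rV[R]_n) c : row_free M ->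
  gram (col_mx x M) <= enorm (x - c *m M) ^+ 2 * gram M.
Proof.
move=> fM; have [c' orth] := orthoproj x fM.
rewrite -[x in col_mx x](subrK (c' *m M)) gram_col_add gram_col_orth//.
rewrite sqr_enorm ler_wpM2r ?gram_ge0// -!sqr_enorm.
rewrite ler_pXn2r ?nnegrE ?enorm_ge0//.
have -> : x - c *m M = (x - c' *m M) + (c' - c) *m M.
  by rewrite mulmxBl addrA subrK.
apply: enorm_le_orth; rewrite dotrE trmx_mul mulmxA orth mul0mx mxE//.
Qed.

(** A substitute for Hadamard's inequality: all Leibniz terms have the same bound, since a
    permutation only reorders the factors [b i]. *)
Lemma det_le (e : nat) (K : 'M[R]_e) (a b : 'I_e -> R) :
  (forall i j, `|K i j| <= a i * b j) ->
  `|\det K| <= e`!%:R * ((\prod_i a i) * \prod_i b i).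
Proof.
move=> h; rewrite /determinant; apply: le_trans (ler_norm_sum _ _ _) _.
have -> : e`!%:R * ((\prod_i a i) * \prod_i b i) =
    \sum_(s : 'S_e) ((\prod_i a i) * \prod_i b i).
  rewrite sumr_const -[RHS]mulr_natl; congr (_ * _); congr (_%:R).
  by rewrite -[LHS]card_Sn; apply: eq_card.
apply: ler_sum => s _; rewrite normrM normrX normrN1 expr1n mul1r.
rewrite normr_prod.
have -> : \prod_i b i = \prod_i b (s i) by rewrite (reindex_inj (@perm_inj _ s)).
by rewrite -big_split; apply: ler_prod => i _; rewrite normr_ge0 h.
Qed.

Lemma gram_le (e : nat) (M : 'M[R]_(e, n)) (a : 'I_e -> R) :
  (forall i, enorm (row i M) <= a i) ->
  gram M <= e`!%:R * (\prod_i a i) ^+ 2.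
Proof.
move=> h; apply: le_trans (ler_norm _) _; rewrite expr2; apply: det_le => i j.
rewrite dotr_row; apply: le_trans (dotr_le _ _) _.
by apply: ler_pM; rewrite ?enorm_ge0.
Qed.

(* For [L] with columns [l_k] and [P] the orthogonal projection onto the row
   space of [M], the matrix of the [<P l_k, P l_m>] has determinant
   [det (M L) ^ 2 / gram M]. *)
Lemma det_mulmx_le (e : nat) (M : 'M[R]_(e, n)) (L : 'M[R]_(n, e)) (k : 'I_e -> R) :
  row_free M -> (forall i, 0 <= k i) ->
  (forall c i, `|(c *m M *m L) 0 i| <= k i * enorm (c *m M)) ->
  \det (M *m L) ^+ 2 <= e`!%:R * gram M * (\prod_i k i) ^+ 2.
Proof.
move=> fM k0 h.
have g0 : 0 < gram M by rewrite -row_free_gram_gt0.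
have uG : M *m M^T \in unitmx by rewrite unitmxE unitfE -/(gram M) gt_eqF.
pose P := M^T *m invmx (M *m M^T) *m M.
have PT : P^T = P.
  by rewrite /P !trmx_mul trmxK trmx_inv trmx_mul trmxK mulmxA.
have PP : P *m P = P.
  by rewrite /P -!mulmxA; congr (_ *m (_ *m _)); rewrite (mulmxA M) (mulmxA (_ *m _)) mulmxV// mul1mx.
pose N := (P *m L)^T.
have rN i : exists c, row i N = c *m M.
  exists (row i (L^T *m (M^T *m invmx (M *m M^T)))).
  by rewrite -row_mul /N trmx_mul PT /P !mulmxA.
have eN i : enorm (row i N) <= k i.
  have [->|nz] := eqVneq (row i N) 0; first by rewrite enorm0.
  have p : 0 < enorm (row i N) by rewrite enorm_gt0.
  rewrite -(ler_pM2r p) -expr2 sqr_enorm.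
  suff -> : dotr (row i N) (row i N) = (row i N *m L) 0 i.
    by apply: le_trans (ler_norm _) _; have [c ->] := rN i.
  rewrite -dotr_row -row_mul [RHS]mxE; congr (fun_of_matrix _ i i).
  by rewrite /N trmxK trmx_mul PT mulmxA -(mulmxA L^T P P) PP.
have gN : gram N * gram M = \det (M *m L) ^+ 2.
  rewrite {1}/gram /N trmxK trmx_mul PT mulmxA -(mulmxA L^T P P) PP /P.
  have -> : L^T *m (M^T *m invmx (M *m M^T) *m M) *m L =
      (M *m L)^T *m invmx (M *m M^T) *m (M *m L).
    by rewrite trmx_mul !mulmxA.
  rewrite !(@det_mulmx _ e) det_tr det_inv -/(gram M).
  by rewrite expr2 mulrAC; congr (_ * _); rewrite mulfVK// gt_eqF.
rewrite -gN mulrAC ler_wpM2r ?gram_ge0//.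
exact: gram_le.
Qed.

(** [omega] is the sine of the angle; its Gram determinant is computed by subtracting from [v] its
    projection on [w]. *)
Lemma sqr_omega (v w : 'rV[R]_n) : v != 0 -> w != 0 ->
  omega v w ^+ 2 = 1 - dotr v w ^+ 2 / (dotr v v * dotr w w).
Proof.
move=> v0 w0.
have gE : gram (col_mx v w) = dotr v v * dotr w w - dotr v w ^+ 2.
  have ww : dotr w w != 0 by rewrite dotr_eq0.
  pose c := dotr v w / dotr w w.
  have -> : v = (v - c *: w) + c%:M *m w by rewrite mul_scalar_mx subrK.
  rewrite gram_col_add gram_col_orth.
    rewrite mul_scalar_mx subrK /gram det_mx11 -dotrE.
    by rewrite dotrBl !dotrBr !dotrZl !dotrZr (dotrC w v) /c; field.
  rewrite mulmx_tr_dotr dotrBl dotrZl /c mulfVK// subrr.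
  by apply/matrixP => i j; rewrite !mxE mul0rn.
rewrite /omega wedge_normE expr_div_n sqr_sqrtr ?gram_ge0// exprMn !sqr_enorm gE.
by rewrite mulrBl divff// mulf_neq0 ?dotr_eq0.
Qed.

Lemma omega_ge0 (v w : 'rV[R]_n) : 0 <= omega v w.
Proof. by rewrite divr_ge0 ?mulr_ge0 ?sqrtr_ge0. Qed.

End Gram.

(** * Integer bases and heights *)

Section RowSpace.
Context {R : realType} {n : nat}.
Implicit Types (B : {vspace 'rV[R]_n}).

Definition row_basis B {e} (M : 'M[R]_(e, n)) : Prop :=
  row_free M /\ forall v, v \in B <-> exists c, v = c *m M.

Definition rowvs {e} (M : 'M[R]_(e, n)) : {vspace 'rV[R]_n} :=
  limg (linfun (mulmxr M : 'rV[R]_e -> 'rV[R]_n)).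

Lemma mem_rowvs e (M : 'M[R]_(e, n)) v :
  v \in rowvs M <-> exists c, v = c *m M.
Proof.
split=> [/memv_imgP[c _ ->]|[c ->]]; first by exists c; rewrite lfunE.
by apply/memv_imgP; exists c; rewrite ?memvf ?lfunE.
Qed.

Lemma dim_rowvs e (M : 'M[R]_(e, n)) : row_free M -> \dim (rowvs M) = e.
Proof.
move=> fM; rewrite /rowvs limg_dim_eq ?dimvf /dim/= ?mul1n//.
have /eqP -> : lker (linfun (mulmxr M : 'rV[R]_e -> 'rV[R]_n)) == 0%VS.
  by apply/lker0P => u v; rewrite !lfunE /= => /(row_free_inj fM).
by rewrite capv0.
Qed.

Lemma row_basis_rowvs B e (M : 'M[R]_(e, n)) : row_basis B M -> B = rowvs M.
Proof.
move=> [_ h]; apply/vspaceP => v; apply/idP/idP.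
  by move=> /h /mem_rowvs.
by move=> /mem_rowvs /h.
Qed.

Lemma row_basis_dim B e (M : 'M[R]_(e, n)) : row_basis B M -> \dim B = e.
Proof. by move=> h; rewrite (row_basis_rowvs h) dim_rowvs//; case: h. Qed.

Lemma row_basis_free B e (M : 'M[R]_(e, n)) : \dim B = e -> row_free M ->
  (forall i, row i M \in B) -> row_basis B M.
Proof.
move=> dB fM h; split => // v.
have sub : (rowvs M <= B)%VS.
  apply/subvP => w /mem_rowvs[c ->]; rewrite mulmx_sum_row.
  by apply: memv_suml => i _; rewrite memvZ.
have /eqP <- : rowvs M == B by rewrite eqEdim sub dB dim_rowvs//=.
exact: mem_rowvs.
Qed.

Lemma row_basis_row B e (M : 'M[R]_(e, n)) i : row_basis B M -> row i M \in B.
Proof. by move=> [_ h]; apply/h; exists (delta_mx 0 i); rewrite rowE. Qed.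

Lemma row_basis_exists B : exists M : 'M[R]_(\dim B, n), row_basis B M.
Proof.
exists (\matrix_i (vbasis B)`_i); have bB := vbasisP B.
apply: row_basis_free => // [|i]; last first.
  by rewrite rowK vbasis_mem// mem_nth// size_tuple.
apply/inj_row_free => v; rewrite mulmx_sum_row => h.
have /freeP fB := basis_free bB.
apply/rowP => i; rewrite mxE; apply: (fB (fun i => v 0 i)).
by rewrite -[RHS]h; apply: eq_bigr => j _; rewrite rowK.
Qed.

Lemma orthoproj_vs B x :
  exists2 y, y \in B & forall w, w \in B -> dotr (x - y) w = 0.
Proof.
have [M [fM h]] := row_basis_exists B.
have [c orth] := orthoproj x fM.
exists (c *m M); first by apply/h; exists c.
by move=> w /h[c' ->]; rewrite dotrE trmx_mul mulmxA orth mul0mx mxE.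
Qed.

(** The double orthogonal complement of [B] lies in [B]. Membership thus becomes a family of linear
    equations, a closed condition suited to compactness. *)
Lemma orth_vs_mem B x :
  (forall w, (forall b, b \in B -> dotr b w = 0) -> dotr x w = 0) -> x \in B.
Proof.
move=> h; have [y yB orth] := orthoproj_vs B x.
suff : x - y == 0 by rewrite subr_eq0 => /eqP ->.
rewrite -dotr_eq0 dotrBl (dotrC y) orth// subr0.
by apply/eqP/h => b bB; rewrite dotrC orth.
Qed.

End RowSpace.

Section AdjReplace.
Context {K : comNzRingType}.

Lemma adj_mulmx_col e (P : 'M[K]_e) (g : 'cV[K]_e) i :
  (\adj P *m g) i 0 =
  \det (\matrix_(a, b) if b == i then g a 0 else P a b).
Proof.
rewrite mxE (expand_det_col _ i); apply: eq_bigr => j _.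
rewrite !mxE eqxx mulrC; congr (_ * _).
rewrite /cofactor; congr (_ * \det _).
by apply/matrixP => a b; rewrite !mxE eq_sym (negPf (neq_lift _ _)).
Qed.

(** Cramer's rule on each column of [M]. As [colsub f M] times its adjugate is scalar, a matrix
    whose minor at [f] is nonzero is recovered from its minors up to left multiplication: the minors
    determine the row space. *)
Lemma adj_colsub_mulmx e n (M : 'M[K]_(e, n)) (f : {ffun 'I_e -> 'I_n}) i k :
  (\adj (colsub f M) *m M) i k =
  \det (colsub [ffun b => if b == i then k else f b] M).
Proof.
have -> : (\adj (colsub f M) *m M) i k = (\adj (colsub f M) *m col k M) i 0.
  by rewrite [LHS]mxE [RHS]mxE; apply: eq_bigr => j _; rewrite [col _ _ _ _]mxE.
rewrite adj_mulmx_col; congr (\det _); apply/matrixP => a b.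
by rewrite !mxE ffunE; case: eqP.
Qed.

End AdjReplace.

Section Heights.
Context {R : realType} {n : nat}.
Implicit Types (B : {vspace 'rV[R]_n}).

Definition intmx {m p} (M : 'M[int]_(m, p)) : 'M[R]_(m, p) := map_mx intr M.
Local Notation zmx := intmx.

Lemma gram_zmx e (M : 'M[int]_(e, n)) : gram (zmx M) = (\det (M *m M^T))%:~R.
Proof. by rewrite /gram /intmx map_trmx -map_mxM det_map_mx. Qed.

Lemma int_ge1 (a : int) : 0 < (a%:~R : R) -> 1 <= (a%:~R : R).
Proof. by rewrite ltr0z -[1]/(1%:~R) ler_int gtz0_ge1. Qed.

Lemma sqr_int_ge1 (a : int) : a != 0 -> 1 <= (a%:~R : R) ^+ 2.
Proof.
move=> a0; rewrite -rmorphXn /=; apply: int_ge1.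
by rewrite ltr0z lt_def sqrf_eq0 a0 sqr_ge0.
Qed.

Lemma row_zmx e (M : 'M[int]_(e, n)) i : row i (zmx M) = zmx (row i M).
Proof. by rewrite /intmx map_row. Qed.

Lemma clear_denom (v : 'rV[rat]_n) :
  exists2 k : int, k != 0 & exists x : 'rV[int]_n, map_mx intr x = k%:~R *: v.
Proof.
exists (\prod_i denq (v 0 i)).
  by apply/prodf_neq0 => i _; rewrite denq_neq0.
exists (\row_i (numq (v 0 i) * \prod_(j | j != i) denq (v 0 j))).
apply/rowP => i; rewrite !mxE [in RHS](bigD1 i)//= !intrM numqE; ring.
Qed.

Lemma rational_int_basis B : rational_subspace B ->
  exists W : 'M[int]_(\dim B, n), row_basis B (zmx W).
Proof.
move=> [s sB].
have sz : size s = \dim B.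
  by have := basis_free sB; rewrite /free (span_basis sB) size_map => /eqP.
have /choice[F Fs] : forall i : 'I_(\dim B), exists p : int * 'rV[int]_n,
    p.1 != 0 /\ map_mx intr p.2 = p.1%:~R *: s`_i :> 'rV[rat]_n.
  move=> i; have [k k0 [x xE]] := clear_denom s`_i.
  by exists (k, x).
have FE i : zmx (F i).2 = (F i).1%:~R *: (map (map_mx ratr) s)`_i.
  have [_ h] := Fs i.
  rewrite (nth_map 0) ?sz// -[zmx _]/(map_mx _ _).
  have -> : map_mx intr (F i).2 = map_mx ratr (map_mx intr (F i).2 : 'rV[rat]_n) :> 'rV[R]_n.
    by apply/rowP => j; rewrite !mxE ratr_int.
  by rewrite h; apply/rowP => j; rewrite !mxE rmorphM /= ratr_int.
exists (\matrix_i (F i).2).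
apply: row_basis_free => // [|i]; last first.
  rewrite row_zmx rowK FE memvZ// (basis_mem sB)// mem_nth// size_map sz//.
apply/inj_row_free => v; rewrite mulmx_sum_row => h.
have fB := basis_free sB.
have szs : size (map (map_mx ratr) s : seq 'rV[R]_n) == \dim B by rewrite size_map sz.
have /freeP fP : free (Tuple szs) by [].
apply/rowP => i; rewrite mxE.
suff : v 0 i * (F i).1%:~R = 0.
  by move/eqP; rewrite mulf_eq0 intr_eq0 (negPf (Fs i).1) orbF => /eqP.
apply: (fP (fun i => v 0 i * (F i).1%:~R)).
rewrite -[RHS]h; apply: eq_bigr => j _.
by rewrite row_zmx rowK FE scalerA.
Qed.

Lemma row_basis_rational B e (W : 'M[int]_(e, n)) :
  row_basis B (zmx W) -> rational_subspace B.
Proof.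
move=> bW; have dB := row_basis_dim bW; case: bW => fW h.
pose s := [tuple row i (map_mx intr W) : 'rV[rat]_n | i < e].
exists s; have sE : map (map_mx ratr) s = [tuple row i (zmx W) | i < e].
  rewrite /= -map_comp; apply: eq_map => i /=.
  by apply/rowP => j; rewrite !mxE ratr_int.
rewrite sE basisEdim size_tuple dB leqnn andbT; apply/subvP => v /h[c ->].
rewrite mulmx_sum_row; apply: memv_suml => i _; apply: memvZ.
by apply: memv_span; apply/mapP; exists i => //; rewrite mem_enum.
Qed.

End Heights.

Section HeightBounds.
Context {R : realType} {n : nat}.
Implicit Types (B : {vspace 'rV[R]_n}).
Local Notation zmx := (@intmx R _ _).

Lemma zmxM m p r (M : 'M[int]_(m, p)) (N : 'M[int]_(p, r)) :
  zmx (M *m N) = zmx M *m zmx N.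
Proof. by rewrite /intmx map_mxM. Qed.

Lemma zmx_inj m p : injective (@intmx R m p).
Proof.
move=> M N /matrixP h; apply/matrixP => i j.
by have := h i j; rewrite !mxE => /intr_inj.
Qed.

(** The Smith normal form of an integer basis is [L *m D *m P *m Q] with [L], [Q] unimodular. The
    rows of [P *m Q] are rows of a unimodular matrix, so they have an integer right inverse and
    integer points of their span have integer coordinates. *)
Lemma Zbasis_exists B : rational_subspace B ->
  exists M : 'M[int]_(\dim B, n), Zbasis B M /\ row_basis B (zmx M).
Proof.
move=> /rational_int_basis; set e := \dim B => -[W bW].
have [L uL [Q uQ [s _ WE]]] := int_Smith_normal_form W.
have [fW hW] := bW.
pose P : 'M[int]_(e, n) := \matrix_(i, j) (i == j :> nat)%:R.
pose D : 'M[int]_e := \matrix_(i, j) (s`_i *+ (i == j)).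
have en : (e <= n)%N.
  by have := rank_leq_col (zmx W); rewrite (eqP fW).
have DP : \matrix_(i, j) (s`_i *+ (i == j :> nat)) = D *m P.
  apply/matrixP => i j; rewrite !mxE (bigD1 i)//= big1 ?addr0.
    by rewrite !mxE eqxx mulr1n mulr_natr.
  by move=> k ki; rewrite !mxE eq_sym (negPf ki) mulr0n mul0r.
have PPt : P *m P^T = 1%:M.
  apply/matrixP => i j; rewrite !mxE.
  pose i' := widen_ord en i.
  rewrite (bigD1 i')//= big1 ?addr0.
    by rewrite !mxE /= eqxx mul1r eq_sym.
  move=> k ki; rewrite !mxE; case: eqP => [ik|]; last by rewrite mul0r.
  by case/eqP: ki; apply: val_inj; rewrite /= ik.
pose M := P *m Q.
have WM : W = L *m (D *m M) by rewrite WE DP /M !mulmxA.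
have rinv : M *m (invmx Q *m P^T) = 1%:M.
  by rewrite /M -mulmxA (mulmxA Q) mulmxV// mul1mx PPt.
have fM : row_free (zmx M).
  apply/row_freeP; exists (zmx (invmx Q *m P^T)).
  by rewrite -zmxM rinv /intmx map_mx1.
(* A zero invariant factor would make row [i] of [invmx L] a relation between the independent rows
   of [W]. *)
have s0 (i : 'I_e) : s`_i != 0.
  apply/negP => /eqP si.
  have LD : invmx L *m W = D *m M by rewrite WM mulKmx.
  have : zmx (delta_mx 0 i *m invmx L) = 0 :> 'rV_e.
    apply: (row_free_inj fW); rewrite mul0mx -zmxM -mulmxA LD mulmxA -rowE.
    have -> : row i D = 0.
      by apply/rowP => j; rewrite !mxE si mul0rn.
    by rewrite mul0mx; apply/matrixP => a b; rewrite !mxE.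
  have -> : 0 = zmx (0 : 'rV_e) by apply/matrixP => a b; rewrite !mxE.
  move=> /zmx_inj /(congr1 (mulmx^~ L)); rewrite mulmxKV// mul0mx.
  by move=> /matrixP/(_ 0 i); rewrite !mxE !eqxx.
(* A nonzero multiple of this row, by [s_i], is an integer combination of the rows of [W]. *)
have MB i : row i (zmx M) \in B.
  have : zmx (row i (D *m M)) \in B.
    apply/hW; exists (zmx (row i (invmx L))).
    by rewrite -zmxM -row_mul WM mulKmx.
  have -> : zmx (row i (D *m M)) = (s`_i)%:~R *: row i (zmx M).
    rewrite row_mul row_zmx.
    have -> : row i D = s`_i *: delta_mx 0 i.
      by apply/rowP => j; rewrite !mxE eqxx /= eq_sym mulr_natr.
    rewrite -scalemxAl -rowE; apply/rowP => j; rewrite !mxE intrM//.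
  move=> /(memvZ (s`_i)%:~R^-1); rewrite scalerA mulVf ?scale1r//.
  by rewrite intr_eq0.
have bM : row_basis B (zmx M) by apply: row_basis_free.
exists M; split => //; split.
  by move=> c; rewrite -/(intmx _) zmxM; apply/bM.2; exists (zmx c).
move=> x; rewrite -/(intmx _) => /bM.2[c xE].
have cE : c = zmx (x *m (invmx Q *m P^T)).
  by rewrite zmxM xE -mulmxA -zmxM rinv /intmx map_mx1 mulmx1.
exists (x *m (invmx Q *m P^T)); split.
  by apply: (@zmx_inj _ _); rewrite zmxM -cE.
move=> c' ->; by rewrite -mulmxA rinv mulmx1.
Qed.

Lemma Zbasis_mulmx B e (M : 'M[int]_(e, n)) f (W : 'M[int]_(f, n)) :
  Zbasis B M -> (forall i, zmx (row i W) \in B) -> exists C, W = C *m M.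
Proof.
move=> [_ h] /(_ _)/h hW.
have /choice[F FE] : forall i, exists c, row i W = c *m M.
  by move=> i; have [c [-> _]] := hW i; exists c.
exists (\matrix_i F i); apply/row_matrixP => i.
by rewrite row_mul rowK FE.
Qed.

(** Independence over the reals follows from a comparison of ranks: the basis given by
    [Zbasis_exists] consists of integer combinations of the rows of [M]. *)
Lemma Zbasis_row_basis B (M : 'M[int]_(\dim B, n)) :
  rational_subspace B -> Zbasis B M -> row_basis B (zmx M).
Proof.
move=> /Zbasis_exists[M0 [_ bM0]] zM.
have [C CE] : exists C, M0 = C *m M.
  apply: (Zbasis_mulmx zM) => i; rewrite -row_zmx; exact: row_basis_row.
apply: row_basis_free => // [|i]; last first.
  by rewrite row_zmx rowE; exact: zM.1.
have [fM0 _] := bM0; move: fM0; rewrite CE zmxM /row_free !eqn_leq !rank_leq_row/=.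
by move=> /leq_trans; apply; rewrite mxrankM_maxr.
Qed.

Lemma height_spec B e : rational_subspace B -> \dim B = e ->
  exists M : 'M[int]_(e, n), [/\ Zbasis B M, row_basis B (zmx M) &
    height B ^+ 2 = gram (zmx M)].
Proof.
move=> rB <-; have [M0 [zM0 _]] := Zbasis_exists rB.
(* The default value of [xget] is ruled out by the Z-basis [M0]. *)
rewrite /height; case: xgetP => [h -> [M zM hE]|/(_ (wedge_norm (zmx M0)))]; last first.
  by case; exists M0.
exists M; split => //; first exact: Zbasis_row_basis.
by rewrite hE wedge_normE sqr_sqrtr ?gram_ge0.
Qed.

Lemma height_ge0 B : 0 <= height B.
Proof.
by rewrite /height; case: xgetP => // h -> [M _ ->]; rewrite wedge_normE sqrtr_ge0.
Qed.

Lemma height_ge1 B : rational_subspace B -> 1 <= height B.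
Proof.
move=> rB; have [M [_ [fM _] hE]] := height_spec rB erefl.
rewrite -(@ler_pXn2r _ 2)// ?nnegrE ?height_ge0// expr1n hE.
by move: fM; rewrite row_free_gram_gt0 gram_zmx => /int_ge1.
Qed.

(** The rows of [W] span a sublattice: [W = C *m M] with [M] a Z-basis and [\det C] a nonzero
    integer, whose square is at least 1. *)
Lemma height_le_gram B e (W : 'M[int]_(e, n)) : \dim B = e ->
  row_free (zmx W) -> (forall i, zmx (row i W) \in B) ->
  rational_subspace B /\ height B ^+ 2 <= gram (zmx W).
Proof.
move=> dB fW WB.
have rB : rational_subspace B.
  apply: (@row_basis_rational _ _ _ _ W); apply: row_basis_free => // i.
  by rewrite row_zmx.
split => //; have [M [zM _ ->]] := height_spec rB dB.
have [C CE] := Zbasis_mulmx zM WB.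
move: fW; rewrite row_free_gram CE zmxM gram_mulmx mulf_eq0 negb_or => /andP[dC _].
rewrite ler_peMl ?gram_ge0//; move: dC; rewrite /intmx det_map_mx => dC.
by apply: sqr_int_ge1; move: dC; rewrite expf_eq0 /= intr_eq0.
Qed.

(** A Z-basis of [B] together with [x] spans a sublattice of the integer points of the sum; its Gram
    determinant is bounded by [gram_col_le]. *)
Lemma height_add B (x : 'rV[int]_n) (y : 'rV[R]_n) :
  rational_subspace B -> zmx x \notin B -> y \in B ->
  [/\ rational_subspace (B + <[zmx x]>)%VS,
      \dim (B + <[zmx x]>)%VS = (\dim B).+1 &
      height (B + <[zmx x]>)%VS <= enorm (zmx x - y) * height B].
Proof.
move=> rB xB yB; have [M [zM bM hE]] := height_spec rB erefl.
have [fM h] := bM.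
have dE : \dim (B + <[zmx x]>)%VS = (1 + \dim B)%N.
  have x0 : zmx x != 0 by apply: contraNneq xB => ->; rewrite mem0v.
  rewrite dimv_disjoint_sum ?dim_vline ?x0 1?addnC//.
  apply/eqP; rewrite -subv0; apply/subvP => v.
  rewrite memv_cap => /andP[vB /vlineP[k vE]]; rewrite memv0.
  have [k0|k0] := eqVneq k 0; first by rewrite vE k0 scale0r.
  case/negP: xB; rewrite -[zmx x]scale1r -(mulVf k0) -scalerA -vE.
  exact: memvZ.
have zcE : zmx (col_mx x M) = col_mx (zmx x) (zmx M) by rewrite /intmx map_col_mx.
have fW : row_free (zmx (col_mx x M)).
  rewrite zcE row_free_gram.
  have [c orth] := orthoproj (zmx x) fM.
  rewrite -[zmx x](subrK (c *m zmx M)) gram_col_add gram_col_orth//.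
  rewrite mulf_neq0 -?row_free_gram// dotr_eq0 subr_eq0.
  by apply: contraNneq xB => ->; apply/h; exists c.
have [|rS hS] := @height_le_gram (B + <[zmx x]>)%VS _ (col_mx x M) dE fW.
  move=> i; rewrite -row_zmx zcE; case: (split_ordP i) => j ->.
    rewrite rowKu ord1 row_id; apply: (subvP (addvSr _ _)); exact: memv_line.
  rewrite rowKd; apply: (subvP (addvSl _ _)); exact: row_basis_row.
split => //.
rewrite -(@ler_pXn2r _ 2)// ?nnegrE ?mulr_ge0 ?enorm_ge0 ?height_ge0//.
apply: le_trans hS _; rewrite exprMn hE zcE.
by have /h[c ->] := yB; exact: gram_col_le.
Qed.

(** Vectors already in the space built so far are skipped, so [s] counts the effective additions
    only. *)
Lemma height_add_seq B (xs : seq 'rV[int]_n) (rho : R) :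
  rational_subspace B -> 0 <= rho ->
  (forall x, x \in xs -> exists2 y, y \in B & enorm (zmx x - y) <= rho) ->
  exists s, let B' := (B + <<map zmx xs>>)%VS in
    [/\ rational_subspace B', \dim B' = (\dim B + s)%N, (s <= size xs)%N &
        height B' <= rho ^+ s * height B].
Proof.
move=> rB rho0; elim/last_ind: xs => [|xs x IH] h.
  by exists 0; rewrite /= span_nil addv0 addn0 expr0 mul1r.
have [s [rB' dB' sB' hB']] : exists s, let B' := (B + <<map zmx xs>>)%VS in
    [/\ rational_subspace B', \dim B' = (\dim B + s)%N, (s <= size xs)%N &
        height B' <= rho ^+ s * height B].
  by apply: IH => y yxs; apply: h; rewrite mem_rcons inE yxs orbT.
have [|y yB xy] := h x; first by rewrite mem_rcons mem_head.
have -> : (B + <<map zmx (rcons xs x)>>)%VS = (B + <<map zmx xs>> + <[zmx x]>)%VS.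
  by rewrite map_rcons -cats1 span_cat span_seq1 addvA.
have [xin|xnin] := boolP (zmx x \in (B + <<map zmx xs>>)%VS).
  exists s => /=; rewrite (addv_idPl _) -?memvE//; split => //.
  by rewrite size_rcons leqW.
have yB' : y \in (B + <<map zmx xs>>)%VS by apply: (subvP (addvSl _ _)).
have [r1 d1 h1] := height_add rB' xnin yB'.
exists s.+1; rewrite /= size_rcons ltnS; split => //.
  by rewrite d1 dB' addnS.
apply: le_trans h1 _; rewrite exprS -mulrA; apply: ler_pM => //.
  exact: enorm_ge0.
exact: height_ge0.
Qed.

End HeightBounds.

(** * Finiteness of the rational subspaces of bounded height *)

Section Northcott.
Context {R : realType} {n : nat}.
Local Notation zmx := (@intmx R _ _).

Lemma colsub_mulmx m e (M : 'M[R]_(m, n)) (f : 'I_e -> 'I_n) :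
  colsub f M = M *m colsub f 1%:M.
Proof.
apply/matrixP => i j; rewrite !mxE (bigD1 (f j))//= big1 ?addr0.
  by rewrite !mxE eqxx mulr1.
by move=> k kj; rewrite !mxE (negPf kj) mulr0.
Qed.

Lemma sqr_minor_le e (M : 'M[R]_(e, n)) (f : 'I_e -> 'I_n) : row_free M ->
  \det (colsub f M) ^+ 2 <= e`!%:R * gram M.
Proof.
move=> fM; rewrite colsub_mulmx.
have := @det_mulmx_le R n e M (colsub f 1%:M) (fun=> 1) fM (fun=> ler01).
rewrite big1// expr1n mulr1; apply => c i.
by rewrite -(colsub_mulmx (c *m M)) mxE mul1r coord_le_enorm.
Qed.

Lemma row_free_minor e (M : 'M[R]_(e, n)) : row_free M ->
  exists f : {ffun 'I_e -> 'I_n}, \det (colsub f M) != 0.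
Proof.
rewrite row_free_gram /gram Cauchy_Binet => h; apply: contrapT => h'.
case/eqP: h; rewrite big1// => f _.
have [->|nz] := eqVneq (\det (colsub f M)) 0; first by rewrite mulr0.
by case: h'; exists f.
Qed.

Lemma minors_subvs (B B' : {vspace 'rV[R]_n}) e (M M' : 'M[R]_(e, n)) :
  row_basis B M -> row_basis B' M' ->
  (forall f : {ffun 'I_e -> 'I_n}, \det (colsub f M) = \det (colsub f M')) ->
  (B <= B')%VS.
Proof.
move=> [fM hM] [fM' hM'] h; have [f df] := row_free_minor fM.
have adjE : \adj (colsub f M) *m M = \adj (colsub f M') *m M'.
  by apply/matrixP => i k; rewrite !adj_colsub_mulmx h.
have ME : M = (\det (colsub f M))^-1 *: (colsub f M *m (\adj (colsub f M') *m M')).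
  by rewrite -adjE mulmxA mul_mx_adj mul_scalar_mx scalerA mulVf// scale1r.
apply/subvP => v /hM[c ->]; apply/hM'.
exists (c *m ((\det (colsub f M))^-1 *: (colsub f M *m \adj (colsub f M')))).
by rewrite -mulmxA -scalemxAl -mulmxA -ME.
Qed.

(** A bound on the height bounds the minors of a Z-basis; these are integers and determine the
    subspace. *)
Lemma Northcott e (T : R) :
  finite_set [set B : {vspace 'rV[R]_n} | rational_subspaces e B /\ height B <= T].
Proof.
pose K := (Num.truncn (e`!%:R * T ^+ 2)).+1.
have KT : e`!%:R * T ^+ 2 <= K%:R :> R by exact: ltW (truncnS_gt _).
(* Integers between [- K] and [K] are stored in a finite ordinal type after a shift by [K]. *)
pose code (phi : {ffun {ffun 'I_e -> 'I_n} -> 'I_(K + K).+1}) B :=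
  exists2 M : 'M[int]_(e, n), row_basis B (zmx M) &
    forall f : {ffun 'I_e -> 'I_n}, \det (colsub f M) = (phi f)%:Z - K%:Z.
pose dec phi := xget (0%VS : {vspace 'rV[R]_n}) [set B | code phi B].
apply: (@sub_finite_set _ _ (dec @` setT)); last exact: finite_image.
move=> B [[rB dB] hB] /=.
have [M [_ bM hE]] := height_spec rB dB.
have [fM _] := bM.
have bd (f : {ffun 'I_e -> 'I_n}) : `|\det (colsub f M)| <= K%:Z.
  rewrite -(@ler_int R) -pmulrn; apply: le_trans KT.
  apply: (@le_trans _ _ ((\det (colsub f M))%:~R ^+ 2)).
    rewrite -rmorphXn /= ler_int -[X in _ <= X]ger0_norm ?sqr_ge0// normrX.
    have [->//|nz] := eqVneq `|\det (colsub f M)| 0.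
    by rewrite expr2 ler_peMr// -gtz0_ge1 lt_def nz /=.
  have -> : (\det (colsub f M))%:~R = \det (colsub f (zmx M)) :> R.
    by rewrite -map_mxsub det_map_mx.
  apply: le_trans (sqr_minor_le f fM) _.
  rewrite ler_wpM2l// -hE ler_pXn2r ?nnegrE ?height_ge0//.
  exact: le_trans (height_ge0 _) hB.
pose phi : {ffun {ffun 'I_e -> 'I_n} -> 'I_(K + K).+1} :=
  [ffun f : {ffun 'I_e -> 'I_n} => inord (absz (\det (colsub f M) + K%:Z))].
have cB : code phi B.
  exists M => // f; rewrite ffunE inordK; last first.
    by rewrite ltnS; have := bd f; lia.
  by have := bd f; lia.
exists phi => //.
have := @xgetI _ (0%VS : {vspace 'rV[R]_n}) [set B | code phi B] B cB.
rewrite -/(dec _); move: (dec _) => B' [M2 bM2 hM2]; case: cB => M' bM' hM'.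
have eqm (f : {ffun 'I_e -> 'I_n}) : \det (colsub f (zmx M')) = \det (colsub f (zmx M2)).
  by rewrite -!map_mxsub !det_map_mx hM' hM2.
apply/eqP; rewrite eqEsubv (minors_subvs bM' bM2)//= (minors_subvs bM2 bM')//.
Qed.

End Northcott.

(** * Angles between subspaces *)

Section Minimizers.
Context {R : realType} {n : nat}.
Implicit Types (A B : {vspace 'rV[R]_n}) (X Y : nat -> 'rV[R]_n).

Lemma orth_nonzeroE A X k v : orth_nonzero A X k v <->
  [/\ v \in A, v != 0 & forall i, (0 < i <= k)%N -> dotr v (X i) = 0].
Proof.
split=> -[vA v0 h]; split => //.
  move=> i ik; apply/h/memv_span/mapP; exists i => //.
  by rewrite mem_iota add1n ltnS.
move=> w wX; rewrite (coord_span wX) dotrC dotr_suml big1// => i _.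
rewrite dotrZl dotrC.
have /mapP[j] : [seq X i | i <- iota 1 k]`_i \in [seq X i | i <- iota 1 k].
  by apply: mem_nth; rewrite size_map size_iota.
rewrite mem_iota add1n ltnS => jk ->; by rewrite h ?mulr0.
Qed.

Lemma orth_nonzero_le A X k l v : (k <= l)%N ->
  orth_nonzero A X l v -> orth_nonzero A X k v.
Proof.
move=> kl /orth_nonzeroE[vA v0 h]; apply/orth_nonzeroE; split => // i /andP[i0 ik].
by apply: h; rewrite i0 (leq_trans ik).
Qed.

Lemma omegaC (v w : 'rV[R]_n) : v != 0 -> w != 0 -> omega v w = omega w v.
Proof.
move=> v0 w0; apply: (@pexpIrn _ 2) => //; rewrite ?nnegrE ?omega_ge0//.
by rewrite !sqr_omega// (dotrC w v) (mulrC (dotr w w)).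
Qed.

Lemma minimizing_pairsC A B j X Y :
  minimizing_pairs A B j X Y -> minimizing_pairs B A j Y X.
Proof.
move=> h k kj; have [hX hY hm] := h k kj; split => // v w hv hw.
have [_ v0 _] := hv; have [_ w0 _] := hw; have [_ X0 _] := hX; have [_ Y0 _] := hY.
by rewrite omegaC// (omegaC v0)// hm.
Qed.

Lemma psiC A B j : (0 < j)%N -> psi A B j = psi B A j.
Proof.
move=> j0; rewrite /psi; congr xget; apply/seteqP; split => r /= [X [Y [h ->]]].
all: exists Y, X; split; first exact: minimizing_pairsC.
all: have := h j.-1; rewrite ltn_predL prednK// => /(_ j0)[[_ X0 _] [_ Y0 _] _].
all: exact: omegaC.
Qed.

Lemma omega_dist (v w : 'rV[R]_n) : v != 0 -> w != 0 ->
  enorm (v - (dotr v w / dotr w w) *: w) = omega v w * enorm v.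
Proof.
move=> v0 w0; apply: (@pexpIrn _ 2) => //.
- by rewrite nnegrE enorm_ge0.
- by rewrite nnegrE mulr_ge0 ?omega_ge0 ?enorm_ge0.
have ww : dotr w w != 0 by rewrite dotr_eq0.
have vv : dotr v v != 0 by rewrite dotr_eq0.
rewrite exprMn sqr_omega// !sqr_enorm dotrBl !dotrBr !dotrZl !dotrZr (dotrC w v).
by field; rewrite ww vv.
Qed.

(** The constraint sets shrink as the index grows, so a later pair competes in every earlier
    minimization. *)
Lemma minimizing_mono A B j X Y i k : minimizing_pairs A B j X Y ->
  (0 < i <= k)%N -> (k <= j)%N -> omega (X i) (Y i) <= omega (X k) (Y k).
Proof.
move=> h /andP[i0 ik] kj; case: i i0 ik => // i _ ik.
case: k ik kj => // k ik kj.
have [_ _ hm] := h i (leq_trans ik kj); have [hX hY _] := h k kj.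
by apply: hm; apply: orth_nonzero_le; [exact: ik|exact: hX|exact: ik|exact: hY].
Qed.

(** The vectors [X 1, ..., X j] form an orthogonal basis of [A], and each is at relative distance at
    most [omega (X j) (Y j)] from [B]. The factor [j] is the triangle inequality on the expansion of
    [x], whose components have norm at most [enorm x]. *)
Lemma minimizing_dist A B j X Y : minimizing_pairs A B j X Y -> (0 < j)%N ->
  \dim A = j -> forall x, x \in A ->
  exists2 b, b \in B & enorm (x - b) <= j%:R * omega (X j) (Y j) * enorm x.
Proof.
move=> h j0 dA x xA.
have hX (i : 'I_j) : [/\ X i.+1 \in A, X i.+1 != 0 &
    forall k : 'I_j, (k < i)%N -> dotr (X i.+1) (X k.+1) = 0].
  have [/orth_nonzeroE[XA X0 hi] _ _] := h i (ltn_ord i); split => // k ki.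
  by apply: hi.
have orth (i k : 'I_j) : i != k -> dotr (X i.+1) (X k.+1) = 0.
  rewrite neq_ltn => /orP[ik|ki]; last by have [_ _ hi] := hX i; exact: hi.
  by rewrite dotrC; have [_ _ hk] := hX k; exact: hk.
pose M : 'M[R]_(j, n) := \matrix_i X i.+1.
have dM (c : 'rV_j) (i : 'I_j) : dotr (c *m M) (X i.+1) = c 0 i * dotr (X i.+1) (X i.+1).
  rewrite mulmx_sum_row dotr_suml (bigD1 i)//= big1 ?addr0 => [|k ki].
    by rewrite rowK dotrZl.
  by rewrite rowK dotrZl orth ?mulr0.
have fM : row_free M.
  apply/inj_row_free => c cM; apply/rowP => i; rewrite mxE.
  have := dM c i; rewrite cM dotr0l => /esym/eqP; rewrite mulf_eq0 dotr_eq0.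
  by have [_ /negPf -> _] := hX i; rewrite orbF => /eqP.
have [|_ hM] := row_basis_free dA fM.
  by move=> i; rewrite rowK; have [] := hX i.
have /hM[c xE] := xA.
pose b i := (dotr (X i) (Y i) / dotr (Y i) (Y i)) *: Y i.
exists (\sum_(i < j) c 0 i *: b i.+1).
  apply: memv_suml => i _; apply/memvZ/memvZ.
  by have [_ /orth_nonzeroE[YB _ _] _] := h i (ltn_ord i).
have -> : x - \sum_(i < j) c 0 i *: b i.+1 = \sum_(i < j) c 0 i *: (X i.+1 - b i.+1).
  rewrite xE mulmx_sum_row -sumrB; apply: eq_bigr => i _.
  by rewrite rowK scalerBr.
apply: le_trans (enorm_sum _ _ _) _.
have -> : j%:R * omega (X j) (Y j) * enorm x =
    \sum_(i < j) (omega (X j) (Y j) * enorm x).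
  by rewrite sumr_const card_ord -[RHS]mulr_natl mulrA.
apply: ler_sum => i _.
have [_ X0 _] := hX i; have [_ /orth_nonzeroE[_ Y0 _] _] := h i (ltn_ord i).
rewrite enormZ /b omega_dist// mulrCA; apply: ler_pM.
- exact: omega_ge0.
- by rewrite mulr_ge0 ?enorm_ge0.
- by apply: (minimizing_mono h) => //; exact: ltn_ord.
have X1 : 0 < enorm (X i.+1) by rewrite enorm_gt0.
rewrite -(ler_pM2r X1) -mulrA -expr2 sqr_enorm.
rewrite -[dotr _ _]ger0_norm ?dotr_ge0// -normrM -dM -xE.
exact: dotr_le.
Qed.

(* For all [t], [X i + t *: v] competes with [X i] in the [i]-th minimization:
   the first variation vanishes. *)
Lemma minimizing_cross A B j X Y : minimizing_pairs A B j X Y ->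
  forall i v, (0 < i <= j)%N -> orth_nonzero A X i v -> dotr v (Y i) = 0.
Proof.
move=> h [//|i] v /= ij hv.
have [hX hY hm] := h i ij.
have [XA X0 XX] := (orth_nonzeroE _ _ _ _).1 hX.
have [YB Y0 YY] := (orth_nonzeroE _ _ _ _).1 hY.
have [vA v0 vX] := (orth_nonzeroE _ _ _ _).1 hv.
have vXi : dotr v (X i.+1) = 0 by apply: vX; rewrite leqnn.
have Xp : 0 < dotr (X i.+1) (X i.+1) by rewrite lt_def dotr_ge0 dotr_eq0 X0.
have Yp : 0 < dotr (Y i.+1) (Y i.+1) by rewrite lt_def dotr_ge0 dotr_eq0 Y0.
have vp : 0 < dotr v v by rewrite lt_def dotr_ge0 dotr_eq0 v0.
have key t : (dotr (X i.+1) (Y i.+1) + t * dotr v (Y i.+1)) ^+ 2 * dotr (X i.+1) (X i.+1)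
    <= dotr (X i.+1) (Y i.+1) ^+ 2 * (dotr (X i.+1) (X i.+1) + t ^+ 2 * dotr v v).
  pose u := X i.+1 + t *: v.
  have uu : dotr u u = dotr (X i.+1) (X i.+1) + t ^+ 2 * dotr v v.
    by rewrite /u !dotrDl !dotrDr !dotrZl !dotrZr (dotrC _ v) vXi; ring.
  have up : 0 < dotr u u by rewrite uu ltr_wpDr// mulr_ge0 ?sqr_ge0// ltW.
  have u0 : u != 0 by rewrite -dotr_eq0 gt_eqF.
  have : omega (X i.+1) (Y i.+1) ^+ 2 <= omega u (Y i.+1) ^+ 2.
    rewrite ler_pXn2r ?nnegrE ?omega_ge0//; apply: hm => //.
    apply/orth_nonzeroE; split => //; first by rewrite memvD// memvZ.
    move=> k /andP[k0 ki]; rewrite dotrDl dotrZl XX ?k0// vX ?mulr0 ?addr0//.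
    by rewrite k0 leqW.
  rewrite !sqr_omega// lerD2l lerN2 !invfM !mulrA ler_pM2r ?invr_gt0//.
  rewrite ler_pdivrMr// mulrAC ler_pdivlMr// -uu.
  by rewrite /u dotrDl dotrZl.
move: key; set a := dotr (X _) (Y _); set b := dotr v _; set x := dotr (X _) _.
move=> key; apply: contrapT => /eqP b0.
have b2 : 0 < b ^+ 2 by rewrite exprn_even_gt0.
have [a0|a0] := eqVneq a 0.
  have := key 1; rewrite a0 !add0r expr0n mul0r mul1r.
  by rewrite leNgt mulr_gt0.
have a2 : 0 < a ^+ 2 by rewrite exprn_even_gt0.
(* This value of [t] equals [x * b / (a * dotr v v)], where the squared cosine between
   [X i.+1 + t *: v] and [Y i.+1] is maximal; if [b] were nonzero it would beat [t = 0]. *)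
have := key (x / (a * b * dotr v v) * b ^+ 2).
suff : 0 < (a + x / (a * b * dotr v v) * b ^+ 2 * b) ^+ 2 * x -
   a ^+ 2 * (x + (x / (a * b * dotr v v) * b ^+ 2) ^+ 2 * dotr v v).
  by rewrite subr_gt0 ltNge => /negPf ->.
have -> : (a + x / (a * b * dotr v v) * b ^+ 2 * b) ^+ 2 * x -
   a ^+ 2 * (x + (x / (a * b * dotr v v) * b ^+ 2) ^+ 2 * dotr v v)
  = x ^+ 2 * b ^+ 2 / dotr v v * (1 + x * b ^+ 2 / (a ^+ 2 * dotr v v)).
  by field; rewrite b0 a0 gt_eqF.
have q : 0 <= x * b ^+ 2 / (a ^+ 2 * dotr v v).
  by apply: divr_ge0; apply: mulr_ge0; exact: ltW.
apply: mulr_gt0; last by rewrite ltr_wpDr.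
by apply: divr_gt0 => //; apply: mulr_gt0 => //; exact: exprn_gt0.
Qed.

(* By [minimizing_cross], [X j] is orthogonal to [Y 1], ..., [Y (j - 1)], hence
   so is its projection onto [B], which thus competes in the last minimization. *)
Lemma minimizing_le A B j X Y (eta : R) : minimizing_pairs A B j X Y -> (0 < j)%N ->
  eta < 1 ->
  (forall x, x \in A -> exists2 b, b \in B & enorm (x - b) <= eta * enorm x) ->
  omega (X j) (Y j) <= eta.
Proof.
move=> h j0 eta1 near.
have jj : (j.-1 < j)%N by rewrite ltn_predL.
have [hX hY hm] := h j.-1 jj; rewrite (prednK j0) in hX hY hm.
have [XA X0 XX] := (orth_nonzeroE _ _ _ _).1 hX.
have X1 : 0 < enorm (X j) by rewrite enorm_gt0.
have [b bB hb] := near _ XA.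
have [y yB orth] := orthoproj_vs B (X j).
have hy : enorm (X j - y) <= eta * enorm (X j).
  apply: le_trans hb; have -> : X j - b = (X j - y) + (y - b) by rewrite addrA subrK.
  by apply: enorm_le_orth; apply: orth; rewrite memvB.
have y0 : y != 0.
  apply: contraTneq hy => ->; rewrite subr0 -ltNge -[ltRHS]mul1r ltr_pM2r//.
have Xy : dotr (X j) y = dotr y y.
  by apply/eqP; rewrite -subr_eq0 -dotrBl orth.
have : omega (X j) y <= eta.
  rewrite -(ler_pM2r X1) -omega_dist// Xy divff ?dotr_eq0// scale1r//.
apply: le_trans; apply: hm => //; apply/orth_nonzeroE; split => // i /andP[i0 ij].
have yYi : dotr (X j - y) (Y i) = 0.
  apply: orth; case: i i0 ij => // i _ ij.
  by have [_ [] ] := h i (leq_trans ij (leq_pred _)).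
have : dotr (X j) (Y i) = 0.
  apply: (minimizing_cross h); first by rewrite i0 (leq_trans ij) ?leq_pred.
  exact: orth_nonzero_le hX.
by move=> XY0; move: yYi; rewrite dotrBl XY0 sub0r => /eqP; rewrite oppr_eq0 => /eqP.
Qed.

End Minimizers.

(** * Existence of minimizing pairs by compactness *)

Section MinimizersExist.
Context {R : realType} {n : nat}.
Implicit Types (A B : {vspace 'rV[R]_n}) (X Y : nat -> 'rV[R]_n).
Import numFieldNormedType.Exports.
Local Open Scope classical_set_scope.
Local Open Scope ring_scope.

Lemma orth_nonzero_ex A X k : (k < \dim A)%N -> exists v, orth_nonzero A X k v.
Proof.
move=> kA; have [M [fM hM]] := row_basis_exists A.
pose N : 'M[R]_(k, n) := \matrix_i X i.+1.
have : kermx (M *m N^T) != 0.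
  rewrite -mxrank_eq0 mxrank_ker subn_eq0 -ltnNge.
  exact: leq_ltn_trans (rank_leq_col _) kA.
move=> /rowV0Pn[c /sub_kermxP cMN c0]; exists (c *m M).
apply/orth_nonzeroE; split; first by apply/hM; exists c.
  by apply: contra_neq c0 => cM; apply: (row_free_inj fM); rewrite cM mul0mx.
move=> [//|i] /= ik.
have /matrixP/(_ 0 (Ordinal ik)) := cMN.
rewrite mulmxA dotr_row row_id rowK mxE => //.
Qed.

Lemma continuous_sum_rV m I (r : seq I) (F : I -> 'rV[R]_m -> R) :
  (forall i, continuous (F i)) -> continuous (fun z => \sum_(i <- r) F i z).
Proof.
move=> cF; elim: r => [|i r IH].
  by under eq_fun => z do rewrite big_nil; exact: cst_continuous.
under eq_fun => z do rewrite big_cons.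
by move=> z; apply: continuousD; [exact: cF|exact: IH].
Qed.

Lemma dotr_continuous m (f g : 'I_n -> 'I_m) : continuous
  (fun z : 'rV[R]_m => dotr (\row_i z 0 (f i)) (\row_i z 0 (g i))).
Proof.
under eq_fun => z.
  rewrite /dotr; under eq_bigr => i _ do rewrite !mxE.
  over.
apply: continuous_sum_rV => i z.
by apply: continuousM; exact: coord_continuous.
Qed.

Lemma dotrl_continuous m (f : 'I_n -> 'I_m) w : continuous
  (fun z : 'rV[R]_m => dotr (\row_i z 0 (f i)) w).
Proof.
under eq_fun => z.
  rewrite /dotr; under eq_bigr => i _ do rewrite !mxE.
  over.
apply: continuous_sum_rV => i z.
by apply: continuousM; [exact: coord_continuous|exact: cst_continuous].
Qed.

Lemma closed_zeros m (W : set 'rV[R]_n) (f : 'I_n -> 'I_m) :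
  closed [set z : 'rV[R]_m | forall w, W w -> dotr (\row_i z 0 (f i)) w = 0].
Proof.
rewrite (_ : mkset _ = \bigcap_(w in W)
  (fun z : 'rV[R]_m => dotr (\row_i z 0 (f i)) w) @^-1` [set 0])//.
apply: closed_bigI => w _; apply: preimage_closed; last exact: closed_eq.
by move=> z _; exact: dotrl_continuous.
Qed.

Lemma closed_unit m (f : 'I_n -> 'I_m) :
  closed [set z : 'rV[R]_m | dotr (\row_i z 0 (f i)) (\row_i z 0 (f i)) = 1].
Proof.
rewrite (_ : mkset _ = (fun z : 'rV[R]_m =>
  dotr (\row_i z 0 (f i)) (\row_i z 0 (f i))) @^-1` [set 1])//.
apply: preimage_closed; last exact: closed_eq.
by move=> z _; exact: dotr_continuous.
Qed.

(** Minimizing a sine is maximizing the absolute scalar product of unit vectors, over a compact set.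
    A pair of vectors is encoded as one row of length [n + n], to which the extreme value theorem
    applies. *)
Lemma omega_minimizer (U V : set 'rV[R]_n) :
  (exists2 u, u != 0 & forall w, U w -> dotr u w = 0) ->
  (exists2 v, v != 0 & forall w, V w -> dotr v w = 0) ->
  exists x y, [/\ x != 0 /\ y != 0, forall w, U w -> dotr x w = 0,
    forall w, V w -> dotr y w = 0 &
    forall u v, u != 0 -> v != 0 -> (forall w, U w -> dotr u w = 0) ->
      (forall w, V w -> dotr v w = 0) -> omega x y <= omega u v].
Proof.
move=> [u u0 hu] [v v0 hv].
pose l (z : 'rV[R]_(n + n)) : 'rV[R]_n := \row_i z 0 (lshift n i).
pose r (z : 'rV[R]_(n + n)) : 'rV[R]_n := \row_i z 0 (rshift n i).
have lE (a b : 'rV[R]_n) : l (row_mx a b) = a.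
  by apply/rowP => i; rewrite mxE row_mxEl.
have rE (a b : 'rV[R]_n) : r (row_mx a b) = b.
  by apply/rowP => i; rewrite mxE row_mxEr.
pose S := ([set z | forall w, U w -> dotr (l z) w = 0] `&`
           [set z | forall w, V w -> dotr (r z) w = 0]) `&`
          ([set z | dotr (l z) (l z) = 1] `&` [set z | dotr (r z) (r z) = 1]).
have Scl : closed S.
  by apply: closedI; apply: closedI;
    [exact: closed_zeros|exact: closed_zeros|exact: closed_unit|exact: closed_unit].
have Scp : compact S.
  have cp := @rV_compact _ (n + n) (fun=> `[(-1 : R), 1]%classic) (fun=> @segment_compact _ _ _).
  apply: (subclosed_compact Scl cp) => z [_ [l1 r1]] i /=.
  rewrite in_itv /= -ler_norml.
  have n1 (a : 'rV[R]_n) j : dotr a a = 1 -> `|a 0 j| <= 1.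
    move=> a1; apply: le_trans (coord_le_enorm _ _) _.
    by rewrite /enorm a1 sqrtr1.
  case: (split_ordP i) => j ->.
    by have := n1 _ j l1; rewrite mxE.
  by have := n1 _ j r1; rewrite mxE.
have unitS a b : a != 0 -> b != 0 -> (forall w, U w -> dotr a w = 0) ->
    (forall w, V w -> dotr b w = 0) ->
    S (row_mx ((enorm a)^-1 *: a) ((enorm b)^-1 *: b)).
  move=> a0 b0 ha hb; rewrite /S /= !lE !rE.
  have e1 (c : 'rV[R]_n) : c != 0 -> dotr ((enorm c)^-1 *: c) ((enorm c)^-1 *: c) = 1.
    move=> c0; rewrite dotrZl dotrZr -sqr_enorm expr2 mulrA -invfM mulVf//.
    by rewrite mulf_neq0 ?enorm_eq0.
  split; split; [move=> w Uw| move=> w Vw|exact: e1|exact: e1].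
    by rewrite dotrZl ha// mulr0.
  by rewrite dotrZl hb// mulr0.
have [z zS zmax] := @EVT_max_rV R (n + n) (fun z => dotr (l z) (r z)) S
  (ex_intro _ _ (unitS u v u0 v0 hu hv)) Scp
  (continuous_subspaceT (@dotr_continuous _ _ _)).
rewrite inE in zS; case: zS => [[zU zV] [zl zr]].
have nz (c : 'rV[R]_n) : dotr c c = 1 -> c != 0.
  by move=> c1; rewrite -dotr_eq0 c1 oner_eq0.
exists (l z), (r z); split => //; first by split; exact: nz.
move=> a b a0 b0 ha hb.
have lz0 := nz _ zl; have rz0 := nz _ zr.
rewrite -(@ler_pXn2r _ 2)// ?nnegrE ?omega_ge0// !sqr_omega//.
rewrite zl zr mulr1 divr1 lerD2l lerN2.
have pa : 0 < enorm a by rewrite enorm_gt0.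
have pb : 0 < enorm b by rewrite enorm_gt0.
have bound c : c != 0 -> (forall w, V w -> dotr c w = 0) ->
    (enorm a)^-1 * ((enorm c)^-1 * dotr a c) <= dotr (l z) (r z).
  move=> c0 hc; have := zmax (row_mx ((enorm a)^-1 *: a) ((enorm c)^-1 *: c)).
  by rewrite inE lE rE dotrZl dotrZr; apply; exact: unitS.
have := bound b b0 hb.
(* The maximum concerns the signed product; testing [- b] as well bounds its absolute value. *)
have := bound (- b); rewrite oppr_eq0 => /(_ b0) h1.
have {h1} := h1 (fun w Vw => etrans (dotrNl _ _) (etrans (congr1 _ (hb w Vw)) (oppr0 _))).
rewrite enormN -scaleN1r dotrZr !mulN1r !mulrN => h1 h2.
have -> : dotr a b ^+ 2 / (dotr a a * dotr b b) =
    ((enorm a)^-1 * ((enorm b)^-1 * dotr a b)) ^+ 2.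
  by rewrite -!sqr_enorm; field; rewrite !gt_eqF.
rewrite -[leLHS]real_normK ?num_real// -[leRHS]real_normK ?num_real//.
rewrite ler_pXn2r ?nnegrE//; apply: (@le_trans _ _ (dotr (l z) (r z))); last exact: ler_norm.
by rewrite ler_norml h2 andbT lerNl.
Qed.

(** Rewrites the constraint as the linear equations expected by [omega_minimizer]: orthogonality to
    the complement of [A] and to the previous vectors. *)
Lemma orth_nonzero_zeros A X k v :
  orth_nonzero A X k v <-> v != 0 /\
    forall w, ((forall b, b \in A -> dotr b w = 0) \/
               exists2 i, (0 < i <= k)%N & w = X i) -> dotr v w = 0.
Proof.
split=> [/orth_nonzeroE[vA v0 h]|[v0 h]].
  by split=> // w [/(_ v vA)//|[i ik ->]]; exact: h.
apply/orth_nonzeroE; split => //.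
  by apply: orth_vs_mem => w hw; apply: h; left.
by move=> i ik; apply: h; right; exists i.
Qed.

Lemma minimizing_pairs_ex A B j : (j <= \dim A)%N -> (j <= \dim B)%N ->
  exists X Y, minimizing_pairs A B j X Y.
Proof.
elim: j => [|j IH] jA jB; first by exists (fun=> 0), (fun=> 0).
have [X [Y h]] := IH (ltnW jA) (ltnW jB).
have [u /orth_nonzero_zeros[u0 hu]] := orth_nonzero_ex X jA.
have [v /orth_nonzero_zeros[v0 hv]] := orth_nonzero_ex Y jB.
have [x [y [[x0 y0] hx hy hmin]]] := omega_minimizer (ex_intro2 _ _ u u0 hu) (ex_intro2 _ _ v v0 hv).
(* Only entry [j.+1] is overwritten, and the constraints of index at most [j] do not involve it. *)
pose upd (Z : nat -> 'rV[R]_n) z i := if i == j.+1 then z else Z i.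
have updE C Z z k w : (k <= j)%N ->
    orth_nonzero C (upd Z z) k w <-> orth_nonzero C Z k w.
  move=> kj; split=> /orth_nonzeroE[wC w0 hw]; apply/orth_nonzeroE; split => // i /andP[i0 ik].
    have := hw i; rewrite /upd i0 ik ltn_eqF; first exact.
    by rewrite ltnS (leq_trans ik).
  rewrite /upd ltn_eqF ?hw ?i0//.
  by rewrite ltnS (leq_trans ik).
exists (upd X x), (upd Y y) => k; rewrite ltnS leq_eqVlt => /orP[/eqP ->|kj].
  rewrite /upd eqxx; split.
  - by apply/updE => //; apply/orth_nonzero_zeros; split.
  - by apply/updE => //; apply/orth_nonzero_zeros; split.
  move=> a b /updE => /(_ (leqnn _))/orth_nonzero_zeros[a0 ha].
  move=> /updE => /(_ (leqnn _))/orth_nonzero_zeros[b0 hb].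
  exact: hmin.
have [hX hY hm] := h k kj; have kj' := ltnW kj.
have uE Z z : upd Z z k.+1 = Z k.+1 by rewrite /upd eqSS (ltn_eqF kj).
rewrite !uE; split; [exact/updE|exact/updE|] => a b /updE ha /updE hb.
by apply: hm; [exact: ha|exact: hb].
Qed.

(** The estimates [minimizing_dist] and [minimizing_le] hold for all minimizing pairs, hence for the
    value that [xget] selects, whichever it is. *)
Lemma psi_spec A B j : (j <= \dim A)%N -> (j <= \dim B)%N ->
  exists X Y, minimizing_pairs A B j X Y /\ psi A B j = omega (X j) (Y j).
Proof.
move=> jA jB; have [X [Y h]] := minimizing_pairs_ex jA jB.
have := @xgetI _ (0 : R) [set r | exists X Y, minimizing_pairs A B j X Y /\ r = omega (X j) (Y j)]
  (omega (X j) (Y j)) (ex_intro _ X (ex_intro _ Y (conj h erefl))).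
exact.
Qed.

Lemma psi_dist A B : (0 < \dim A <= \dim B)%N -> forall x, x \in A ->
  exists2 b, b \in B &
    enorm (x - b) <= (\dim A)%:R * psi A B (\dim A) * enorm x.
Proof.
move=> /andP[dA dAB]; have [X [Y [h ->]]] := psi_spec (leqnn (\dim A)) dAB.
exact: minimizing_dist h dA erefl.
Qed.

Lemma psi_le A B (eta : R) : (0 < \dim A <= \dim B)%N -> eta < 1 ->
  (forall x, x \in A -> exists2 b, b \in B & enorm (x - b) <= eta * enorm x) ->
  psi A B (\dim A) <= eta.
Proof.
move=> /andP[dA dAB]; have [X [Y [h ->]]] := psi_spec (leqnn (\dim A)) dAB.
exact: minimizing_le h dA.
Qed.

End MinimizersExist.

(** * The limit subspace *)

Section Tensor.
Context {K : comNzRingType} {m d : nat}.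

(** Tensors are flattened matrices with rows indexed by the first factor; a linear form on that
    factor acts on [vec_mx] by left multiplication. *)
Definition tens (x : 'rV[K]_m) (v : 'rV[K]_d) : 'rV[K]_(m * d) :=
  mxvec (x^T *m v).

Lemma tensE x v i j : vec_mx (tens x v) i j = x 0 i * v 0 j.
Proof. by rewrite mxvecK !mxE big_ord1 !mxE. Qed.

Lemma tensDl x y v : tens (x + y) v = tens x v + tens y v.
Proof. by rewrite /tens linearD mulmxDl linearD. Qed.

Lemma tensDr x v w : tens x (v + w) = tens x v + tens x w.
Proof. by rewrite /tens mulmxDr linearD. Qed.

Lemma tensZl a x v : tens (a *: x) v = a *: tens x v.
Proof. by rewrite /tens linearZ /= -scalemxAl linearZ. Qed.

Lemma tensZr a x v : tens x (a *: v) = a *: tens x v.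
Proof. by rewrite /tens -scalemxAr linearZ. Qed.

Lemma tensBl x y v : tens (x - y) v = tens x v - tens y v.
Proof. by rewrite tensDl -scaleN1r tensZl scaleN1r. Qed.

Lemma tensBr x v w : tens x (v - w) = tens x v - tens x w.
Proof. by rewrite tensDr -scaleN1r tensZr scaleN1r. Qed.

Fact tens_is_linear x : linear (tens x).
Proof. by move=> a u v; rewrite tensDr tensZr. Qed.

HB.instance Definition _ x := GRing.isLinear.Build K _ _ _ (tens x) (tens_is_linear x).

End Tensor.

Section TensorReal.
Context {R : realType} {m d : nat}.

Lemma dotr_mxvec (a b : 'M[R]_(m, d)) :
  dotr (mxvec a) (mxvec b) = \sum_i \sum_j a i j * b i j.
Proof.
rewrite /dotr (reindex _ (curry_mxvec_bij m d)) /=.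
rewrite (pair_bigA _ (fun i j => a i j * b i j)) /=.
by apply: eq_bigr => -[i j] _; rewrite !mxvecE.
Qed.

Lemma dotr_tens (x y : 'rV[R]_m) (v w : 'rV[R]_d) :
  dotr (tens x v) (tens y w) = dotr x y * dotr v w.
Proof.
rewrite dotr_mxvec [dotr x y]/dotr mulr_suml; apply: eq_bigr => i _.
rewrite /dotr mulr_sumr; apply: eq_bigr => j _.
by rewrite !mxE !big_ord1 !mxE; ring.
Qed.

Lemma enorm_tens (x : 'rV[R]_m) (v : 'rV[R]_d) :
  enorm (tens x v) = enorm x * enorm v.
Proof. by rewrite /enorm dotr_tens sqrtrM ?dotr_ge0. Qed.

(** Cauchy-Schwarz on each column of [vec_mx z], summed over the columns. *)
Lemma enorm_contract (f : 'rV[R]_m) (z : 'rV[R]_(m * d)) :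
  enorm (f *m vec_mx z) <= enorm f * enorm z.
Proof.
rewrite -(@ler_pXn2r _ 2)// ?nnegrE ?mulr_ge0 ?enorm_ge0//.
rewrite exprMn !sqr_enorm -{3 4}(vec_mxK z) dotr_mxvec exchange_big /=.
rewrite {1}/dotr mulr_sumr; apply: ler_sum => j _.
have -> : (f *m vec_mx z) 0 j = dotr f (col j (vec_mx z))^T.
  by rewrite mxE; apply: eq_bigr => i _; rewrite !mxE.
rewrite -expr2; apply: le_trans (sqr_dotr_le _ _) _.
by rewrite ler_wpM2l ?dotr_ge0//; apply: ler_sum => i _; rewrite !mxE.
Qed.

Lemma contract_tens (f x : 'rV[R]_m) (v : 'rV[R]_d) :
  f *m vec_mx (tens x v) = dotr f x *: v.
Proof. by rewrite mxvecK mulmxA mulmx_tr_dotr mul_scalar_mx. Qed.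

Definition lineT (x : 'rV[R]_m) : {vspace 'rV[R]_(m * d)} := limg (linfun (tens x)).

Lemma mem_lineT x z : z \in lineT x <-> exists v, z = tens x v.
Proof.
split=> [/memv_imgP[v _ ->]|[v ->]]; first by exists v; rewrite lfunE.
by apply/memv_imgP; exists v; rewrite ?memvf ?lfunE.
Qed.

Lemma dim_lineT x : x != 0 -> \dim (lineT x) = d.
Proof.
move=> x0; rewrite /lineT limg_dim_eq ?dimvf /dim/= ?mul1n//.
have /eqP -> : lker (linfun (tens x : 'rV[R]_d -> _)) == 0%VS.
  apply/lker0P => u v; rewrite !lfunE /= => /eqP.
  by rewrite -subr_eq0 -tensBr -enorm_eq0 enorm_tens mulf_eq0 !enorm_eq0
    (negPf x0) /= subr_eq0 => /eqP.
by rewrite capv0.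
Qed.

End TensorReal.
Arguments lineT {R m d} x.

(** * The sequence, its limit and the linear forms that detect it *)

Section Sequence.
Context {R : realType} (alpha : R) (q : nat).
Local Notation zmx := (@intmx R _ _).

(** In the quotient of consecutive terms, the factor [den N'] gives the divisibility needed for
    coprimality, the truncation plus one is between one and two times [den N' ^ (alpha - 2)], and
    the factor 2 makes the sequence at least double. *)
Fixpoint den (N : nat) : nat :=
  if N is N'.+1 then
    ((2 * den N' * (Num.truncn ((den N')%:R `^ (alpha - 2))).+1) * den N')%N
  else 1%N.

Definition ratio (N : nat) : nat :=
  (2 * den N * (Num.truncn ((den N)%:R `^ (alpha - 2))).+1)%N.

Definition pos (N : nat) : 'I_q.+1 := inord (N %% q).+1.

Fixpoint numer (N : nat) : 'rV[int]_q.+1 :=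
  if N is N'.+1 then (ratio N')%:Z *: numer N' + delta_mx 0 (pos N')
  else delta_mx 0 0.

Definition xi (N : nat) : 'rV[R]_q.+1 := (den N)%:R^-1 *: zmx (numer N).

(** The coordinates of [xi N] are nondecreasing and bounded, so the supremum is the limit. *)
Definition limxi : 'rV[R]_q.+1 := \row_i sup (range (fun N => xi N 0 i)).

(** The form comparing coordinate [pos (N + k)] with its value in [xi N]. For [k < q] this
    coordinate first moves between the indices [N + k] and [(N + k).+1], so the form vanishes on
    [xi N, ..., xi (N + k)] and is positive on [limxi]. *)
Definition phi (N k : nat) : 'rV[R]_q.+1 :=
  delta_mx 0 (pos (N + k)) - xi N 0 (pos (N + k)) *: delta_mx 0 0.

Lemma denS N : den N.+1 = (ratio N * den N)%N. Proof. by []. Qed.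

Lemma den_gt0 N : (0 < den N)%N.
Proof. by elim: N => //= N IH; rewrite !muln_gt0 IH. Qed.

Lemma den_ge2 N : (2 * den N <= den N.+1)%N.
Proof.
have := den_gt0 N; rewrite denS /ratio; set a := Num.truncn _ => h.
by apply: leq_mul => //; rewrite -mulnA leq_pmulr// muln_gt0 h.
Qed.

Lemma denR_gt0 N : 0 < (den N)%:R :> R.
Proof. by rewrite ltr0n den_gt0. Qed.

Lemma denR_neq0 N : (den N)%:R != 0 :> R.
Proof. by rewrite gt_eqF ?denR_gt0. Qed.

Lemma denR_ge1 N : 1 <= (den N)%:R :> R.
Proof. by rewrite ler1n den_gt0. Qed.

Lemma den_powR N : 2 <= alpha ->
  2 * (den N)%:R `^ alpha <= (den N.+1)%:R :> R /\
  (den N.+1)%:R <= 4 * (den N)%:R `^ alpha :> R.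
Proof.
move=> a2; have p := denR_gt0 N.
have e : (den N)%:R `^ alpha = (den N)%:R ^+ 2 * (den N)%:R `^ (alpha - 2) :> R.
  rewrite -powR_mulrn ?ler0n// -powRD; first by congr (_ `^ _); lra.
  by apply/implyP => _; rewrite gt_eqF.
have s1 : 1 <= (den N)%:R `^ (alpha - 2) :> R.
  rewrite -[X in X <= _](powRr0 (den N)%:R).
  by apply: ler_powR; rewrite ?denR_ge1//; lra.
rewrite denS /ratio e; set s := (den N)%:R `^ _ in s1 *.
have /andP[h1 h2] := truncn_itv (le_trans ler01 s1).
rewrite !natrM; set w := _.+1%:R in h2 *; set D := (den N)%:R.
have h3 : w <= s + 1 by rewrite /w -addn1 natrD lerD2r.
have D2 : 0 < D ^+ 2 by rewrite exprn_gt0.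
have -> : 2%:R * D * w * D = 2 * (D ^+ 2 * w) by ring.
split; first by rewrite ler_pM2l// ler_pM2l// ltW.
have -> : 4 * (D ^+ 2 * s) = 2 * (D ^+ 2 * (s + s)) by ring.
rewrite ler_pM2l// ler_pM2l//; lra.
Qed.

Lemma pos_neq0 N : (0 < q)%N -> pos N != 0.
Proof.
move=> q0; apply/eqP => /(congr1 val); rewrite /pos /= inordK//.
by rewrite ltnS; apply: ltn_pmod.
Qed.

Lemma pos_eq N M : (0 < q)%N -> (pos N == pos M) = (N == M %[mod q]).
Proof.
move=> q0; apply/eqP/eqP => [/(congr1 val)|e].
  by rewrite /pos /= !inordK ?ltnS ?ltn_pmod// => -[].
by rewrite /pos e.
Qed.

Lemma pos_neq N k l : (k < l < q)%N -> pos (N + k) != pos (N + l).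
Proof.
move=> /andP[kl lq]; rewrite pos_eq ?(leq_trans _ lq)// eqn_modDl.
by rewrite !modn_small ?(ltn_trans kl)// ltn_eqF.
Qed.

Lemma xi0 : xi 0 = delta_mx 0 0.
Proof.
rewrite /xi /= invr1 scale1r; apply/rowP => i; rewrite !mxE.
by case: (_ && _).
Qed.

Lemma xiS N : xi N.+1 = xi N + (den N.+1)%:R^-1 *: delta_mx 0 (pos N).
Proof.
apply/rowP => i; rewrite /xi !mxE intrD intrM mulrDr; congr (_ + _).
  have d0 := denR_neq0 N; have := denR_neq0 N.+1.
  rewrite denS natrM mulf_eq0 negb_or => /andP[r0 _].
  by rewrite -pmulrn; field; rewrite d0 r0.
by case: (_ && _).
Qed.

Lemma numer_xi N : zmx (numer N) = (den N)%:R *: xi N.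
Proof. by rewrite /xi scalerA mulfV ?denR_neq0// scale1r. Qed.

Lemma xiS_coord N i : xi N.+1 0 i = xi N 0 i + (i == pos N)%:R / (den N.+1)%:R.
Proof. by rewrite xiS [LHS]mxE; congr (_ + _); rewrite !mxE eqxx mulrC. Qed.

Lemma xi_mono N M i : (N <= M)%N -> xi N 0 i <= xi M 0 i.
Proof.
elim: M => [|M IH]; first by rewrite leqn0 => /eqP ->.
rewrite leq_eqVlt => /orP[/eqP -> //|/IH h].
apply: le_trans h _; rewrite xiS_coord lerDl divr_ge0// ltW// denR_gt0.
Qed.

Lemma xi_upper N M i : xi M 0 i <= xi N 0 i + 2 / (den N.+1)%:R.
Proof.
(* Replaces summing the tail: the left side does not increase with [K], because the denominators at
   least double. *)
have key K : xi (N + K) 0 i + 2 / (den (N + K).+1)%:R <= xi N 0 i + 2 / (den N.+1)%:R.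
  elim: K => [|K IH]; first by rewrite addn0.
  apply: le_trans IH; rewrite addnS xiS_coord -addrA lerD2l.
  have p := denR_gt0 (N + K).+1; have p' := denR_gt0 (N + K).+2.
  have : 2 / (den (N + K).+2)%:R <= 1 / (den (N + K).+1)%:R :> R.
    rewrite ler_pdivrMr// mulrAC mul1r ler_pdivlMr// -natrM ler_nat.
    exact: den_ge2.
  have : (i == pos (N + K))%:R / (den (N + K).+1)%:R <= 1 / (den (N + K).+1)%:R :> R.
    by rewrite ler_pM2r ?invr_gt0//; case: eqP; rewrite ?ler01.
  have -> : 2 / (den (N + K).+1)%:R = 1 / (den (N + K).+1)%:R + 1 / (den (N + K).+1)%:R :> R.
    by rewrite -mulrDl.
  exact: lerD.
have [NM|MN] := leqP N M; last first.
  apply: le_trans (xi_mono i (ltnW MN)) _; rewrite lerDl divr_ge0// ltW// denR_gt0.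
have := key (M - N)%N; rewrite subnKC//; apply: le_trans.
by rewrite lerDl divr_ge0// ltW// denR_gt0.
Qed.

Lemma den1_ge2 : 2 <= (den 1)%:R :> R.
Proof. by rewrite (ler_nat _ 2); exact: (den_ge2 0). Qed.

Lemma xi_coord0 N : (0 < q)%N -> xi N 0 0 = 1.
Proof.
move=> q0; elim: N => [|N IH]; first by rewrite xi0 !mxE.
by rewrite xiS_coord IH eq_sym (negPf (pos_neq0 _ q0)) mul0r addr0.
Qed.

Lemma xi_ge0 N i : 0 <= xi N 0 i.
Proof. by apply: le_trans (xi_mono i (leq0n N)); rewrite xi0 !mxE ler0n. Qed.

Lemma xi_le1 N i : (0 < q)%N -> xi N 0 i <= 1.
Proof.
move=> q0; have [->|i0] := eqVneq i 0; first by rewrite xi_coord0.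
apply: le_trans (xi_upper 0 N i) _; rewrite xi0 !mxE (negPf i0) /= add0r.
by rewrite ler_pdivrMr ?denR_gt0// mul1r den1_ge2.
Qed.

Lemma xi_range_sup i : has_sup (range (fun N => xi N 0 i)).
Proof.
split; first by exists (xi 0 0 i), 0%N.
by exists (xi 0 0 i + 2 / (den 1)%:R) => _ [M _ <-]; exact: xi_upper.
Qed.

Lemma limxi_ge N i : xi N 0 i <= limxi 0 i.
Proof.
rewrite [leRHS]mxE; apply: sup_upper_bound; first exact: xi_range_sup.
by exists N.
Qed.

Lemma limxi_le c i : (forall N, xi N 0 i <= c) -> limxi 0 i <= c.
Proof.
move=> h; rewrite mxE; apply: ge_sup; first exact: (xi_range_sup i).1.
by move=> _ [M _ <-].
Qed.

Lemma limxi_upper N i : limxi 0 i <= xi N 0 i + 2 / (den N.+1)%:R.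
Proof. by apply: limxi_le => M; exact: xi_upper. Qed.

Lemma limxi_coord0 : (0 < q)%N -> limxi 0 0 = 1.
Proof.
move=> q0; apply/eqP; rewrite eq_le; apply/andP; split.
  by apply: limxi_le => N; rewrite xi_coord0.
by rewrite -(xi_coord0 0 q0) limxi_ge.
Qed.

Lemma limxi_le1 i : (0 < q)%N -> limxi 0 i <= 1.
Proof. by move=> q0; apply: limxi_le => N; exact: xi_le1. Qed.

Lemma limxi_ge0 i : 0 <= limxi 0 i.
Proof. exact: le_trans (xi_ge0 0 i) (limxi_ge 0 i). Qed.

Lemma limxi_pos N k : xi N 0 (pos (N + k)) + (den (N + k).+1)%:R^-1 <=
  limxi 0 (pos (N + k)).
Proof.
apply: le_trans (limxi_ge (N + k).+1 _); rewrite xiS_coord eqxx mul1r lerD2r.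
by apply: xi_mono; rewrite leq_addr.
Qed.

Lemma xi_const N k i : (i <= k)%N -> (k < q)%N ->
  xi (N + i) 0 (pos (N + k)) = xi N 0 (pos (N + k)).
Proof.
move=> ik kq; elim: i ik => [|i IH] ik; first by rewrite addn0.
rewrite addnS xiS_coord IH ?(ltnW ik)// eq_sym (negPf (pos_neq _ _)) ?ik//.
by rewrite mul0r addr0.
Qed.

Lemma dotr_phi N k (z : 'rV[R]_q.+1) :
  dotr (phi N k) z = z 0 (pos (N + k)) - xi N 0 (pos (N + k)) * z 0 0.
Proof.
have dE j (w : 'rV[R]_q.+1) : dotr (delta_mx 0 j) w = w 0 j.
  rewrite /dotr (bigD1 j)//= big1 ?addr0; first by rewrite !mxE !eqxx mul1r.
  by move=> l lj; rewrite !mxE eqxx (negPf lj) mul0r.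
by rewrite /phi dotrBl dotrZl !dE.
Qed.

Lemma mulmx_phi d N k (Z : 'M[R]_(q.+1, d)) :
  phi N k *m Z = row (pos (N + k)) Z - xi N 0 (pos (N + k)) *: row 0 Z.
Proof. by rewrite /phi mulmxBl -scalemxAl -!rowE. Qed.

Lemma phi_xi N k i : (0 < q)%N -> (i <= k)%N -> (k < q)%N ->
  dotr (phi N k) (xi (N + i)) = 0.
Proof. by move=> q0 ik kq; rewrite dotr_phi xi_coord0// mulr1 xi_const// subrr. Qed.

Lemma phi_xiS N k : (0 < q)%N -> (k < q)%N ->
  dotr (phi N k) (xi (N + k).+1) = (den (N + k).+1)%:R^-1.
Proof.
move=> q0 kq; rewrite dotr_phi xi_coord0// mulr1 xiS_coord eqxx xi_const// mul1r.
by rewrite addrAC subrr add0r.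
Qed.

Lemma phi_limxi N k : (0 < q)%N ->
  (den (N + k).+1)%:R^-1 <= dotr (phi N k) limxi.
Proof.
by move=> q0; rewrite dotr_phi limxi_coord0// mulr1 lerBrDl limxi_pos.
Qed.

Lemma enorm_phi N k : (0 < q)%N -> enorm (phi N k) <= 2.
Proof.
move=> q0; apply: le_trans (enormB _ _) _.
rewrite enormZ !enorm_delta mulr1 ger0_norm ?xi_ge0//.
have := xi_le1 N (pos (N + k)) q0; lra.
Qed.

Lemma enorm_xi_lim N : (0 < q)%N ->
  enorm (limxi - xi N) <= q.+1%:R * (2 / (den N.+1)%:R).
Proof.
move=> q0; apply: enorm_le_coord => [|i]; first by rewrite divr_ge0// ltW// denR_gt0.
have -> : (limxi - xi N) 0 i = limxi 0 i - xi N 0 i.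
  by rewrite [LHS]mxE; congr (_ + _); rewrite [LHS]mxE.
by rewrite ger0_norm ?subr_ge0 ?limxi_ge// lerBlDl limxi_upper.
Qed.

Lemma enorm_xi_le N : (0 < q)%N -> enorm (xi N) <= q.+1%:R.
Proof.
move=> q0; rewrite -[leRHS]mulr1; apply: enorm_le_coord => // i.
by rewrite ger0_norm ?xi_ge0// xi_le1.
Qed.

Lemma enorm_limxi_le : (0 < q)%N -> enorm limxi <= q.+1%:R.
Proof.
move=> q0; rewrite -[leRHS]mulr1; apply: enorm_le_coord => // i.
by rewrite ger0_norm ?limxi_ge0// limxi_le1.
Qed.

Lemma enorm_limxi_ge : (0 < q)%N -> 1 <= enorm limxi.
Proof.
by move=> q0; have := coord_le_enorm limxi 0; rewrite limxi_coord0// normr1.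
Qed.

Lemma xi_neq0 N : (0 < q)%N -> xi N != 0.
Proof.
move=> q0; apply/eqP => /rowP/(_ 0); rewrite xi_coord0// mxE => /eqP.
by rewrite oner_eq0.
Qed.

Lemma limxi_neq0 : (0 < q)%N -> limxi != 0.
Proof.
move=> q0; apply/eqP => /rowP/(_ 0); rewrite limxi_coord0// [RHS]mxE => /eqP.
by rewrite oner_eq0.
Qed.

Lemma enorm_xiS N : enorm (xi N.+1 - xi N) = (den N.+1)%:R^-1.
Proof.
by rewrite xiS addrAC subrr add0r enormZ enorm_delta mulr1 ger0_norm.
Qed.

(* The coordinate [pos N] of [numer N.+1] is [1] modulo [ratio N], and every
   prime factor of [den N.+1] divides [ratio N]. *)
Lemma coprime_numer N : (0 < q)%N -> coprimez (den N.+1)%:Z (numer N.+1 0 (pos N)).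
Proof.
move=> q0; rewrite denS PoszM.
have -> : numer N.+1 0 (pos N) = (ratio N)%:Z * numer N 0 (pos N) + 1.
  by rewrite [numer N.+1]/(_ + _) !mxE !eqxx.
have rd : (den N %| ratio N)%N by rewrite /ratio mulnAC dvdn_mull.
have c1 : coprimez (ratio N)%:Z ((ratio N)%:Z * numer N 0 (pos N) + 1).
  by rewrite /coprimez mulrC gcdzMDl gcdz1.
by rewrite coprimezMl c1; exact: (coprimez_dvdl _ c1).
Qed.

End Sequence.

Section IntegralFunctionals.
Context {R : realType} {n : nat}.
Local Notation zmx := (@intmx R _ _).

(* The integers [z *m L] form an invertible matrix when [z] runs over a Z-basis of
   [B], so their determinant is at least [1]. *)
Lemma height_ge_functionals (B : {vspace 'rV[R]_n}) (e : nat) (L : 'M[R]_(n, e))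
    (k : 'I_e -> R) :
  rational_subspace B -> \dim B = e -> (forall l, 0 <= k l) ->
  (forall z : 'rV[int]_n, zmx z \in B -> exists a : 'rV[int]_e, zmx z *m L = zmx a) ->
  (forall z, z \in B -> z *m L = 0 -> z = 0) ->
  (forall z l, z \in B -> `|(z *m L) 0 l| <= k l * enorm z) ->
  1 <= e`!%:R * height B ^+ 2 * (\prod_l k l) ^+ 2.
Proof.
move=> rB dB k0 intL injL bdL.
have [M [_ bM ->]] := height_spec rB dB; have [fM hM] := bM.
have /choice[F FE] : forall i, exists a : 'rV[int]_e, row i (zmx M) *m L = zmx a.
  by move=> i; rewrite row_zmx; apply: intL; rewrite -row_zmx; exact: row_basis_row.
have ME : zmx M *m L = zmx (\matrix_i F i).
  by apply/row_matrixP => i; rewrite row_mul FE row_zmx rowK.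
apply: le_trans (det_mulmx_le fM k0 _); last first.
  by move=> c l; apply: bdL; apply/hM; exists c.
have dn0 : \det (zmx M *m L) != 0.
  rewrite -unitfE -unitmxE -row_free_unit; apply/inj_row_free => c.
  rewrite mulmxA => /injL h; apply: (row_free_inj fM); rewrite mul0mx; apply: h.
  by apply/hM; exists c.
move: dn0; rewrite ME /intmx det_map_mx intr_eq0 => dn0.
exact: sqr_int_ge1.
Qed.

(** A Liouville inequality: adjoining [x] multiplies the height by at most the distance, and the new
    height is still at least 1. *)
Lemma height_dist_ge1 (B : {vspace 'rV[R]_n}) (x : 'rV[int]_n) (y : 'rV[R]_n) :
  rational_subspace B -> zmx x \notin B -> y \in B ->
  1 <= enorm (zmx x - y) * height B.
Proof.
move=> rB xB yB; have [rB' _ h] := height_add rB xB yB.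
by apply: le_trans h; exact: height_ge1.
Qed.

End IntegralFunctionals.

(** * Spans of consecutive lines of the sequence *)

Section Spaces.
Context {R : realType} (alpha : R) (q d : nat).
Context (q0 : (0 < q)%N).
Local Notation den := (den alpha).
Local Notation xi := (xi alpha q).
Local Notation numer := (numer alpha q).
Local Notation phi := (phi alpha q).
Local Notation limxi := (limxi alpha q).
Local Notation zmx := (@intmx R _ _).
Implicit Types (B : {vspace 'rV[R]_(q.+1 * d)}).

Definition Wsp (N Q : nat) : {vspace 'rV[R]_(q.+1 * d)} :=
  (\sum_(k < Q) lineT (xi (N + k)))%VS.

Definition limsp : {vspace 'rV[R]_(q.+1 * d)} := lineT limxi.

Lemma WspS N Q : Wsp N Q.+1 = (Wsp N Q + lineT (xi (N + Q)))%VS.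
Proof. by rewrite /Wsp big_ord_recr. Qed.

Lemma Wsp0 N : Wsp N 0 = 0%VS.
Proof. by rewrite /Wsp big_ord0. Qed.

Lemma WspSl N Q : Wsp N Q.+1 = (lineT (xi N) + Wsp N.+1 Q)%VS.
Proof.
rewrite /Wsp big_ord_recl addn0; congr (_ + _)%VS.
by apply: eq_bigr => i _; rewrite addSnnS.
Qed.

Lemma Wsp_subP N Q B :
  reflect (forall k, (k < Q)%N -> (lineT (xi (N + k)) <= B)%VS) (Wsp N Q <= B)%VS.
Proof.
apply: (iffP subv_sumP) => [h k kQ|h k _]; last exact: h.
exact: (h (Ordinal kQ)).
Qed.

Lemma lineT_sub_Wsp N Q k : (k < Q)%N -> (lineT (xi (N + k)) <= Wsp N Q)%VS.
Proof. by move=> kQ; rewrite /Wsp (sumv_sup (Ordinal kQ)). Qed.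

Lemma phi_Wsp N Q k z : (Q <= k.+1)%N -> (k < q)%N -> z \in Wsp N Q ->
  phi N k *m vec_mx z = 0.
Proof.
move=> Qk kq /memv_sumP[F hF ->]; rewrite linear_sum /= mulmx_sumr big1// => i _.
have /mem_lineT[v ->] := hF i isT.
rewrite contract_tens phi_xi ?scale0r// -ltnS.
by rewrite (leq_trans _ Qk).
Qed.

(** A triangular system: the last form [phi] vanishes on all lines but the last, whose component is
    therefore zero, and induction removes the others. These rows later supply the functionals for
    the height. *)
Lemma Wsp_eq0 N Q z : (Q <= q.+1)%N -> z \in Wsp N Q ->
  row 0 (vec_mx z) = 0 ->
  (forall k, (k.+1 < Q)%N -> row (pos q (N + k)) (vec_mx z) = 0) -> z = 0.
Proof.
elim: Q => [|Q IH] in z *; first by rewrite Wsp0 memv0 => _ /eqP.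
move=> Qq; rewrite WspS => /memv_addP[w wW [_ /mem_lineT[v ->] zE]] z0 zpos.
suff v0 : v = 0.
  rewrite v0 raddf0 addr0 in zE; rewrite zE; apply: IH => //.
  - exact: ltnW.
  - by rewrite -zE.
  - by move=> k kQ; rewrite -zE zpos// ltnW.
case: Q IH Qq wW zE zpos => [|Q] IH Qq wW zE zpos.
  move: wW; rewrite Wsp0 memv0 => /eqP w0.
  apply/rowP => j; have /rowP/(_ j) := z0.
  by rewrite zE w0 add0r [LHS]mxE tensE xi_coord0// mul1r.
have : phi N Q *m vec_mx z = 0.
  rewrite mulmx_phi z0 scaler0 subr0.
  exact: zpos.
rewrite zE linearD /= mulmxDr (phi_Wsp (leqnn _) Qq wW).
rewrite add0r contract_tens addnS phi_xiS// => /eqP; rewrite scaler_eq0.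
by rewrite invr_eq0 (negPf (denR_neq0 _ _)) => /eqP.
Qed.

Lemma dim_Wsp N Q : (Q <= q.+1)%N -> \dim (Wsp N Q) = (Q * d)%N.
Proof.
elim: Q => [|Q IH] Qq; first by rewrite Wsp0 dimv0.
rewrite WspS dimv_disjoint_sum ?IH ?(ltnW Qq) ?dim_lineT ?xi_neq0//.
  by rewrite mulSn addnC.
apply/eqP; rewrite -subv0; apply/subvP => z.
rewrite memv_cap memv0 => /andP[zW /mem_lineT[v zE]].
suff v0 : v = 0 by rewrite zE v0 raddf0.
case: Q zW zE {IH} Qq => [|Q] zW zE Qq.
  move: zW; rewrite Wsp0 memv0 => /eqP z0.
  apply/rowP => j; have := tensE (xi N) v 0 j.
  rewrite -{1}(addn0 N) -zE z0 xi_coord0// mul1r => <-.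
  by rewrite linear0 !mxE.
have := phi_Wsp (leqnn _) Qq zW; rewrite zE contract_tens addnS phi_xiS//.
by move=> /eqP; rewrite scaler_eq0 invr_eq0 (negPf (denR_neq0 _ _)) => /eqP.
Qed.

Lemma zmx_tens (x : 'rV[int]_q.+1) (v : 'rV[int]_d) :
  zmx (tens x v) = tens (zmx x) (zmx v).
Proof. by rewrite /tens /intmx map_mxvec map_mxM map_trmx. Qed.

Definition gens (M : nat) : seq 'rV[int]_(q.+1 * d) :=
  [seq tens (numer M) (delta_mx 0 j) | j <- enum 'I_d].

Lemma zmx_gen M (j : 'I_d) : zmx (tens (numer M) (delta_mx 0 j)) =
  (den M)%:R *: tens (xi M) (delta_mx 0 j).
Proof.
by rewrite zmx_tens numer_xi tensZl /intmx map_delta_mx.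
Qed.

Lemma span_gens M : (<<map zmx (gens M)>> = lineT (xi M))%VS.
Proof.
apply/eqP; rewrite eqEsubv; apply/andP; split.
  apply/span_subvP => _ /mapP[_ /mapP[j _ ->] ->].
  by rewrite zmx_gen memvZ//; apply/mem_lineT; exists (delta_mx 0 j).
apply/subvP => _ /mem_lineT[v ->]; rewrite (row_sum_delta v) linear_sum /=.
apply: memv_suml => j _; rewrite tensZr memvZ//.
have -> : tens (xi M) (delta_mx 0 j) =
    (den M)%:R^-1 *: zmx (tens (numer M) (delta_mx 0 j)).
  by rewrite zmx_gen scalerA mulVf ?scale1r ?denR_neq0.
by apply/memvZ/memv_span/map_f/map_f; rewrite mem_enum.
Qed.

(** A form [phi] killing the whole window gives [den N] times one coordinate of [z] equal to a
    coordinate of [numer N] times the one along 0; by [coprime_numer] the denominator divides the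
    latter. *)
Lemma Wsp_int_dvd N Q (z : 'rV[int]_(q.+1 * d)) j : (Q <= q)%N ->
  zmx z \in Wsp N Q -> ((den N)%:Z %| vec_mx z 0%R j)%Z.
Proof.
case: N => [|N] Qq zW; first by rewrite dvd1z.
(* The last coordinate of a full cycle starting at [N.+1] is the one changed in the step from [N] to
   [N.+1], where coprimality is known. *)
have ppos : pos q (N.+1 + q.-1) = pos q N.
  by apply/eqP; rewrite pos_eq// addSnnS prednK// modnDr.
have Qk : (Q <= q.-1.+1)%N by rewrite prednK.
have kq : (q.-1 < q)%N by rewrite prednK.
have := phi_Wsp Qk kq zW.
rewrite mulmx_phi ppos => /rowP/(_ j).
have vE i : vec_mx (zmx z) i j = (vec_mx z i j)%:~R.
  by rewrite !mxE.
have dE : (den N.+1)%:R * xi N.+1 0 (pos q N) = (numer N.+1 0 (pos q N))%:~R.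
  by have /rowP/(_ (pos q N)) := numer_xi alpha q N.+1; rewrite [LHS]mxE [RHS]mxE => ->.
move=> h; have {h} : (den N.+1)%:R * (vec_mx z (pos q N) j)%:~R =
    (numer N.+1 0 (pos q N))%:~R * (vec_mx z 0 j)%:~R :> R.
  rewrite -dE -mulrA; congr (_ * _); apply/eqP; rewrite -subr_eq0; apply/eqP.
  by rewrite -!vE; move: h; rewrite !mxE.
rewrite pmulrn -!intrM => /intr_inj h.
rewrite -(Gauss_dvdzr _ (coprime_numer alpha N q0)) -h.
exact: dvdz_mulr.
Qed.

End Spaces.

(** * Heights and distances in dimension at least [d] *)

Section HighDimension.
Context {R : realType} (alpha : R) (q d : nat) (q0 : (0 < q)%N).
Local Notation den := (den alpha).
Local Notation xi := (xi alpha q).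
Local Notation numer := (numer alpha q).
Local Notation phi := (phi alpha q).
Local Notation limxi := (limxi alpha q).
Local Notation Wsp := (Wsp alpha q d).
Local Notation limsp := (limsp alpha q d).
Local Notation zmx := (@intmx R _ _).
Implicit Types (B : {vspace 'rV[R]_(q.+1 * d)}).

(** [height_ge_functionals] with the coordinates of [Wsp_eq0]: those along 0 remain integral after
    division by [den N], and these [d] divisions give the power. *)
Lemma height_Wsp_ge N Q : (0 < Q <= q)%N -> rational_subspace (Wsp N Q) ->
  (den N)%:R ^+ d <= (Q * d)`!%:R * height (Wsp N Q) :> R.
Proof.
move=> /andP[Q0 Qq] rW.
pose Phi : 'M[R]_(Q, q.+1) := \matrix_k (if k == 0%N :> nat then
  (den N)%:R^-1 *: delta_mx 0 0 else delta_mx 0 (pos q (N + k.-1))).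
pose L : 'M[R]_(q.+1 * d, Q * d) := lin1_mx (mxvec \o mulmx Phi \o vec_mx).
pose kap : 'rV[R]_(Q * d) := mxvec (\matrix_(k < Q, j < d)
  (if k == 0%N :> nat then (den N)%:R^-1 else 1)).
have LE (z : 'rV[R]_(q.+1 * d)) k j : (z *m L) 0 (mxvec_index k j) =
    if k == 0%N :> nat then (den N)%:R^-1 * vec_mx z 0 j
    else vec_mx z (pos q (N + k.-1)) j.
  rewrite mul_rV_lin1 /= mxvecE.
  have -> : (Phi *m vec_mx z) k j = (row k Phi *m vec_mx z) 0 j.
    by rewrite -row_mul [RHS]mxE.
  rewrite rowK; case: ifP => _.
    by rewrite -scalemxAl [LHS]mxE -rowE [in LHS]mxE.
  by rewrite -rowE [LHS]mxE.
have dimW : \dim (Wsp N Q) = (Q * d)%N by rewrite dim_Wsp// leqW.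
have := @height_ge_functionals R _ (Wsp N Q) (Q * d) L (fun l => kap 0 l) rW dimW.
have -> : \prod_l kap 0 l = (den N)%:R^-1 ^+ d.
  rewrite (reindex _ (curry_mxvec_bij Q d)) /=.
  transitivity (\prod_(p : 'I_Q * 'I_d)
      (if p.1 == 0%N :> nat then (den N)%:R^-1 else 1 : R)).
    by apply: eq_bigr => -[k j] _; rewrite /kap mxvecE mxE.
  rewrite -(pair_bigA _ (fun (k : 'I_Q) (j : 'I_d) =>
    if k == 0%N :> nat then (den N)%:R^-1 else 1)) /=.
  rewrite (bigD1 (Ordinal Q0))//= prodr_const card_ord big1 ?mulr1// => k k0.
  by rewrite big1// => j _; case: eqP => // k0'; case/eqP: k0; apply: val_inj.
have dp := denR_gt0 alpha N.
move=> h; have {}h : 1 <= (Q * d)`!%:R * height (Wsp N Q) ^+ 2 * ((den N)%:R^-1 ^+ d) ^+ 2.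
  apply: h.
  - move=> l; case/mxvec_indexP: l => k j; rewrite /kap mxvecE mxE.
    by case: ifP => _ //; rewrite invr_ge0 ltW.
  - move=> z zW.
    pose a : 'M[int]_(Q, d) := \matrix_(k, j) (if k == 0%N :> nat then
      (vec_mx z 0%R j %/ (den N)%:Z)%Z else vec_mx z (pos q (N + k.-1)) j).
    exists (mxvec a); apply/rowP => l; case/mxvec_indexP: l => k j.
    rewrite LE [RHS]mxE mxvecE [in RHS]mxE.
    have vE i : vec_mx (zmx z) i j = (vec_mx z i j)%:~R by rewrite !mxE.
    case: ifP => _; rewrite vE//.
    have /divzK {1}<- := Wsp_int_dvd q0 j Qq zW.
    by rewrite intrM -pmulrn mulrC mulfK// gt_eqF.
  - move=> z zW zL; apply: (Wsp_eq0 q0 _ zW); first exact: leqW.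
      apply/rowP => j; have /rowP/(_ (mxvec_index (Ordinal Q0) j)) := zL.
      rewrite LE /= [RHS]mxE => /eqP; rewrite mulf_eq0 invr_eq0 gt_eqF//= => /eqP h0.
      by rewrite [LHS]mxE h0 [RHS]mxE.
    move=> k kQ; apply/rowP => j; have /rowP/(_ (mxvec_index (Ordinal kQ) j)) := zL.
    by rewrite LE /= [RHS]mxE => h0; rewrite [LHS]mxE h0 [RHS]mxE.
  move=> z l zW; case/mxvec_indexP: l => k j.
  have cz i : `|vec_mx z i j| <= enorm z by rewrite mxE coord_le_enorm.
  rewrite LE /kap mxvecE [X in _ <= X * _]mxE; case: ifP => _; last by rewrite mul1r.
  have i0 : 0 <= (den N)%:R^-1 :> R by rewrite invr_ge0 ltW.
  by rewrite normrM (ger0_norm i0) ler_wpM2l.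
have f1 : 1 <= (Q * d)`!%:R :> R by rewrite ler1n fact_gt0.
rewrite -(@ler_pXn2r _ 2)// ?nnegrE ?mulr_ge0 ?height_ge0 ?exprn_ge0 ?ler0n//.
rewrite exprMn; move: h; rewrite exprVn exprVn ler_pdivlMr ?exprn_gt0// mul1r.
move=> h; apply: le_trans h _; rewrite ler_wpM2r ?exprn_ge0 ?height_ge0//.
by rewrite expr2 ler_peMl// ler0n.
Qed.

(** The last form [phi] kills [Wsp N Q], so it maps [B] onto a space of dimension less than [d]. For
    [v] orthogonal to that image, the distance from [tens limxi v] to [B] is at least about
    [dotr (phi N _) limxi]. *)
Lemma den_le_near N Q B (eta : R) : (0 < Q <= q)%N -> (Wsp N Q <= B)%VS ->
  (\dim B < Q.+1 * d)%N ->
  (forall x, x \in limsp -> exists2 b, b \in B & enorm (x - b) <= eta * enorm x) ->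
  1 <= 2 * q.+1%:R * (eta * (den (N + Q))%:R).
Proof.
case: Q => // Q /= Qq WB dB near.
pose F : 'Hom('rV[R]_(q.+1 * d), 'rV[R]_d) :=
  linfun (mulmx (phi N Q) \o vec_mx).
have FE z : F z = phi N Q *m vec_mx z by rewrite lfunE.
have dF : (\dim (F @: B) < d)%N.
  have cap : (Q.+1 * d <= \dim (B :&: lker F))%N.
    rewrite -(@dim_Wsp R alpha q d q0 N Q.+1) ?leqW//; apply: dimvS.
    apply/subvP => z zW; rewrite memv_cap (subvP WB)// memv_ker FE.
    by rewrite (phi_Wsp q0 (leqnn _) Qq zW) eqxx.
  rewrite -(ltn_add2l (\dim (B :&: lker F))) limg_ker_dim.
  by apply: leq_trans dB _; rewrite mulSn addnC leq_add2r.
have [u uF] : exists u, u \notin (F @: B)%VS.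
  apply: contrapT => h; have : (fullv <= F @: B)%VS.
    by apply/subvP => u _; apply: contrapT => /negP uF; apply: h; exists u.
  by move=> /dimvS; rewrite dimvf /dim/= mul1n leqNgt dF.
have [y yF orth] := orthoproj_vs (F @: B)%VS u.
pose v := u - y.
have v0 : v != 0 by rewrite subr_eq0; apply: contraNneq uF => ->.
have [b bB hb] := near (tens limxi v) ((mem_lineT _ _).2 (ex_intro _ v erefl)).
have vp : 0 < enorm v by rewrite enorm_gt0.
have dp := denR_gt0 alpha (N + Q).+1.
have e1 : dotr v (F (tens limxi v - b)) = dotr (phi N Q) limxi * enorm v ^+ 2.
  have -> : F (tens limxi v - b) = F (tens limxi v) - F b by rewrite linearB.
  rewrite dotrBr (orth (F b)) ?memv_img// subr0 FE contract_tens.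
  by rewrite dotrZr sqr_enorm.
have e2 : dotr v (F (tens limxi v - b)) <= enorm v * (2 * (eta * (q.+1%:R * enorm v))).
  apply: le_trans (ler_norm _) _; apply: le_trans (dotr_le _ _) _.
  rewrite ler_pM2l// FE; apply: le_trans (enorm_contract _ _) _.
  apply: ler_pM; rewrite ?enorm_ge0 ?enorm_phi//.
  apply: (le_trans hb); rewrite enorm_tens.
  have eta0 : 0 <= eta.
    have p : 0 < enorm (tens limxi v) by rewrite enorm_tens mulr_gt0// enorm_gt0 limxi_neq0.
    by have := le_trans (enorm_ge0 _) hb; rewrite pmulr_lge0.
  by rewrite ler_wpM2l// ler_wpM2r ?enorm_ge0// enorm_limxi_le.
have e3 := phi_limxi alpha N Q q0.
move: e2; rewrite e1 => e2.
have e4 : (den (N + Q).+1)%:R^-1 <= 2 * (eta * q.+1%:R).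
  apply: le_trans e3 _; rewrite -(ler_pM2r (exprn_gt0 2 vp)).
  by apply: le_trans e2 _; rewrite le_eqVlt; apply/orP; left; apply/eqP; ring.
rewrite addnS; move: e4; rewrite -(ler_pM2r dp) mulVf ?gt_eqF//.
by move=> e4; apply: le_trans e4 _; rewrite le_eqVlt; apply/orP; left; apply/eqP; ring.
Qed.

(** The Liouville inequality for a generator outside [B], whose distance to [B] is bounded by
    passing through [limsp]. *)
Lemma notin_le_near N B (eta : R) (j : 'I_d) : rational_subspace B ->
  zmx (tens (numer N) (delta_mx 0 j)) \notin B ->
  (forall x, x \in limsp -> exists2 b, b \in B & enorm (x - b) <= eta * enorm x) ->
  1 <= q.+1%:R * height B * ((den N)%:R * (2 / (den N.+1)%:R + eta)).
Proof.
move=> rB xB near.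
have [b bB hb] := near (tens limxi (delta_mx 0 j)) ((mem_lineT _ _).2 (ex_intro _ _ erefl)).
have dp := denR_gt0 alpha N.
rewrite enorm_tens enorm_delta mulr1 in hb.
have eta0 : 0 <= eta.
  have := le_trans (enorm_ge0 _) hb; rewrite pmulr_lge0//.
  by rewrite enorm_gt0 limxi_neq0.
have := height_dist_ge1 rB xB (memvZ (den N)%:R bB).
rewrite zmx_gen -scalerBr enormZ ger0_norm ?(ltW dp)// => h.
apply: (le_trans h).
have -> : q.+1%:R * height B * ((den N)%:R * (2 / (den N.+1)%:R + eta)) =
    (den N)%:R * (q.+1%:R * (2 / (den N.+1)%:R + eta)) * height B by ring.
rewrite ler_wpM2r ?height_ge0// ler_pM2l//.
have -> : tens (xi N) (delta_mx 0 j) - b =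
    (tens limxi (delta_mx 0 j) - b) - tens (limxi - xi N) (delta_mx 0 j).
  by rewrite tensBl opprB [RHS]addrC addrA subrK.
apply: le_trans (enormB _ _) _.
rewrite enorm_tens enorm_delta mulr1 mulrDr addrC; apply: lerD.
  exact: enorm_xi_lim.
by apply: (le_trans hb); rewrite mulrC ler_wpM2r// enorm_limxi_le.
Qed.

(** Adjoining the line of index [N] adds [s >= d - r] dimensions. If [s = d - r] the sum is exactly
    [Wsp N Q.+1], of known height; otherwise one more factor [rho] is gained and height at least 1
    suffices. *)
Lemma height_ge_Wsp N Q r B : (0 < Q)%N -> (Q.+1 <= q)%N -> (r < d)%N ->
  rational_subspace B -> (Wsp N.+1 Q <= B)%VS -> \dim B = (Q * d + r)%N ->
  (den N.+1)%:R ^+ (d - r) * (den N)%:R ^+ d <=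
     (Q.+1 * d)`!%:R * height B * (den N)%:R ^+ (d - r) :> R \/
  (den N.+1)%:R ^+ (d - r).+1 <= height B * (den N)%:R ^+ (d - r).+1 :> R.
Proof.
move=> Q0 Qq rd rB WB dB.
have dp := denR_gt0 alpha N; have dp' := denR_gt0 alpha N.+1.
pose rho : R := (den N)%:R / (den N.+1)%:R.
have rho0 : 0 <= rho by rewrite divr_ge0// ltW.
have rho1 : rho <= 1.
  rewrite ler_pdivrMr// mul1r ler_nat.
  by apply: leq_trans (den_ge2 alpha N); rewrite leq_pmull.
have WN : (lineT (xi N.+1) <= Wsp N.+1 Q)%VS.
  by have := lineT_sub_Wsp alpha q d N.+1 Q0; rewrite addn0.
have near x : x \in gens alpha q d N ->
    exists2 y, y \in B & enorm (zmx x - y) <= rho.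
  move=> /mapP[j _ ->]; exists ((den N)%:R *: tens (xi N.+1) (delta_mx 0 j)).
    apply: memvZ; apply: (subvP (subv_trans WN WB)).
    by apply/mem_lineT; exists (delta_mx 0 j).
  rewrite zmx_gen -scalerBr -tensBl enormZ enorm_tens enormBC enorm_xiS.
  by rewrite enorm_delta mulr1 ger0_norm// ltW.
have [s []] := height_add_seq rB rho0 near.
rewrite span_gens => rB' dB' _ hB'.
have sub : (Wsp N Q.+1 <= B + lineT (xi N))%VS.
  by rewrite WspSl addvC; apply: addvS.
have ds : (d - r <= s)%N.
  have := dimvS sub; rewrite dim_Wsp// ?dB' ?dB; last by rewrite ltnW.
  rewrite mulSn; move: rd; lia.
have p k : (0 : R) < (den N.+1)%:R ^+ k by rewrite exprn_gt0.
have [se|sn] := eqVneq s (d - r)%N; [left|right].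
  have WE : Wsp N Q.+1 = (B + lineT (xi N))%VS.
    apply/eqP; rewrite eqEdim sub dB' dB dim_Wsp//; last by rewrite ltnW.
    by rewrite se mulSn; move: rd; lia.
  have := @height_Wsp_ge N Q.+1; rewrite WE /= Qq => /(_ isT rB') h.
  rewrite mulrC -ler_pdivlMr//.
  apply: le_trans h _; rewrite -!mulrA ler_wpM2l ?ler0n//.
  apply: le_trans hB' _; rewrite se mulrC /rho expr_div_n.
  by rewrite mulrA.
have sd : ((d - r).+1 <= s)%N by rewrite ltn_neqAle eq_sym sn.
have := le_trans (height_ge1 rB') hB'.
have : rho ^+ s * height B <= rho ^+ (d - r).+1 * height B.
  rewrite ler_wpM2r ?height_ge0//.
  by apply: ler_wiXn2l.
move=> h1 h2; have := le_trans h2 h1.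
by rewrite /rho expr_div_n mulrAC ler_pdivlMr// mul1r mulrC.
Qed.

End HighDimension.

(** * Heights and distances in dimension less than [d] *)

Section LowDimension.
Context {R : realType} (alpha : R) (q d : nat) (q0 : (0 < q)%N).
Local Notation den := (den alpha).
Local Notation xi := (xi alpha q).
Local Notation numer := (numer alpha q).
Local Notation phi := (phi alpha q).
Local Notation limxi := (limxi alpha q).
Local Notation limsp := (limsp alpha q d).
Local Notation zmx := (@intmx R _ _).
Implicit Types (B : {vspace 'rV[R]_(q.+1 * d)}).

Lemma row_tens (x : 'rV[R]_q.+1) (v : 'rV[R]_d) i :
  row i (vec_mx (tens x v)) = x 0 i *: v.
Proof. by apply/rowP => j; rewrite [LHS]mxE tensE [RHS]mxE. Qed.

Lemma enorm_row_vec_mx (z : 'rV[R]_(q.+1 * d)) i : enorm (row i (vec_mx z)) <= enorm z.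
Proof.
rewrite rowE; apply: (le_trans (enorm_contract _ _)).
by rewrite enorm_delta mul1r.
Qed.

(** Row 0 of [tens limxi v] is [v]. If row 0 of [b] vanishes, the approximating [v] has norm at most
    [eta * enorm b], whence [enorm b] is at most [(q.+1 + 1) * eta] times itself. *)
Lemma near_eq0 B (eta : R) : q.+2%:R * eta < 1 ->
  (forall b, b \in B -> exists2 x, x \in limsp & enorm (x - b) <= eta * enorm b) ->
  forall b, b \in B -> row 0 (vec_mx b) = 0 -> b = 0.
Proof.
move=> eta1 near b bB b0; have [_ /mem_lineT[v ->] hb] := near b bB.
have hv : enorm v <= eta * enorm b.
  apply: le_trans hb; apply: le_trans (enorm_row_vec_mx _ 0).
  have -> : row 0 (vec_mx (tens limxi v - b)) = v.
    by rewrite !linearB /= b0 subr0 row_tens limxi_coord0// scale1r.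
  by [].
apply/eqP; rewrite -enorm_eq0 eq_le enorm_ge0 andbT.
have : enorm b <= enorm (tens limxi v) + eta * enorm b.
  have {1}-> : b = tens limxi v - (tens limxi v - b) by rewrite subKr.
  by apply: (le_trans (enormB _ _)); rewrite lerD2l.
have : enorm (tens limxi v) <= q.+1%:R * (eta * enorm b).
  by rewrite enorm_tens ler_pM ?enorm_ge0// enorm_limxi_le.
move: eta1; rewrite -[q.+2%:R]natr1.
have := enorm_ge0 b; set E := enorm b => E0 h1 h2 h3.
have : (1 - (q.+1%:R + 1) * eta) * E <= 0 by lra.
by rewrite pmulr_rle0// subr_gt0.
Qed.

(** These integral forms cut out [lineT (xi N)]. The term with 4 comes from [limxi - xi N] and
    [enorm v <= 2 * enorm b], the other from two coordinates of the error. *)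
Lemma near_coord_le B (eta : R) N b i j : eta <= 1 ->
  (forall b, b \in B -> exists2 x, x \in limsp & enorm (x - b) <= eta * enorm b) ->
  b \in B ->
  `|(den N)%:R * vec_mx b i j - (numer N 0 i)%:~R * vec_mx b 0 j| <=
   (den N)%:R * (4 / (den N.+1)%:R + 2 * eta) * enorm b.
Proof.
move=> eta1 near bB; have [_ /mem_lineT[v ->] hb] := near b bB.
have dp := denR_gt0 alpha N; have dp' := denR_gt0 alpha N.+1.
have -> : (numer N 0 i)%:~R = (den N)%:R * xi N 0 i.
  by have /rowP/(_ i) := numer_xi alpha q N; rewrite [LHS]mxE [RHS]mxE.
rewrite -[X in _ - X]mulrA -mulrBr normrM (ger0_norm (ltW dp)) -mulrA ler_pM2l//.
pose r := tens limxi v - b.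
have -> : vec_mx b i j - xi N 0 i * vec_mx b 0 j =
  (limxi 0 i - xi N 0 i) * v 0 j - vec_mx r i j + xi N 0 i * vec_mx r 0 j.
  have rE l : vec_mx r l j = limxi 0 l * v 0 j - vec_mx b l j.
    rewrite -tensE /r linearB /=.
    by rewrite [LHS]mxE; congr (_ + _); rewrite [LHS]mxE.
  by rewrite !rE limxi_coord0//; ring.
have cr l : `|vec_mx r l j| <= eta * enorm b.
  by apply: le_trans hb; rewrite mxE coord_le_enorm.
have hv : enorm v <= 2 * enorm b.
  have h : enorm (tens limxi v) <= enorm b + eta * enorm b.
    have {1}-> : tens limxi v = b + (tens limxi v - b) by rewrite addrC subrK.
    by apply: (le_trans (enormD _ _)); rewrite lerD2l.
  have : enorm v <= enorm (tens limxi v).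
    by rewrite enorm_tens ler_peMl ?enorm_ge0// enorm_limxi_ge.
  have : eta * enorm b <= enorm b by rewrite ler_piMl ?enorm_ge0.
  lra.
have t1 : `|(limxi 0 i - xi N 0 i) * v 0 j| <= 2 / (den N.+1)%:R * (2 * enorm b).
  rewrite normrM ger0_norm ?subr_ge0 ?limxi_ge//; apply: ler_pM => //.
  - by rewrite subr_ge0 limxi_ge.
  - by rewrite lerBlDl limxi_upper.
  - by apply: le_trans hv; exact: coord_le_enorm.
have t2 : `|xi N 0 i * vec_mx r 0 j| <= eta * enorm b.
  rewrite normrM ger0_norm ?xi_ge0//; apply: le_trans (cr 0).
  by rewrite ler_piMl// xi_le1.
have -> : (4 / (den N.+1)%:R + 2 * eta) * enorm b =
  2 / (den N.+1)%:R * (2 * enorm b) + eta * enorm b + eta * enorm b by ring.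
apply: (le_trans (ler_normD _ _)); apply: lerD => //.
apply: (le_trans (ler_normB _ _)); exact: lerD.
Qed.

Lemma row0_minor e (M : 'M[R]_(e, q.+1 * d)) :
  (forall c, row 0 (vec_mx (c *m M)) = 0 -> c = 0) ->
  exists f : {ffun 'I_e -> 'I_d},
    \det (colsub (fun b => mxvec_index 0 (f b)) M) != 0.
Proof.
move=> inj; pose P : 'M[R]_(e, d) := colsub (mxvec_index 0) M.
have fP : row_free P.
  apply/inj_row_free => c cP; apply: inj; apply/rowP => j.
  have /rowP/(_ j) := cP; rewrite [LHS]mxE => h.
  by rewrite [LHS]mxE [LHS]mxE [LHS]mxE -[RHS]h; apply: eq_bigr => k _; rewrite [RHS]mulrC mulrC [P _ _]mxE.
have [f df] := row_free_minor fP; exists f.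
by congr (\det _ != 0): df; apply/matrixP => a b; rewrite !mxE.
Qed.

(* Choose [e] coordinates of index [(0, j)] with a nonzero minor on a Z-basis of
   [B]. If some [den N * z_ij - numer N i * z_0j] does not vanish on [B], then by
   Cramer it can replace one of them, giving a small nonzero integer minor. *)
Lemma subsp_or_near N B (eta : R) e : rational_subspace B -> \dim B = e ->
  q.+2%:R * eta < 1 -> eta <= 1 ->
  (forall b, b \in B -> exists2 x, x \in limsp & enorm (x - b) <= eta * enorm b) ->
  (B <= lineT (xi N))%VS \/
  1 <= e`!%:R * height B * `|(den N)%:R * (4 / (den N.+1)%:R + 2 * eta)|.
Proof.
move=> rB dB eta1 eta1' near.
have dp := denR_gt0 alpha N.
have [M [_ bM hE]] := height_spec rB dB; have [fM hM] := bM.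
have [f df] : exists f : {ffun 'I_e -> 'I_d},
    \det (colsub (fun b => mxvec_index 0 (f b)) (zmx M)) != 0.
  apply: row0_minor => c h; apply: (row_free_inj fM); rewrite mul0mx.
  by apply: (near_eq0 eta1 near) => //; apply/hM; exists c.
rewrite -map_mxsub det_map_mx intr_eq0 in df.
pose Gc i j : 'cV[int]_(q.+1 * d) := (den N)%:Z *: delta_mx (mxvec_index i j) 0 -
   numer N 0 i *: delta_mx (mxvec_index 0 j) 0.
pose Lz i j k : 'M[int]_(q.+1 * d, e) := \matrix_(a, b)
  if b == k then Gc i j a 0 else (a == mxvec_index 0 (f b))%:R.
set kap := _ * (4 / _ + _).
have GE (z : 'rV[R]_(q.+1 * d)) i j : (z *m zmx (Gc i j)) 0 0 =
   (den N)%:R * vec_mx z i j - (numer N 0 i)%:~R * vec_mx z 0 j.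
  have -> : zmx (Gc i j) = (den N)%:R *: delta_mx (mxvec_index i j) 0 -
     (numer N 0 i)%:~R *: delta_mx (mxvec_index 0 j) 0.
    apply/colP => a; rewrite !mxE !rmorphB !rmorphM /= -pmulrn.
    by congr (_ * _ - _ * _); case: (_ && _).
  rewrite mulmxBr -!scalemxAr -!colE !mxE//.
have LE (z : 'rV[R]_(q.+1 * d)) i j k b : (z *m zmx (Lz i j k)) 0 b =
   if b == k then (z *m zmx (Gc i j)) 0 0 else vec_mx z 0 (f b).
  rewrite [LHS]mxE; case: eqP => bk.
    by rewrite [RHS]mxE; apply: eq_bigr => a _; rewrite !mxE bk eqxx.
  rewrite mxE (bigD1 (mxvec_index 0 (f b)))//= big1 ?addr0.
    by rewrite !mxE; case: eqP => // _; rewrite eqxx mulr1.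
  by move=> a ab; rewrite !mxE; case: eqP => // _; rewrite (negPf ab) mulr0.
have [h|h] := lerP 1 (e`!%:R * height B * `|kap|); [by right|left].
have det0 i j k : \det (M *m Lz i j k) = 0.
  apply: contrapT => /eqP nz.
  have := @det_mulmx_le R _ e (zmx M) (zmx (Lz i j k)) (fun b => if b == k then `|kap| else 1) fM.
  have -> : \prod_(b < e) (if b == k then `|kap| else 1) = `|kap|.
    rewrite (bigD1 k)//= eqxx big1 ?mulr1// => b bk.
    by rewrite (negPf bk).
  move=> H; have {H} : \det (zmx M *m zmx (Lz i j k)) ^+ 2 <= e`!%:R * gram (zmx M) * `|kap| ^+ 2.
    apply: H; first by move=> b; case: eqP.
    move=> c b; rewrite LE.
    have zB : c *m zmx M \in B by apply/hM; exists c.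
    case: eqP => _; last by rewrite mul1r mxE coord_le_enorm.
    rewrite GE; apply: (le_trans (near_coord_le N i j eta1' near zB)).
    by rewrite ler_wpM2r ?enorm_ge0// ler_norm.
  rewrite -zmxM det_map_mx -hE => H.
  have := le_trans (sqr_int_ge1 nz) H.
  have f1 : 1 <= e`!%:R :> R by rewrite ler1n fact_gt0.
  rewrite leNgt => /negP; apply.
  have h0 : 0 <= e`!%:R * height B * `|kap| by rewrite !mulr_ge0 ?height_ge0.
  apply: (@le_lt_trans _ _ ((e`!%:R * height B * `|kap|) ^+ 2)); last first.
    by rewrite exprn_ilt1.
  rewrite !exprMn ler_wpM2r ?exprn_ge0// ler_wpM2r ?exprn_ge0 ?height_ge0//.
  by rewrite expr2 ler_peMl// ler0n.
(* The determinants that vanish are, by Cramer, the entries of the adjugate of an invertible matrix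
   applied to this column. *)
have g0 i j : M *m Gc i j = 0.
  pose P := colsub (fun b => mxvec_index 0 (f b)) M.
  have adj0 : \adj P *m (M *m Gc i j) = 0.
    apply/colP => k; rewrite adj_mulmx_col [RHS]mxE -(det0 i j k).
    congr (\det _); apply/matrixP => a b; rewrite !mxE.
    have LzE l : Lz i j k l b =
        if b == k then Gc i j l 0 else (l == mxvec_index 0 (f b))%:R.
      by rewrite [LHS]mxE.
    case: eqP => bk; first by apply: eq_bigr => l _; rewrite LzE bk eqxx.
    rewrite (bigD1 (mxvec_index 0 (f b)))//= big1 ?addr0.
      by rewrite LzE; case: eqP => // _; rewrite eqxx mulr1.
    by move=> l lb; rewrite LzE; case: eqP => // _; rewrite (negPf lb) mulr0.
  have : P *m (\adj P *m (M *m Gc i j)) = 0 by rewrite adj0 mulmx0.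
  rewrite mulmxA mul_mx_adj mul_scalar_mx => /colP h0; apply/colP => a.
  have := h0 a; rewrite [LHS]mxE [RHS]mxE => /eqP; rewrite mulf_eq0 (negPf df) /=.
  by rewrite [RHS]mxE => /eqP.
apply/subvP => z /hM[c zE]; apply/mem_lineT; exists (row 0 (vec_mx z)).
apply: (can_inj vec_mxK); apply/matrixP => i j.
have : (z *m zmx (Gc i j)) 0 0 = 0.
  by rewrite zE -mulmxA -zmxM g0 /intmx map_mx0 mulmx0 mxE.
rewrite GE => /eqP; rewrite subr_eq0 => /eqP h0.
have xE : (numer N 0 i)%:~R = (den N)%:R * xi N 0 i.
  by have /rowP/(_ i) := numer_xi alpha q N; rewrite [LHS]mxE [RHS]mxE.
rewrite tensE [X in _ = _ * X]mxE.
apply: (@mulfI _ (den N)%:R); first by rewrite gt_eqF.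
by rewrite h0 xE mulrA.
Qed.

(** On a single line, [e] independent coordinates along 0 can be chosen, and all remain integral
    after division by [den N]. *)
Lemma height_ge_lineT N B e : rational_subspace B -> \dim B = e ->
  (B <= lineT (xi N))%VS -> (den N)%:R ^+ e <= e`!%:R * height B :> R.
Proof.
move=> rB dB BV; have dp := denR_gt0 alpha N.
have [M [_ bM hE]] := height_spec rB dB; have [fM hM] := bM.
have inj z : z \in B -> row 0 (vec_mx z) = 0 -> z = 0.
  move=> /(subvP BV) /mem_lineT[v ->].
  by rewrite row_tens xi_coord0// scale1r => ->; rewrite raddf0.
have [f df] : exists f : {ffun 'I_e -> 'I_d},
    \det (colsub (fun b => mxvec_index 0 (f b)) (zmx M)) != 0.
  apply: row0_minor => c h; apply: (row_free_inj fM); rewrite mul0mx.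
  by apply: inj => //; apply/hM; exists c.
pose L : 'M[R]_(q.+1 * d, e) := (den N)%:R^-1 *: colsub (fun b => mxvec_index 0 (f b)) 1%:M.
have LE m (Z : 'M[R]_(m, q.+1 * d)) : Z *m L = (den N)%:R^-1 *: colsub (fun b => mxvec_index 0 (f b)) Z.
  by rewrite /L -scalemxAr -colsub_mulmx.
have := @height_ge_functionals R _ B e L (fun=> (den N)%:R^-1) rB dB.
rewrite prodr_const card_ord => h.
have {}h : 1 <= e`!%:R * height B ^+ 2 * ((den N)%:R^-1 ^+ e) ^+ 2.
  apply: h.
  - by move=> _; rewrite invr_ge0 ltW.
  - move=> z zB; have zW : zmx z \in Wsp alpha q d N 1.
      by rewrite WspS Wsp0 add0v addn0 (subvP BV).
    exists (\row_b (vec_mx z 0%R (f b) %/ (den N)%:Z)%Z).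
    apply/rowP => b; rewrite LE !mxE.
    have := Wsp_int_dvd q0 (f b) q0 zW; rewrite mxE => /divzK {1}<-.
    by rewrite intrM -pmulrn mulrC mulfK// gt_eqF.
  - move=> z /hM[c ->]; rewrite LE => /eqP; rewrite scaler_eq0 invr_eq0 gt_eqF//=.
    rewrite colsub_mulmx -mulmxA -colsub_mulmx => /eqP h0.
    suff -> : c = 0 by rewrite mul0mx.
    have fC : row_free (colsub (fun b => mxvec_index 0 (f b)) (zmx M)).
      by rewrite row_free_unit unitmxE unitfE.
    by apply: (row_free_inj fC); rewrite h0 mul0mx.
  move=> z l _; rewrite LE [X in `|X|]mxE normrM ger0_norm ?invr_ge0 ?(ltW dp)//.
  by rewrite ler_wpM2l ?invr_ge0 ?(ltW dp)// mxE coord_le_enorm.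
have f1 : 1 <= e`!%:R :> R by rewrite ler1n fact_gt0.
rewrite -(@ler_pXn2r _ 2)// ?nnegrE ?mulr_ge0 ?height_ge0 ?exprn_ge0 ?ler0n//.
rewrite exprMn; move: h; rewrite exprVn exprVn ler_pdivlMr ?exprn_gt0// mul1r.
move=> h; apply: (le_trans h); rewrite ler_wpM2r ?exprn_ge0 ?height_ge0//.
by rewrite expr2 ler_peMl// ler0n.
Qed.

(** One nonzero vector of [B] is enough: [phi N 0] kills it but takes a value of at least
    [1 / den N.+1] on [limxi]. The bound on [eta] makes the two vector factors comparable. *)
Lemma den_le_near_lineT N B (eta : R) : (0 < \dim B)%N ->
  q.+1%:R * eta <= 2^-1 -> (B <= lineT (xi N))%VS ->
  (forall b, b \in B -> exists2 x, x \in limsp & enorm (x - b) <= eta * enorm b) ->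
  1 <= 4 * q.+1%:R * (eta * (den N.+1)%:R).
Proof.
move=> dB eta2 BV near; have dp := denR_gt0 alpha N.+1.
pose z := vpick B.
have z0 : z != 0 by rewrite vpick0 -dimv_eq0 -lt0n.
have zB : z \in B := memv_pick B.
have [v zE] := (mem_lineT _ _).1 (subvP BV _ zB).
have [_ /mem_lineT[w ->] hw] := near z zB.
have zp : 0 < enorm z by rewrite enorm_gt0.
have eta0 : 0 <= eta by have := le_trans (enorm_ge0 _) hw; rewrite pmulr_lge0.
have hz : enorm z <= q.+1%:R * enorm v.
  by rewrite zE enorm_tens ler_wpM2r ?enorm_ge0// enorm_xi_le.
have hr : enorm (w - v) <= eta * enorm z.
  apply: le_trans hw; apply: le_trans (enorm_row_vec_mx _ 0).
  by rewrite !linearB /= zE !row_tens limxi_coord0// xi_coord0// !scale1r.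
have hvw : enorm v <= 2 * enorm w.
  have : enorm v <= enorm w + enorm (w - v).
    have {1}-> : v = w - (w - v) by rewrite subKr.
    exact: enormB.
  have : eta * enorm z <= 2^-1 * enorm v.
    apply: (le_trans (ler_wpM2l eta0 hz)).
    by rewrite mulrA (mulrC eta) ler_wpM2r ?enorm_ge0.
  lra.
have vp : 0 < enorm v.
  by rewrite enorm_gt0; apply: contraNneq z0 => v0; rewrite zE v0 raddf0.
have wp : 0 < enorm w by lra.
have hphi : (den N.+1)%:R^-1 * enorm w <= 2 * (eta * enorm z).
  apply: (@le_trans _ _ (enorm (phi N 0 *m vec_mx (tens limxi w - z)))); last first.
    by apply: (le_trans (enorm_contract _ _)); apply: ler_pM; rewrite ?enorm_ge0 ?enorm_phi.
  have -> : vec_mx (tens limxi w - z) = vec_mx (tens limxi w) - vec_mx z.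
    by rewrite linearB.
  rewrite mulmxBr contract_tens zE contract_tens.
  have := @phi_xi R alpha q N 0 0 q0 (leqnn _) q0; rewrite addn0 => ->.
  rewrite scale0r subr0 enormZ ler_wpM2r ?enorm_ge0//.
  apply: le_trans (ler_norm _).
  by have := phi_limxi alpha N 0 q0; rewrite addn0.
have : (den N.+1)%:R^-1 * enorm w <= 4 * q.+1%:R * eta * enorm w.
  apply: (le_trans hphi).
  have -> : 4 * q.+1%:R * eta * enorm w = 2 * (eta * (q.+1%:R * (2 * enorm w))) by ring.
  rewrite ler_wpM2l// ler_wpM2l//; apply: (le_trans hz).
  by rewrite ler_wpM2l.
rewrite ler_pM2r// -(ler_pM2r dp) mulVf ?gt_eqF//.
by rewrite -!mulrA.
Qed.

End LowDimension.

(** * Comparison of distances and heights *)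

Section LogBounds.
Context {R : realType} (alpha : R) (alpha4 : 4 <= alpha).
Local Notation den := (den alpha).

Definition lden (N : nat) : R := ln (den N)%:R.

Lemma ln4_gt0 : 0 < ln 4 :> R.
Proof. by rewrite ln_gt0// ltr1n. Qed.

Lemma ln2_gt0 : 0 < ln 2 :> R.
Proof. by rewrite ln_gt0// ltr1n. Qed.

Lemma lden0 : lden 0 = 0.
Proof. by rewrite /lden /= ln1. Qed.

Lemma lden_ge0 N : 0 <= lden N.
Proof. by rewrite ln_ge0// denR_ge1. Qed.

Lemma ldenS_ge N : alpha * lden N + ln 2 <= lden N.+1.
Proof.
have a4 := alpha4.
have p := denR_gt0 alpha N; have a2 : 2 <= alpha by lra.
have [h1 h2] := den_powR N a2.
rewrite /lden -ln_powR addrC -lnM ?posrE ?powR_gt0//.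
by rewrite ler_ln ?posrE ?mulr_gt0 ?powR_gt0 ?denR_gt0.
Qed.

Lemma ldenS_le N : lden N.+1 <= alpha * lden N + ln 4.
Proof.
have a4 := alpha4.
have p := denR_gt0 alpha N; have a2 : 2 <= alpha by lra.
have [h1 h2] := den_powR N a2.
rewrite /lden -ln_powR addrC -lnM ?posrE ?powR_gt0//.
by rewrite ler_ln ?posrE ?mulr_gt0 ?powR_gt0 ?denR_gt0.
Qed.

Lemma lden_grow N : lden N + ln 2 <= lden N.+1.
Proof.
have a4 := alpha4.
apply: le_trans (ldenS_ge N); rewrite lerD2r.
by rewrite ler_peMl ?lden_ge0//; lra.
Qed.

Lemma lden_mono N M : (N <= M)%N -> lden N <= lden M.
Proof.
have a4 := alpha4.
elim: M => [|M IH]; first by rewrite leqn0 => /eqP ->.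
rewrite leq_eqVlt => /orP[/eqP -> //|/IH h]; apply: (le_trans h).
have := lden_grow M; have := ln2_gt0; lra.
Qed.

Lemma lden_ge_nat N : N%:R * ln 2 <= lden N.
Proof.
elim: N => [|N IH]; first by rewrite mul0r lden_ge0.
apply: le_trans (lden_grow N); rewrite -natr1 mulrDl mul1r lerD2r//.
Qed.

Lemma lden_add_le k : exists2 C, 0 <= C &
  forall N, lden (N + k) <= alpha ^+ k * lden N + C.
Proof.
have a4 := alpha4.
elim: k => [|k [C C0 IH]].
  by exists 0 => // N; rewrite addn0 expr0 mul1r addr0.
exists (alpha * C + ln 4) => [|N].
  by rewrite addr_ge0 ?mulr_ge0 ?(ltW ln4_gt0)//; lra.
rewrite addnS; apply: (le_trans (ldenS_le _)).
have : alpha * lden (N + k) <= alpha * (alpha ^+ k * lden N + C).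
  by rewrite ler_wpM2l//; lra.
rewrite exprS; lra.
Qed.

(** The least index after which consecutive denominators have a quotient of at least [expR y];
    minimality at [N - 1] gives the upper bound. With [y] close to the log-height, this is where the
    window starts. *)
Lemma lden_choice (y : R) : 0 <= y -> exists N,
  y <= (alpha - 1) * lden N /\ lden N <= alpha / (alpha - 1) * y + ln 4.
Proof.
have a4 := alpha4.
move=> y0; have a1 : 0 < alpha - 1 by lra.
pose P N := y <= (alpha - 1) * lden N.
have ex : exists N, P N.
  exists (Num.truncn (y / ((alpha - 1) * ln 2))).+1; rewrite /P.
  have p : 0 < (alpha - 1) * ln 2 by rewrite mulr_gt0 ?ln2_gt0.
  apply: (@le_trans _ _ ((alpha - 1) * ((Num.truncn (y / ((alpha - 1) * ln 2))).+1%:R * ln 2))).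
    by rewrite mulrCA -ler_pdivrMr// ltW// truncnS_gt.
  by rewrite ler_pM2l// lden_ge_nat.
case: (ex_minnP ex) => -[|N] PN minN.
  exists 0%N; split => //; rewrite lden0 addr_ge0 ?(ltW ln4_gt0)//.
  by rewrite mulr_ge0// divr_ge0//; lra.
exists N.+1; split => //; apply: (le_trans (ldenS_le N)); rewrite lerD2r.
have : (alpha - 1) * lden N < y.
  by rewrite ltNge; apply/negP => /minN; rewrite ltnn.
move=> h; rewrite mulrAC -mulrA ler_wpM2l//; first by lra.
by rewrite ler_pdivlMr// mulrC ltW.
Qed.

Lemma den_expR_le (y : R) N M : y <= (alpha - 1) * lden N -> (N <= M)%N ->
  (den M)%:R * expR y * 2 <= (den M.+1)%:R :> R.
Proof.
have a4 := alpha4.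
move=> h NM; have p := denR_gt0 alpha M.
rewrite -ler_ln ?posrE ?mulr_gt0 ?expR_gt0 ?denR_gt0//.
rewrite lnM ?posrE ?mulr_gt0 ?expR_gt0// lnM ?posrE ?expR_gt0// expRK.
have := ldenS_ge M; rewrite -/(lden M) -/(lden M.+1).
have : (alpha - 1) * lden N <= (alpha - 1) * lden M.
  by rewrite ler_wpM2l ?lden_mono//; lra.
lra.
Qed.

(** The conclusion [0 < eta] is kept because it yields irrationality when applied to a
    containment. *)
Lemma ln_near (K X eta : R) : 1 <= K * (eta * X) -> 0 < K -> 0 < X ->
  0 < eta /\ - ln eta <= ln K + ln X.
Proof.
move=> h K0 X0.
have e0 : 0 < eta.
  have : 0 < K * (eta * X) by apply: lt_le_trans h.
  by rewrite pmulr_rgt0// pmulr_lgt0.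
split => //; have : ln 1 <= ln (K * (eta * X)).
  by rewrite ler_ln ?posrE// (lt_le_trans _ h).
rewrite ln1 lnM ?posrE ?mulr_gt0// lnM ?posrE//; lra.
Qed.

End LogBounds.

(** * No rational subspace beats the exponent *)

Section NearBounds.
Context {R : realType} (alpha : R) (q d : nat) (q0 : (0 < q)%N) (d0 : (0 < d)%N).
Context (alpha4d : 4 * d%:R <= alpha).
Local Notation den := (den alpha).
Local Notation xi := (xi alpha q).
Local Notation lden := (lden alpha).
Local Notation limsp := (limsp alpha q d).
Implicit Types (B : {vspace 'rV[R]_(q.+1 * d)}).

Lemma d_ge1 : 1 <= d%:R :> R.
Proof. by rewrite ler1n. Qed.

Lemma alpha_ge4 : 4 <= alpha.
Proof. have := alpha4d; have := d_ge1; lra. Qed.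

Definition exponent (Q r : nat) : R :=
  alpha ^+ Q.+1 / (r%:R + (d%:R - r%:R) * alpha).

Lemma exponent_den_gt0 r : (r < d)%N -> 0 < r%:R + (d%:R - r%:R) * alpha.
Proof.
move=> rd; have a4 := alpha_ge4.
apply: ltr_wpDl => //; apply: mulr_gt0; last by lra.
by rewrite subr_gt0 ltr_nat.
Qed.

Lemma exponent_ge (Q r : nat) : (r < d)%N ->
  alpha ^+ Q / d%:R <= exponent Q r.
Proof.
move=> rd; have a4 := alpha_ge4; have d1 := d_ge1.
have D0 := exponent_den_gt0 rd.
have p : 0 < alpha ^+ Q by rewrite exprn_gt0//; lra.
rewrite /exponent ler_pdivlMr// mulrAC ler_pdivrMr; last by lra.
rewrite exprSr -!mulrA ler_pM2l// mulrC.
have r0 : 0 <= r%:R :> R by [].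
have : r%:R * 1 <= r%:R * alpha by rewrite ler_wpM2l//; lra.
lra.
Qed.

(** The left side is the exponent obtained when the window is not contained in [B]. Here
    [4 * d <= alpha] is used: [alpha / (alpha - 1) <= 2] and [4 <= alpha / d] reduce it to
    [1 + 2 x <= 4 x] for [x >= 1]. *)
Lemma exponent_ge1 (Q r : nat) : (r < d)%N ->
  1 + alpha ^+ Q * (alpha / (alpha - 1)) <= exponent Q.+1 r.
Proof.
move=> rd; apply: le_trans (exponent_ge _ rd).
have a4 := alpha_ge4; have d1 := d_ge1; have a4d := alpha4d.
have p : 1 <= alpha ^+ Q by rewrite exprn_ege1//; lra.
have h1 : alpha / (alpha - 1) <= 2 by rewrite ler_pdivrMr; lra.
have h2 : 4 <= alpha / d%:R by rewrite ler_pdivlMr//; lra.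
rewrite exprSr -mulrA.
have h3 : alpha ^+ Q * (alpha / (alpha - 1)) <= alpha ^+ Q * 2 by rewrite ler_pM2l//; lra.
have h4 : alpha ^+ Q * 4 <= alpha ^+ Q * (alpha / d%:R) by rewrite ler_pM2l//; lra.
lra.
Qed.

Lemma le_ln (x y : R) : 0 < x -> x <= y -> ln x <= ln y.
Proof. by move=> x0 xy; rewrite ler_ln ?posrE// (lt_le_trans x0). Qed.

Lemma ln_exp (x : R) k : 0 < x -> ln (x ^+ k) = k%:R * ln x.
Proof. by move=> x0; rewrite lnXn// mulr_natl. Qed.

Lemma ln_denX N k : ln ((den N)%:R ^+ k : R) = k%:R * lden N.
Proof. by rewrite ln_exp ?denR_gt0. Qed.

Lemma height_gt0 B : rational_subspace B -> 0 < height B.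
Proof. by move=> rB; apply: lt_le_trans (height_ge1 rB). Qed.

Lemma ln_height_ge0 B : rational_subspace B -> 0 <= ln (height B).
Proof. by move=> rB; rewrite ln_ge0// height_ge1. Qed.

Lemma ln_fact_ge0 k : 0 <= ln (k`!%:R : R).
Proof. by rewrite ln_ge0// ler1n fact_gt0. Qed.

(** For [r = 0] the space is [Wsp N Q] itself, and for [N = 0] the left side vanishes. Otherwise
    [height_ge_Wsp] applies one index lower, [lden N] being [lden N.+1 / alpha] up to a constant. *)
Lemma ln_height_ge_Wsp Q r : (0 < Q)%N -> (r < d)%N -> (Q * d + r <= q * d)%N ->
  exists2 C, 0 <= C & forall B N, rational_subspace B -> \dim B = (Q * d + r)%N ->
    (Wsp alpha q d N Q <= B)%VS ->
    (d%:R - r%:R + r%:R / alpha) * lden N <= ln (height B) + C.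
Proof.
move=> Q0 rd Qrq; have a4 := alpha_ge4; have d1 := d_ge1; have a4d := alpha4d.
have Qq : (Q <= q)%N.
  by rewrite -(leq_pmul2r d0); apply: leq_trans Qrq; rewrite leq_addr.
exists (ln ((Q * d)`!%:R) + ln ((Q.+1 * d)`!%:R) + r%:R / alpha * ln 4).
  apply: addr_ge0; first by apply: addr_ge0; exact: ln_fact_ge0.
  by apply: mulr_ge0; [apply: divr_ge0 => //; lra|exact: ltW ln4_gt0].
move=> B N rB dB WB.
have f1 := ln_fact_ge0 (Q * d); have f2 := ln_fact_ge0 (Q.+1 * d).
have r0 : 0 <= r%:R :> R by [].
have l4 := @ln4_gt0 R.
have ra0 : 0 <= r%:R / alpha by rewrite divr_ge0//; lra.
have h0 := ln_height_ge0 rB; have Hp := height_gt0 rB.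
have ral4 : 0 <= r%:R / alpha * ln 4 by exact: mulr_ge0 ra0 (ltW l4).
have [rz|rnz] := posnP r.
  have WE : Wsp alpha q d N Q = B.
    by apply/eqP; rewrite eqEdim WB dim_Wsp ?dB ?rz ?addn0//= leqW.
  have := @height_Wsp_ge R alpha q d q0 N Q; rewrite Q0 Qq WE => /(_ isT rB).
  move=> /le_ln; rewrite exprn_gt0 ?denR_gt0// => /(_ isT).
  rewrite ln_denX lnM ?posrE ?ltr0n ?fact_gt0//.
  rewrite rz mul0r subr0 addr0; lra.
case: N WB => [|N] WB.
  rewrite lden0 mulr0; lra.
have Qq' : (Q.+1 <= q)%N.
  rewrite -(ltn_pmul2r d0); apply: leq_trans Qrq.
  by rewrite -addn1 leq_add2l.
have p := denR_gt0 alpha N; have p' := denR_gt0 alpha N.+1.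
have dr : (d - r)%:R = d%:R - r%:R :> R by rewrite natrB// ltnW.
have lN := ldenS_le alpha_ge4 N.
have lN' := ldenS_ge alpha_ge4 N.
have l2 := @ln2_gt0 R.
case: (height_ge_Wsp q0 Q0 Qq' rd rB WB dB) => /le_ln.
  rewrite mulr_gt0 ?exprn_gt0// => /(_ isT).
  rewrite lnM ?posrE ?exprn_gt0// lnM ?posrE ?exprn_gt0// ?mulr_gt0 ?ltr0n ?fact_gt0//.
  rewrite lnM ?posrE ?ltr0n ?fact_gt0// !ln_denX dr => h.
  have : r%:R / alpha * lden N.+1 <= r%:R / alpha * (alpha * lden N + ln 4).
    by rewrite ler_wpM2l.
  have -> : r%:R / alpha * (alpha * lden N + ln 4) =
      r%:R * lden N + r%:R / alpha * ln 4 by field; lra.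
  lra.
rewrite exprn_gt0// => /(_ isT); rewrite lnM ?posrE ?exprn_gt0// !ln_denX.
rewrite -natr1 dr => h.
have s1 : 1 <= d%:R - r%:R + 1 :> R by rewrite lerDr subr_ge0 ler_nat ltnW.
have lNa : lden N <= lden N.+1 / alpha.
  rewrite ler_pdivlMr; first by rewrite mulrC; lra.
  by lra.
have h1 : (d%:R - r%:R + 1) * lden N <= (d%:R - r%:R + 1) * (lden N.+1 / alpha).
  by rewrite ler_wpM2l//; lra.
suff : (d%:R - r%:R + r%:R / alpha) * lden N.+1 <=
    (d%:R - r%:R + 1) * lden N.+1 - (d%:R - r%:R + 1) * (lden N.+1 / alpha) by lra.
have -> : (d%:R - r%:R + 1) * lden N.+1 - (d%:R - r%:R + 1) * (lden N.+1 / alpha) =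
    (d%:R - r%:R + 1 - (d%:R - r%:R + 1) / alpha) * lden N.+1 by ring.
rewrite ler_wpM2r ?lden_ge0// -subr_ge0.
(* The second alternative is harmless because [alpha >= d + 1]. *)
have -> : d%:R - r%:R + 1 - (d%:R - r%:R + 1) / alpha - (d%:R - r%:R + r%:R / alpha) =
    (alpha - (d%:R + 1)) / alpha by field; lra.
by rewrite divr_ge0//; lra.
Qed.

(** If [B] contains the window chosen from its height, [den_le_near] and [ln_height_ge_Wsp] give
    exactly the exponent. If it misses a generator, [notin_le_near] gives a smaller one, by
    [exponent_ge1]. *)
Lemma near_bound_high Q r : (0 < Q)%N -> (r < d)%N -> (Q * d + r <= q * d)%N ->
  exists C, forall B (eta : R), rational_subspace B -> \dim B = (Q * d + r)%N ->
    (forall x, x \in limsp -> exists2 b, b \in B & enorm (x - b) <= eta * enorm x) ->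
    0 < eta /\ - ln eta <= exponent Q r * ln (height B) + C.
Proof.
move=> Q0 rd Qrq; have a4 := alpha_ge4; have d1 := d_ge1; have a4d := alpha4d.
have Qq : (Q <= q)%N.
  by rewrite -(leq_pmul2r d0); apply: leq_trans Qrq; rewrite leq_addr.
have [C2 C20 hC2] := ln_height_ge_Wsp Q0 rd Qrq.
(* From here on [Q] is one less than in the statement, and the window is [N, ..., N + Q]. *)
case: Q Q0 Qrq Qq hC2 => // Q _ Qrq Qq hC2.
have [C1 C10 hC1] := lden_add_le a4 Q.
have [C3 C30 hC3] := lden_add_le a4 Q.+1.
pose k : R := ln (2 * q.+1%:R).
have q1 : 1 <= q.+1%:R :> R by rewrite ler1n.
have k0 : 0 <= k by rewrite ln_ge0//; lra.
set mu := exponent Q.+1 r.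
have l4 := @ln4_gt0 R.
have mu0 : 0 <= mu.
  have : 0 <= alpha ^+ Q * (alpha / (alpha - 1)).
    by rewrite mulr_ge0 ?exprn_ge0 ?divr_ge0//; lra.
  by have := exponent_ge1 Q rd; rewrite -/mu; lra.
have aQ : 0 <= alpha ^+ Q by rewrite exprn_ge0//; lra.
have aa : 0 <= alpha / (alpha - 1) by rewrite divr_ge0//; lra.
pose CI := k + alpha ^+ Q * (alpha / (alpha - 1) * k + ln 4) + C1.
pose CII := k + mu * C2 + C3.
have CI0 : 0 <= CI.
  by rewrite !addr_ge0// mulr_ge0// addr_ge0 ?(ltW l4)// mulr_ge0.
have CII0 : 0 <= CII by rewrite !addr_ge0// mulr_ge0.
exists (CI + CII) => B eta rB dB near.
have h0 := ln_height_ge0 rB; have Hp := height_gt0 rB.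
(* The shift [k] of the log-height makes the contribution of [limxi - xi M] at most one half,
   leaving the other half to [eta]. *)
have [N [yN lN]] := lden_choice a4 (addr_ge0 h0 k0).
have muh : (1 + alpha ^+ Q * (alpha / (alpha - 1))) * ln (height B) <= mu * ln (height B).
  by rewrite ler_wpM2r// exponent_ge1.
have [WB|WB] := boolP (Wsp alpha q d N Q.+1 <= B)%VS.
  have dB' : (\dim B < Q.+2 * d)%N by rewrite dB mulSn addnC ltn_add2r.
  have /andP Qqq := conj (ltn0Sn Q) Qq.
  have [||e0 he] := ln_near (den_le_near q0 Qqq WB dB' near).
  - by rewrite mulr_gt0.
  - exact: denR_gt0.
  split => //; have := hC3 N; have := hC2 B N rB dB WB; rewrite -/(lden _) in he => hh h3.
  have : mu * ((d%:R - r%:R + r%:R / alpha) * lden N) <= mu * (ln (height B) + C2).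
    by rewrite ler_wpM2l.
  have D0 := exponent_den_gt0 rd.
  have -> : mu * ((d%:R - r%:R + r%:R / alpha) * lden N) = alpha ^+ Q.+1 * lden N.
    rewrite /mu /exponent [alpha ^+ Q.+2]exprSr; field.
    by rewrite gt_eqF//=; lra.
  rewrite -/k in he; rewrite /CII; lra.
have [M [j [NM MQ xB]]] : exists M j, [/\ (N <= M)%N, (M <= N + Q)%N &
    @intmx R _ _ (tens (numer alpha q M) (delta_mx 0 j)) \notin B].
  apply: contrapT => H; case/negP: WB; apply/Wsp_subP => i iQ.
  rewrite -span_gens; apply/span_subvP => _ /mapP[_ /mapP[j _ ->] ->].
  apply: contrapT => /negP jB; apply: H; exists (N + i)%N, j.
  by split; rewrite ?leq_addr// leq_add2l -ltnS.
have hn := notin_le_near q0 rB xB near.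
have p := denR_gt0 alpha M; have p' := denR_gt0 alpha M.+1.
have := den_expR_le a4 yN NM; rewrite expRD lnK ?posrE// lnK ?posrE; last by rewrite mulr_gt0.
move=> hden.
have half : q.+1%:R * height B * ((den M)%:R * (2 / (den M.+1)%:R)) <= 2^-1.
  have -> : q.+1%:R * height B * ((den M)%:R * (2 / (den M.+1)%:R)) =
    ((den M)%:R * (height B * (2 * q.+1%:R)) * 2) / (den M.+1)%:R / 2.
    by field; rewrite gt_eqF.
  by rewrite -[leRHS]mul1r ler_pM2r ?invr_gt0// ler_pdivrMr// mul1r.
have hn2 : 1 <= 2 * q.+1%:R * (eta * (height B * (den M)%:R)).
  move: hn half; rewrite !mulrDr; lra.
have [||e0 he] := ln_near hn2; [by rewrite mulr_gt0|by rewrite mulr_gt0|].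
split => //; move: he; rewrite -/k lnM ?posrE// -/(lden M) => he.
have lM : lden M <= lden (N + Q) by apply: lden_mono.
have lM2 := hC1 N.
have : alpha ^+ Q * lden N <= alpha ^+ Q * (alpha / (alpha - 1) * (ln (height B) + k) + ln 4).
  by rewrite ler_wpM2l.
rewrite /CI; lra.
Qed.

(** Either [eta] is bounded below, or [B] lies in one line and the exponent is exact, or the
    exponent is at most [1 + alpha / (alpha - 1) <= 3], below [alpha / e]. *)
Lemma near_bound_low e : (0 < e)%N -> (e < d)%N ->
  exists C, forall B (eta : R), rational_subspace B -> \dim B = e ->
    (forall b, b \in B -> exists2 x, x \in limsp & enorm (x - b) <= eta * enorm b) ->
    0 < eta /\ - ln eta <= alpha / e%:R * ln (height B) + C.
Proof.
move=> e0 ed; have a4 := alpha_ge4; have d1 := d_ge1; have a4d := alpha4d.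
have e1 : 1 <= e%:R :> R by rewrite ler1n.
have ed' : e%:R <= d%:R :> R by rewrite ler_nat ltnW.
have q1 : 1 <= q.+1%:R :> R by rewrite ler1n.
have q2 : q.+2%:R = q.+1%:R + 1 :> R by rewrite natr1.
have fg : 1 <= e`!%:R :> R by rewrite ler1n fact_gt0.
pose k : R := ln (4 * e`!%:R).
have k0 : 0 <= k by rewrite ln_ge0//; lra.
have l4 := @ln4_gt0 R.
have mu4 : 4 <= alpha / e%:R by rewrite ler_pdivlMr; lra.
have aa : alpha / (alpha - 1) <= 2 by rewrite ler_pdivrMr; lra.
have aa0 : 0 <= alpha / (alpha - 1) by rewrite divr_ge0//; lra.
pose C0 : R := ln (2 * q.+2%:R).
pose CI := k + (alpha / (alpha - 1) * k + ln 4).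
pose CII := ln (4 * q.+1%:R) + alpha / e%:R * ln (e`!%:R) + ln 4.
have C00 : 0 <= C0 by rewrite ln_ge0// q2; lra.
have CI0 : 0 <= CI by rewrite !addr_ge0 ?(ltW l4)// mulr_ge0.
have CII0 : 0 <= CII.
  rewrite !addr_ge0 ?(ltW l4)//; first by rewrite ln_ge0//; lra.
  by rewrite mulr_ge0 ?ln_fact_ge0//; lra.
exists (C0 + CI + CII) => B eta rB dB near.
have h0 := ln_height_ge0 rB; have Hp := height_gt0 rB.
have muh : 4 * ln (height B) <= alpha / e%:R * ln (height B) by rewrite ler_wpM2r.
have [big|small] := lerP 1 (2 * q.+2%:R * (eta * 1)).
  have [||et0 he] := ln_near big; [by rewrite mulr_gt0|by []|].
  split => //; rewrite ln1 addr0 -/C0 in he; lra.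
have eta0 : 0 <= eta.
  have [x xV hx] := near _ (memv_pick B).
  have := le_trans (enorm_ge0 _) hx; rewrite pmulr_lge0//.
  by rewrite enorm_gt0 vpick0 -dimv_eq0 dB -lt0n.
have t1 : q.+2%:R * eta < 2^-1 by move: small; rewrite mulr1; lra.
have t2 : eta <= 1.
  have : eta * 1 <= eta * q.+2%:R by rewrite ler_wpM2l// q2; lra.
  lra.
have [N [yN lN]] := lden_choice a4 (addr_ge0 h0 k0).
have p := denR_gt0 alpha N; have p' := denR_gt0 alpha N.+1.
have t1' : q.+2%:R * eta < 1 by lra.
have [BV|] := subsp_or_near q0 N rB dB t1' t2 near.
  have dB0 : (0 < \dim B)%N by rewrite dB.
  have t3 : q.+1%:R * eta <= 2^-1 by move: t1; rewrite q2; lra.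
  have [||et0 he] := ln_near (den_le_near_lineT q0 dB0 t3 BV near).
  - by rewrite mulr_gt0.
  - exact: denR_gt0.
  split => //; rewrite -/(lden _) in he.
  have := height_ge_lineT q0 rB dB BV; move=> /le_ln; rewrite exprn_gt0// => /(_ isT).
  rewrite ln_denX lnM ?posrE ?ltr0n ?fact_gt0// => hl.
  have := ldenS_le a4 N.
  have : alpha / e%:R * (e%:R * lden N) <= alpha / e%:R * (ln e`!%:R + ln (height B)).
    by rewrite ler_wpM2l//; lra.
  rewrite mulrA divfK; last by rewrite gt_eqF; lra.
  rewrite /CII; lra.
rewrite ger0_norm => [hn|]; last first.
  by rewrite mulr_ge0 ?addr_ge0 ?divr_ge0 ?mulr_ge0// ltW.
have := den_expR_le a4 yN (leqnn _); rewrite expRD lnK ?posrE// lnK ?posrE; last by rewrite mulr_gt0//; lra.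
move=> hden.
have half : e`!%:R * height B * ((den N)%:R * (4 / (den N.+1)%:R)) <= 2^-1.
  have -> : e`!%:R * height B * ((den N)%:R * (4 / (den N.+1)%:R)) =
    ((den N)%:R * (height B * (4 * e`!%:R)) * 2) / (den N.+1)%:R / 2.
    by field; rewrite gt_eqF.
  by rewrite -[leRHS]mul1r ler_pM2r ?invr_gt0// ler_pdivrMr// mul1r.
have hn2 : 1 <= 4 * e`!%:R * (eta * (height B * (den N)%:R)).
  move: hn half; rewrite !mulrDr; lra.
have [||et0 he] := ln_near hn2; [by rewrite mulr_gt0//; lra|by rewrite mulr_gt0|].
split => //; move: he; rewrite -/k lnM ?posrE// -/(lden N) => he.
have : alpha / (alpha - 1) * ln (height B) <= 2 * ln (height B) by rewrite ler_wpM2r.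
move: lN; rewrite mulrDr /CI; lra.
Qed.

End NearBounds.

(** * The good approximations *)

Section GoodSubspaces.
Context {R : realType} (alpha : R) (q d : nat) (q0 : (0 < q)%N).
Local Notation den := (den alpha).
Local Notation xi := (xi alpha q).
Local Notation lden := (lden alpha).
Local Notation limxi := (limxi alpha q).
Local Notation limsp := (limsp alpha q d).
Local Notation Wsp := (Wsp alpha q d).
Local Notation zmx := (@intmx R _ _).
Implicit Types (B : {vspace 'rV[R]_(q.+1 * d)}).

Lemma rational_zero : rational_subspace (0%VS : {vspace 'rV[R]_(q.+1 * d)}) /\
  height (0%VS : {vspace 'rV[R]_(q.+1 * d)}) = 1.
Proof.
have [||r0 h] := @height_le_gram R _ (0%VS : {vspace 'rV[R]_(q.+1 * d)}) 0 0 (dimv0 _).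
- by rewrite row_free_gram /gram det_mx00 oner_eq0.
- by case.
split => //; apply/eqP; rewrite eq_le height_ge1// andbT.
rewrite -(@ler_pXn2r _ 2)// ?nnegrE ?height_ge0// expr1n.
by apply: (le_trans h); rewrite /gram det_mx00.
Qed.

Lemma mem_gens_xi N (x : 'rV[int]_(q.+1 * d)) : x \in gens alpha q d N ->
  exists j : 'I_d, zmx x = (den N)%:R *: tens (xi N) (delta_mx 0 j).
Proof. by move=> /mapP[j _ ->]; exists j; rewrite zmx_gen. Qed.

Lemma size_gens N : size (gens alpha q d N) = d.
Proof. by rewrite size_map size_enum_ord. Qed.

(* Adding the [r] first generators of a line of vectors raises the dimension by
   exactly [r], since adding all [d] of them raises it by [d]. *)
Lemma add_take_gens B N r (rho : R) : (r <= d)%N -> rational_subspace B -> 0 <= rho ->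
  \dim (B + lineT (xi N))%VS = (\dim B + d)%N ->
  (forall x, x \in gens alpha q d N -> exists2 y, y \in B & enorm (zmx x - y) <= rho) ->
  let B' := (B + <<map zmx (take r (gens alpha q d N))>>)%VS in
  [/\ rational_subspace B', \dim B' = (\dim B + r)%N &
      height B' <= rho ^+ r * height B].
Proof.
move=> rd rB rho0 dBN near B'.
have [|s [rB' dB' ss hB']] := @height_add_seq R _ B (take r (gens alpha q d N)) rho rB rho0.
  by move=> x /mem_take; exact: near.
suff sr : s = r by rewrite sr in dB' hB'.
apply/eqP; rewrite eqn_leq; apply/andP; split.
  by move: ss; rewrite size_takel ?size_gens.
have sp : (B + lineT (xi N) = B' + <<map zmx (drop r (gens alpha q d N))>>)%VS.
  by rewrite /B' -addvA -span_cat -map_cat cat_take_drop span_gens.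
have h1 := dim_span (map zmx (drop r (gens alpha q d N))).
rewrite size_map size_drop size_gens in h1.
have h2 : (\dim B + d <= \dim B + (s + (d - r)))%N.
  rewrite -dBN sp; apply: (leq_trans (dimv_add_leqif _ _)).
  by rewrite dB' addnA leq_add2l.
by rewrite leq_add2l in h2; move: h2 rd; lia.
Qed.

Lemma height_lineT_le N r : (r <= d)%N ->
  let B := (0 + <<map zmx (take r (gens alpha q d N))>>)%VS in
  [/\ rational_subspace B, \dim B = r & height B <= (q.+1%:R * (den N)%:R) ^+ r].
Proof.
move=> rd B; have [rz hz] := rational_zero.
have r0 : 0 <= q.+1%:R * (den N)%:R :> R by rewrite mulr_ge0.
have [||rB dB hB] := @add_take_gens 0%VS N r (q.+1%:R * (den N)%:R) rd rz r0.
- by rewrite add0v dimv0 dim_lineT// xi_neq0.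
- move=> x /mem_gens_xi[j ->]; exists 0; first exact: mem0v.
  rewrite subr0 enormZ enorm_tens enorm_delta mulr1 mulrC ger0_norm//.
  by rewrite ler_wpM2r// enorm_xi_le.
by split => //; [rewrite dB dimv0|rewrite hz mulr1 in hB].
Qed.

(** After the first line, each new generator is at distance at most 1 from a multiple of the
    corresponding generator of the preceding line, so the height does not grow. *)
Lemma height_Wsp_le N Q : (0 < Q)%N -> (Q <= q.+1)%N ->
  rational_subspace (Wsp N Q) /\ height (Wsp N Q) <= (q.+1%:R * (den N)%:R) ^+ d.
Proof.
case: Q => // Q _; elim: Q => [|Q IH] Qq.
  have [rB _ hB] := height_lineT_le N (leqnn d).
  rewrite take_oversize ?size_gens// span_gens in rB hB.
  by rewrite WspS Wsp0 addn0.
have [rW hW] := IH (ltnW Qq).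
have [||rB _ hB] := @add_take_gens (Wsp N Q.+1) (N + Q.+1) d 1 (leqnn d) rW ler01.
- by rewrite -WspS !dim_Wsp// ?(ltnW Qq)// [in LHS]mulSn addnC.
- move=> x /mem_gens_xi[j ->].
  exists ((den (N + Q.+1))%:R *: tens (xi (N + Q)) (delta_mx 0 j)).
    apply: memvZ; rewrite WspS; apply: (subvP (addvSr _ _)).
    by apply/mem_lineT; exists (delta_mx 0 j).
  rewrite -scalerBr -tensBl enormZ enorm_tens enorm_delta mulr1 addnS enorm_xiS.
  by rewrite ger0_norm// mulfV ?denR_neq0.
rewrite take_oversize ?size_gens// span_gens -WspS in rB hB.
by split => //; apply: (le_trans hB); rewrite expr1n mul1r.
Qed.

(** The window starts at [N.+1]. The [r] extra vectors have index [N] and lie at distance at most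
    [den N / den N.+1] from it, so they lower the bound on the height. *)
Lemma good_subspace_high N Q r : (0 < Q)%N -> (Q.+1 <= q.+1)%N -> (r <= d)%N ->
  exists B, [/\ rational_subspace B, \dim B = (Q * d + r)%N,
    height B <= ((den N)%:R / (den N.+1)%:R) ^+ r * (q.+1%:R * (den N.+1)%:R) ^+ d &
    forall x, x \in limsp -> exists2 b, b \in B &
      enorm (x - b) <= 2 * q.+1%:R / (den (N.+1 + Q))%:R * enorm x].
Proof.
move=> Q0 Qq rd; have [rW hW] := @height_Wsp_le N.+1 Q Q0 (ltnW Qq).
pose rho : R := (den N)%:R / (den N.+1)%:R.
have rho0 : 0 <= rho by rewrite divr_ge0.
have [||rB dB hB] := @add_take_gens (Wsp N.+1 Q) N r rho rd rW rho0.
- by rewrite addvC -WspSl !dim_Wsp// ?(ltnW Qq)// mulSn addnC.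
- move=> x /mem_gens_xi[j ->].
  exists ((den N)%:R *: tens (xi N.+1) (delta_mx 0 j)).
    apply: memvZ; apply: (subvP (lineT_sub_Wsp alpha q d N.+1 Q0)).
    by rewrite addn0; apply/mem_lineT; exists (delta_mx 0 j).
  rewrite -scalerBr -tensBl enormZ enorm_tens enormBC enorm_xiS.
  by rewrite enorm_delta mulr1 ger0_norm.
exists (Wsp N.+1 Q + <<map zmx (take r (gens alpha q d N))>>)%VS; split => //.
- by rewrite dB dim_Wsp// ltnW.
- apply: (le_trans hB); rewrite ler_wpM2l// exprn_ge0//.
move=> _ /mem_lineT[v ->]; exists (tens (xi (N + Q)) v).
  apply: (subvP (addvSl _ _)); case: Q Q0 Qq {rW hW dB rB hB} => // Q _ Qq.
  rewrite WspS; apply: (subvP (addvSr _ _)); rewrite addnS -addSn.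
  by apply/mem_lineT; exists v.
rewrite -tensBl !enorm_tens addSn.
apply: (@le_trans _ _ (q.+1%:R * (2 / (den (N + Q).+1)%:R) * enorm v)).
  by rewrite ler_wpM2r ?enorm_ge0// enorm_xi_lim.
rewrite mulrA (mulrC q.+1%:R) ler_wpM2l ?divr_ge0 ?mulr_ge0//.
by rewrite ler_peMl ?enorm_ge0// enorm_limxi_ge.
Qed.

Lemma enorm_xi_ge N : 1 <= enorm (xi N).
Proof. by have := coord_le_enorm (xi N) 0; rewrite xi_coord0// normr1. Qed.

Lemma good_subspace_low N e : (e <= d)%N ->
  exists B, [/\ rational_subspace B, \dim B = e,
    height B <= (q.+1%:R * (den N)%:R) ^+ e &
    forall b, b \in B -> exists2 x, x \in limsp &
      enorm (b - x) <= 2 * q.+1%:R / (den N.+1)%:R * enorm b].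
Proof.
move=> ed; have [rB dB hB] := height_lineT_le N ed.
exists (0 + <<map zmx (take e (gens alpha q d N))>>)%VS; split => // b bB.
have : b \in lineT (xi N).
  apply: (subvP _ _ bB); rewrite add0v -span_gens; apply: sub_span => x.
  by move=> /mapP[y /mem_take yg ->]; apply: map_f.
move=> /mem_lineT[v ->]; exists (tens limxi v); first by apply/mem_lineT; exists v.
rewrite enormBC -tensBl !enorm_tens.
apply: (@le_trans _ _ (q.+1%:R * (2 / (den N.+1)%:R) * enorm v)).
  by rewrite ler_wpM2r ?enorm_ge0// enorm_xi_lim.
rewrite mulrA (mulrC q.+1%:R) ler_wpM2l ?divr_ge0 ?mulr_ge0//.
by rewrite ler_peMl ?enorm_ge0// enorm_xi_ge.
Qed.

End GoodSubspaces.

(** * From two-sided estimates to the exponent *)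

Section ExponentCriterion.
Context {R : realType} {n : nat}.
Implicit Types (A B : {vspace 'rV[R]_n}).
Local Open Scope classical_set_scope.
Local Open Scope ring_scope.

(** Above [mu], the lower bound on [psi] bounds the height, and [Northcott] concludes. Below [mu], a
    finite set would keep the positive numbers [psi] away from 0, while the given family makes them
    arbitrarily small. *)
Lemma mu_exponentE A (e j : nat) (mu kappa C C' : R) (l : nat -> R) :
  0 < mu -> 0 < kappa -> (forall M : R, exists N, M <= l N) ->
  (forall B, rational_subspaces e B ->
    0 < psi A B j /\ - ln (psi A B j) <= mu * ln (height B) + C) ->
  (forall N, exists B (eta : R), [/\ rational_subspaces e B, 0 < eta,
     ln (height B) <= kappa * l N + C', mu * kappa * l N - C' <= - ln eta &
     eta < 1 -> psi A B j <= eta]) ->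
  mu_exponent A e j = mu%:E.
Proof.
move=> mu0 ka0 lunb low up.
have lnH B : rational_subspaces e B -> 1 <= height B /\ 0 <= ln (height B).
  by move=> [rB _]; rewrite ln_ge0 ?height_ge1.
have powE B (m : R) : rational_subspaces e B ->
    (psi A B j <= height B `^ (- m)) = (m * ln (height B) <= - ln (psi A B j)).
  move=> rB; have [p0 _] := low B rB; have [H1 _] := lnH B rB.
  have H0 : 0 < height B by apply: lt_le_trans H1.
  by rewrite -ler_ln ?posrE ?powR_gt0// ln_powR mulNr lerNr.
set S := fun m : R => [set B | rational_subspaces e B /\ psi A B j <= height B `^ (- m)].
have finS m : mu < m -> finite_set (S m).
  move=> mum; apply: (sub_finite_set _ (Northcott e (expR (C / (m - mu))))) => B [rB].
  rewrite powE// => h; split => //; have [H1 _] := lnH B rB.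
  have [_ h'] := low B rB; have H0 : 0 < height B by apply: lt_le_trans H1.
  rewrite -[leLHS]lnK ?posrE// ler_expR ler_pdivlMr ?subr_gt0//.
  lra.
have infS m : 0 < m -> m < mu -> infinite_set (S m).
  move=> m0 mmu /finite_seqP[s sE].
  pose T : R := \sum_(B <- s) `|ln (psi A B j)|.
  have Tb B : S m B -> - ln (psi A B j) <= T.
    rewrite sE /= => Bs; rewrite /T (big_rem _ Bs) /=.
    apply: (@le_trans _ _ `|ln (psi A B j)|); first by rewrite -normrN ler_norm.
    by rewrite lerDl sumr_ge0.
  (* The first term ensures that [B] satisfies the inequality with exponent [m], the second that
     [- ln eta] exceeds [T]. *)
  have [N hN] := lunb ((T + 1 + `|C'| * (1 + mu)) / (kappa * (mu - m)) + (T + 1 + `|C'|) / (kappa * mu)).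
  have T0 : 0 <= T by rewrite sumr_ge0.
  have C0 := normr_ge0 C'; have CC := ler_norm C'.
  have p1 : 0 < kappa * (mu - m) by rewrite mulr_gt0// subr_gt0.
  have p2 : 0 < kappa * mu by rewrite mulr_gt0.
  have cm : 0 <= `|C'| * (1 + mu) by rewrite mulr_ge0//; lra.
  have h1 : T + 1 + `|C'| * (1 + mu) <= l N * (kappa * (mu - m)).
    rewrite -ler_pdivrMr//; apply: le_trans hN; rewrite lerDl divr_ge0//; last by apply: ltW.
    by lra.
  have h2 : T + 1 + `|C'| <= l N * (kappa * mu).
    rewrite -ler_pdivrMr//; apply: le_trans hN; rewrite lerDr divr_ge0//; last by apply: ltW.
    by lra.
  have [B [eta [rB e0 hH he hp]]] := up N.
  have eta1 : eta < 1.
    rewrite -ltr_ln ?posrE// ln1; lra.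
  have [p0 _] := low B rB.
  have hpl : - ln eta <= - ln (psi A B j) by rewrite lerN2 ler_ln ?posrE// hp.
  have SB : S m B.
    split => //; rewrite powE//; apply: le_trans hpl; apply: le_trans he.
    have : m * ln (height B) <= m * (kappa * l N + C') by rewrite ler_pM2l.
    have : m * C' <= mu * `|C'|.
      apply: (@le_trans _ _ (m * `|C'|)); first by rewrite ler_pM2l.
      by rewrite ler_wpM2r// ltW.
    lra.
  have := Tb B SB; lra.
rewrite /mu_exponent; apply/eqP; rewrite eq_le; apply/andP; split.
  apply: ge_ereal_sup => _ [m [m0 iS] <-].
  rewrite lee_fin leNgt; apply/negP => mum; exact: iS (finS m mum).
pose E := [set m : R | 0 < m /\ infinite_set (S m)].
have inS (m : R) : 0 < m -> m < mu -> (m%:E <= ereal_sup [set x%:E | x in E])%E.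
  by move=> m0 mmu; apply: ereal_sup_ubound; exists m => //; split => //; exact: infS.
rewrite -/E; apply/lee_subgt0Pr => eps eps0.
have [le|lt] := lerP mu eps.
  apply: (@le_trans _ _ (mu / 2)%:E); first by rewrite lee_fin; lra.
  by apply: inS; lra.
rewrite -EFinB; apply: inS; lra.
Qed.

End ExponentCriterion.

(** * Exponents and irrationality of the limit subspace *)

Section LimitSubspace.
Context {R : realType} (alpha : R) (q d : nat) (q0 : (0 < q)%N) (d0 : (0 < d)%N).
Context (alpha4d : 4 * d%:R <= alpha).
Local Notation lden := (lden alpha).
Local Notation limsp := (limsp alpha q d).
Implicit Types (B : {vspace 'rV[R]_(q.+1 * d)}).

Lemma dim_limsp : \dim limsp = d.
Proof. by rewrite dim_lineT// limxi_neq0. Qed.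

Lemma lden_unbounded (M : R) : exists N, M <= lden N.
Proof.
have a4 := alpha_ge4 d0 alpha4d.
have [h|h] := lerP M 0; first by exists 0%N; apply: (le_trans h); exact: lden_ge0.
have l2 := @ln2_gt0 R.
exists (Num.truncn (M / ln 2)).+1; apply: le_trans (lden_ge_nat a4 _).
by rewrite -ler_pdivrMr// ltW// truncnS_gt.
Qed.

Lemma lden_add_ge N k : alpha ^+ k * lden N <= lden (N + k).
Proof.
have a4 := alpha_ge4 d0 alpha4d; have l2 := @ln2_gt0 R.
elim: k => [|k IH]; first by rewrite addn0 expr0 mul1r.
rewrite addnS; apply: le_trans (ldenS_ge a4 _).
have : alpha * (alpha ^+ k * lden N) <= alpha * lden (N + k).
  by rewrite ler_wpM2l//; lra.
by rewrite exprS; lra.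
Qed.

Lemma limsp_exponent_high Q r : (0 < Q)%N -> (r < d)%N -> (Q * d + r <= q * d)%N ->
  mu_exponent limsp (Q * d + r) d = (exponent alpha d Q r)%:E.
Proof.
move=> Q0 rd Qrq; have a4 := alpha_ge4 d0 alpha4d; have d1 := @d_ge1 R d d0.
have Qq : (Q <= q)%N.
  by rewrite -(leq_pmul2r d0); apply: leq_trans Qrq; rewrite leq_addr.
have dQ : (0 < \dim limsp <= Q * d + r)%N.
  rewrite dim_limsp d0 /=; apply: (leq_trans (leq_pmull d Q0)); exact: leq_addr.
have [C low] := near_bound_high q0 d0 alpha4d Q0 rd Qrq.
have D0 := exponent_den_gt0 d0 alpha4d rd.
have dr : 1 <= d%:R - r%:R :> R.
  by rewrite -natrB ?(ltnW rd)// ler1n subn_gt0.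
have r0 : 0 <= r%:R / alpha by rewrite divr_ge0//; lra.
have q1 : 1 <= q.+1%:R :> R by rewrite ler1n.
pose kap := d%:R - r%:R + r%:R / alpha.
pose lq := ln (q.+1%:R : R).
pose l2q := ln (2 * q.+1%:R : R).
have lq0 : 0 <= lq by rewrite ln_ge0.
have l2q0 : 0 <= l2q by rewrite ln_ge0//; lra.
have mukap : exponent alpha d Q r * kap = alpha ^+ Q.
  rewrite /exponent /kap exprSr; field.
  by rewrite gt_eqF//=; lra.
(* [kap] is the log-height of the good subspaces in units of [lden N.+1]; [ln d%:R] absorbs the
   dimension factor of [psi_dist]. *)
apply: (@mu_exponentE _ _ _ _ _ _ kap (C + ln d%:R) (d%:R * lq + l2q) (fun N => lden N.+1)).
- by rewrite divr_gt0// exprn_gt0//; lra.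
- by rewrite /kap; lra.
- move=> M; have [N hN] := lden_unbounded M; exists N.
  by apply: (le_trans hN); apply: lden_mono.
- move=> B [rB dB]; have dAB : (0 < \dim limsp <= \dim B)%N by rewrite dB.
  have near := psi_dist dAB; rewrite dim_limsp in near.
  have [e0 he] := low B _ rB dB near.
  have p0 : 0 < psi limsp B d by move: e0; rewrite pmulr_rgt0// ltr0n.
  split => //; move: he; rewrite lnM ?posrE ?ltr0n//; lra.
move=> N; have [B [rB dB hB near]] := good_subspace_high alpha q0 N Q0 Qq (ltnW rd).
have p := denR_gt0 alpha N; have p' := denR_gt0 alpha N.+1; have p2 := denR_gt0 alpha (N.+1 + Q).
exists B, (2 * q.+1%:R / (den alpha (N.+1 + Q))%:R); split => //.
- by rewrite divr_gt0// mulr_gt0.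
- apply: (le_trans (le_ln (height_gt0 rB) hB)).
  rewrite lnM ?posrE ?exprn_gt0 ?divr_gt0 ?mulr_gt0//.
  rewrite !ln_exp ?divr_gt0 ?mulr_gt0// ln_div ?posrE// lnM ?posrE//.
  rewrite -/(lden N) -/(lden N.+1) -/lq.
  have lN : lden N <= lden N.+1 / alpha.
    have := ldenS_ge a4 N; have l2 := @ln2_gt0 R.
    by rewrite ler_pdivlMr; [rewrite mulrC; lra|lra].
  have : r%:R * lden N <= r%:R * (lden N.+1 / alpha) by rewrite ler_wpM2l.
  have -> : kap * lden N.+1 = (d%:R - r%:R) * lden N.+1 + r%:R * (lden N.+1 / alpha).
    by rewrite /kap; ring.
  lra.
- rewrite ln_div ?posrE ?mulr_gt0// -/l2q -/(lden _) mukap.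
  have := lden_add_ge N.+1 Q; have : 0 <= d%:R * lq by rewrite mulr_ge0.
  lra.
move=> eta1; rewrite -[d in psi _ _ d]dim_limsp.
by apply: psi_le => //; rewrite dB.
Qed.

(** The smaller space is now the rational one, so [psiC] exchanges the two before the distance
    estimates are applied. *)
Lemma limsp_exponent_low e : (0 < e)%N -> (e < d)%N ->
  mu_exponent limsp e e = (alpha / e%:R)%:E.
Proof.
move=> e0 ed; have a4 := alpha_ge4 d0 alpha4d; have d1 := @d_ge1 R d d0.
have e1 : 1 <= e%:R :> R by rewrite ler1n.
have [C low] := near_bound_low q0 d0 alpha4d e0 ed.
have q1 : 1 <= q.+1%:R :> R by rewrite ler1n.
pose lq := ln (q.+1%:R : R).
pose l2q := ln (2 * q.+1%:R : R).
have lq0 : 0 <= lq by rewrite ln_ge0.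
have l2q0 : 0 <= l2q by rewrite ln_ge0//; lra.
have dAB B : \dim B = e -> (0 < \dim B <= \dim limsp)%N.
  by move=> ->; rewrite e0 dim_limsp ltnW.
have psiE B : \dim B = e -> psi limsp B e = psi B limsp (\dim B).
  by move=> dB; rewrite dB psiC.
apply: (@mu_exponentE _ _ _ _ _ _ e%:R (C + ln e%:R) (e%:R * lq + l2q) lden).
- by rewrite divr_gt0//; lra.
- by lra.
- exact: lden_unbounded.
- move=> B [rB dB]; have near := psi_dist (dAB B dB); rewrite -psiE// dB in near.
  have [|et0 he] := low B (e%:R * psi limsp B e) rB dB.
    by move=> b /near[x xA hx]; exists x; rewrite // enormBC.
  have p0 : 0 < psi limsp B e by move: et0; rewrite pmulr_rgt0//; lra.
  split => //; move: he; rewrite lnM ?posrE//; lra.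
move=> N; have [B [rB dB hB near]] := good_subspace_low alpha q0 N (ltnW ed).
have p := denR_gt0 alpha N; have p' := denR_gt0 alpha N.+1.
exists B, (2 * q.+1%:R / (den alpha N.+1)%:R); split => //.
- by rewrite divr_gt0// mulr_gt0.
- apply: (le_trans (le_ln (height_gt0 rB) hB)).
  rewrite ln_exp ?mulr_gt0// lnM ?posrE// -/(lden N) -/lq; lra.
- rewrite ln_div ?posrE ?mulr_gt0// -/l2q -/(lden _).
  rewrite divfK; last by rewrite gt_eqF//; lra.
  have := ldenS_ge a4 N; have l2 := @ln2_gt0 R.
  have : 0 <= e%:R * lq by rewrite mulr_ge0.
  lra.
by move=> eta1; rewrite psiE//; apply: psi_le => //; exact: dAB.
Qed.

(** An intersection of dimension [minn d e] would put one space inside the other, and the distance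
    bounds would hold with [eta = 0], although they force [0 < eta]. *)
Lemma limsp_irrational e : (1 <= e <= q * d)%N ->
  irrational_subspaces d e (minn d e) limsp.
Proof.
move=> /andP[e0 eq]; split => [|B [rB dB]]; first exact: dim_limsp.
rewrite ltnNge; apply/negP => h.
have triv A' B' : (A' <= B')%VS -> forall x : 'rV[R]_(q.+1 * d), x \in A' ->
    exists2 b, b \in B' & enorm (x - b) <= 0 * enorm x.
  by move=> AB x xA; exists x; rewrite ?(subvP AB)// subrr enorm0 mul0r.
have [de|ed] := leqP d e.
  have sub : (limsp <= B)%VS.
    rewrite (minn_idPl de) -[d in (d <= _)%N]dim_limsp in h.
    have /eqP <- : (limsp :&: B)%VS == limsp by rewrite eqEdim capvSl h.
    exact: capvSr.
  have rd : (e %% d < d)%N by rewrite ltn_pmod.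
  have Q0 : (0 < e %/ d)%N by rewrite divn_gt0.
  have Qrq : (e %/ d * d + e %% d <= q * d)%N by rewrite -divn_eq.
  have [C low] := near_bound_high q0 d0 alpha4d Q0 rd Qrq.
  rewrite (divn_eq e d) in dB.
  by have [] := low B 0 rB dB (triv _ _ sub); rewrite ltxx.
have sub : (B <= limsp)%VS.
  rewrite (minn_idPr (ltnW ed)) -dB in h.
  have /eqP <- : (limsp :&: B)%VS == B by rewrite eqEdim capvSr h.
  exact: capvSl.
have [C low] := near_bound_low q0 d0 alpha4d e0 ed.
have [] := low B 0 rB dB; last by rewrite ltxx.
by move=> b bB; exists b; rewrite ?(subvP sub)// subrr enorm0 mul0r.
Qed.

End LimitSubspace.

Theorem theorem1p1 (R : realType) (d : nat) (hd : (0 < d)%N) :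
  exists C : R, forall q : nat, (0 < q)%N ->
  let n := (q.+1 * d)%N in
  forall alpha : R, C <= alpha ->
  exists A : {vspace 'rV[R]_n},
    [/\ \dim A = d,
        (forall e : nat, (1 <= e <= n - d)%N ->
           irrational_subspaces d e (minn d e) A),
        (forall e : nat, (d <= e <= n - d)%N ->
           mu_exponent A e d =
             (alpha ^+ (e %/ d).+1 /
                ((e %% d)%:R + (d%:R - (e %% d)%:R) * alpha))%:E)
      & (forall e : nat, (1 <= e <= d - 1)%N ->
           mu_exponent A e e = (alpha / (e %% d)%:R)%:E /\
           alpha / (e %% d)%:R = alpha / e%:R)].
Proof.
exists (4 * d%:R) => q q0 n alpha ha.
have nd : (n - d)%N = (q * d)%N by rewrite /n mulSn addKn.
exists (limsp alpha q d); rewrite nd; split.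
- exact: dim_limsp.
- by move=> e; exact: limsp_irrational.
- move=> e /andP[de eq].
  have := @limsp_exponent_high R alpha q d q0 hd ha (e %/ d) (e %% d).
  by rewrite divn_gt0// de ltn_pmod// -divn_eq eq => /(_ isT isT isT).
move=> e /andP[e0 ed].
have ed' : (e < d)%N by rewrite -ltnS -(prednK hd) -subn1 ltnS in ed *; lia.
by rewrite modn_small//; split => //; exact: limsp_exponent_low.
Qed.
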